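(* Suppose that $$\int_{\mathbb{R}^d}\frac{1}{1+(\Psi(\xi))^{1-\beta_0}}\,\mu(d\xi)<\infty .$$ Then for all $t,\lambda>0$, $$\mathbb{E}\left[\exp\left(\lambda\int_0^t\int_0^t |r-s|^{-\beta_0}\gamma(X_r-X_s)\,ds\,dr\right)\right]<\infty .$$
   Context: Let $d\ge 1$ and $\beta_0\in(0,1)$. $X=\{X_t,t\ge 0\}$ is a symmetric Lévy process in $\mathbb{R}^d$ with $X_0=0$ and characteristic exponent $\Psi$, i.e. $\mathbb{E}\exp(i\xi\cdot X_t)=\exp(-t\Psi(\xi))$; by symmetry $\Psi$ is real-valued and nonnegative. It is assumed that $X$ has transition density functions $q_t(x)$, $t>0$; consequently $\lim_{|\xi|\to\infty}\Psi(\xi)=\infty$. Fourier transform: $\widehat\varphi(\xi)=\int_{\mathbb{R}^d}e^{-i\xi\cdot x}\varphi(x)\,dx$ for $\varphi\in L^1(\mathbb{R}^d)$, extended to tempered distributions $\mathcal{S}'(\mathbb{R}^d)$. $\gamma$ is a symmetric, nonnegative-definite function on $\mathbb{R}^d$ such that: (1) $\gamma$ is nonnegative and locally integrable; (2) its Fourier transform $\widehat\gamma\in\mathcal{S}'(\mathbb{R}^d)$ is a measurable function that is nonnegative almost everywhere; (3) $\gamma:\mathbb{R}^d\to[0,\infty]$ is continuous, where $[0,\infty]$ is the one-point compactification of $[0,\infty)$; (4) either [$\gamma(x)<\infty$ if and only if $x\neq 0$], or [$\widehat\gamma\in L^\infty(\mathbb{R}^d)$ and $\gamma(x)<\infty$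 whenever $x\ne 0$]. The spectral measure is $\mu(d\xi)=\widehat\gamma(\xi)\,d\xi$, a positive tempered measure. *)

(* Defs.v *)
From HB Require Import structures.
From mathcomp Require Import all_boot all_order all_algebra.
From mathcomp Require Import all_classical all_reals all_analysis.
From mathcomp Require Import complex.

Set Implicit Arguments.
Unset Strict Implicit.
Unset Printing Implicit Defensive.

Import Order.TTheory GRing.Theory Num.Theory.
Import numFieldNormedType.Exports.

Local Open Scope classical_set_scope.
Local Open Scope ring_scope.
Local Open Scope complex_scope.

(* The Borel sigma-algebra of R^d, as the one generated by the coordinates. *)
Section measurable_rV.
Context (R : realType) (d : nat).

Let coord : 'I_d -> 'rV[R]_d -> R := fun i x => x ord0 i.

Let rV_set0 : g_sigma_preimage coord set0.
Proof. exact: sigma_algebra0. Qed.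

Let rV_setC A : g_sigma_preimage coord A -> g_sigma_preimage coord (~` A).
Proof. exact: sigma_algebraC. Qed.

Let rV_bigcup (F : (set 'rV[R]_d)^nat) :
  (forall i, g_sigma_preimage coord (F i)) ->
  g_sigma_preimage coord (\bigcup_i (F i)).
Proof. exact: sigma_algebra_bigcup. Qed.

HB.instance Definition _ := @isMeasurable.Build default_measure_display
  'rV[R]_d (g_sigma_preimage coord) rV_set0 rV_setC rV_bigcup.

End measurable_rV.

Section measurable_rV_theory.
Context (R : realType).

Lemma measurable_rV_coord d (i : 'I_d) :
  measurable_fun [set: 'rV[R]_d] (fun x : 'rV[R]_d => x ord0 i).
Proof.
move=> _ Y mY; rewrite setTI; apply: sub_sigma_algebra.
by rewrite -bigcup_seq /=; exists i; [rewrite /= mem_index_enum|exists Y; rewrite ?setTI].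
Qed.

Lemma measurable_fun_rVP d0 (T : measurableType d0) d (f : T -> 'rV[R]_d) :
  (forall i, measurable_fun [set: T] (fun x => f x ord0 i)) ->
  measurable_fun [set: T] f.
Proof.
move=> mf; apply: (@measurability _ _ _ _ setT f
  (\big[setU/set0]_(i < d) preimage_set_system setT
    (fun x : 'rV[R]_d => x ord0 i) measurable)) => //.
move=> _ [C + <-].
rewrite -bigcup_seq => -[i _ [A mA <-]].
by rewrite !setTI -comp_preimage -[X in measurable X]setTI; apply: mf.
Qed.

Definition rV_cons d (p : R * 'rV[R]_d) : 'rV[R]_d.+1 :=
  row_mx (const_mx p.1 : 'rV_1) p.2.

Definition rV_uncons d (x : 'rV[R]_d.+1) : R * 'rV[R]_d :=
  (x ord0 ord0, @rsubmx R 1 1 d x).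

Lemma rV_consK d : cancel (@rV_cons d) (@rV_uncons d).
Proof.
case=> a v; rewrite /rV_uncons /rV_cons row_mxKr; congr pair.
have -> : ord0 = lshift d (ord0 : 'I_1) by exact: val_inj.
by rewrite (@row_mxEl R 1 1 d) mxE.
Qed.

Lemma measurable_rV_cons d : measurable_fun setT (@rV_cons d).
Proof.
apply: measurable_fun_rVP => i; rewrite /rV_cons.
case: (splitP (i : 'I_(1 + d))) => j ij.
- have -> : i = lshift d j by exact: val_inj.
  rewrite (_ : (fun _ => _) = fst); first exact: measurable_fst.
  by apply/funext => x; rewrite (@row_mxEl R 1 1 d) mxE.
- have -> : i = rshift 1 j by exact: val_inj.
  rewrite (_ : (fun _ => _) = (fun v : 'rV[R]_d => v ord0 j) \o snd).
    by apply: measurableT_comp; [exact: measurable_rV_coord|exact: measurable_snd].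
  by apply/funext => x; rewrite (@row_mxEr R 1 1 d).
Qed.

Lemma measurable_rV_uncons d : measurable_fun setT (@rV_uncons d).
Proof.
apply: measurable_fun_pair; first exact: measurable_rV_coord.
apply: measurable_fun_rVP => i.
rewrite (_ : (fun _ => _) = fun x : 'rV[R]_d.+1 => x ord0 (rshift 1 i)).
  exact: measurable_rV_coord.
by apply/funext => x; rewrite mxE.
Qed.

End measurable_rV_theory.


Section lebesgue_rV.
Context (R : realType).
Local Open Scope ereal_scope.

Section step.
Context (d : nat) (m : {sigma_finite_measure set 'rV[R]_d -> \bar R}).

Definition leb_rV_step : set 'rV[R]_d.+1 -> \bar R :=
  pushforward (@lebesgue_measure R \x m) (@rV_cons R d).

HB.instance Definition _ := Measure.copy leb_rV_step
  (measure_function_pushforward__canonical__measure_function_Measure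
     (@lebesgue_measure R \x m) (@measurable_rV_cons R d)).

Let leb_rV_step_sigma_finite : sigma_finite setT leb_rV_step.
Proof.
have /sigma_finiteP[F [TF ndF Foo]] := sigma_finiteT (@lebesgue_measure R).
have /sigma_finiteP[G [TG ndG Goo]] := sigma_finiteT m.
exists (fun n => @rV_uncons R d @^-1` (F n `*` G n)).
  apply/esym; rewrite -subTset => x _.
  have [i _ Fi] : (\bigcup_i F i) (rV_uncons x).1 by rewrite -TF.
  have [j _ Gj] : (\bigcup_i G i) (rV_uncons x).2 by rewrite -TG.
  exists (maxn i j) => //; split.
    by move: Fi; exact/subsetPset/ndF/leq_maxl.
  by move: Gj; exact/subsetPset/ndG/leq_maxr.
move=> n; have [mF oF] := Foo n; have [mG oG] := Goo n; split.
  rewrite -[X in measurable X]setTI; apply: measurable_rV_uncons => //.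
  exact: measurableX.
rewrite /leb_rV_step /pushforward -comp_preimage.
rewrite (_ : _ \o _ = id); last by apply/funext => x; exact: rV_consK.
by rewrite preimage_id product_measure1E// lte_mul_pinfty// ge0_fin_numE.
Qed.

HB.instance Definition _ := Measure_isSigmaFinite.Build _ _ _ leb_rV_step
  leb_rV_step_sigma_finite.

End step.

Fixpoint leb_rV (d : nat) : {sigma_finite_measure set 'rV[R]_d -> \bar R} :=
  match d with
  | 0%N => \d_(0%R : 'rV[R]_0)
  | d'.+1 => leb_rV_step (leb_rV d')
  end.

Lemma leb_rV_box (d : nat) (A : 'I_d -> set R) :
  (forall i, measurable (A i)) ->
  leb_rV d [set x : 'rV[R]_d | forall i, A i (x ord0 i)] =
  \prod_(i < d) lebesgue_measure (A i).
Proof.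
elim: d A => [|d IH] A mA; rewrite /=.
  by rewrite big_ord0 diracE mem_set//= => -[].
rewrite big_ord_recl /leb_rV_step /pushforward.
rewrite (_ : _ @^-1` _ = A ord0 `*`
    [set x : 'rV[R]_d | forall i, A (lift ord0 i) (x ord0 i)]); last first.
  have E0 (p : R * 'rV[R]_d) : rV_cons p ord0 ord0 = p.1.
    by have := rV_consK p; case: p => a v [].
  have ES (p : R * 'rV[R]_d) i : rV_cons p ord0 (lift ord0 i) = p.2 ord0 i.
    rewrite (_ : lift ord0 i = rshift 1 i); last exact: val_inj.
    by rewrite /rV_cons (@row_mxEr R 1 1 d).
  apply/seteqP; split => [p /= h|p /= [h1 h2] i].
    split => [|i]; first by rewrite -E0.
    by rewrite -ES.
  by case: (unliftP ord0 i) => [j|] ->; rewrite ?ES ?E0.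
have mB : measurable [set x : 'rV[R]_d | forall i, A (lift ord0 i) (x ord0 i)].
  rewrite (_ : [set _ | _] = \bigcap_(i in [set: 'I_d])
      ((fun x : 'rV[R]_d => x ord0 i) @^-1` A (lift ord0 i))).
    apply: fin_bigcap_measurable => // i _.
    by rewrite -[X in measurable X]setTI; apply: measurable_rV_coord.
  by apply/seteqP; split => x /= h i; [move=> _|]; exact: h.
rewrite product_measure1E//; last exact: (mA ord0).
by congr (_ * _); exact: IH.
Qed.

End lebesgue_rV.
Arguments leb_rV {R} d.

Section complex_integral.
Context d0 (T : measurableType d0) (R : realType).
Variable mu : {measure set T -> \bar R}.

Definition cintegrable (f : T -> R[i]) : Prop :=
  mu.-integrable setT (fun x => (complex.Re (f x))%:E) /\
  mu.-integrable setT (fun x => (complex.Im (f x))%:E).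

Definition cintegral (f : T -> R[i]) : R[i] :=
  Rintegral mu setT (fun x => complex.Re (f x)) +i*
  Rintegral mu setT (fun x => complex.Im (f x)).

End complex_integral.

Definition dotrV (R : realType) (d : nat) (x y : 'rV[R]_d) : R :=
  \sum_(i < d) x ord0 i * y ord0 i.

Definition expi (R : realType) (a : R) : R[i] := cos a +i* sin a.

Section distributions.
Context (R : realType) (d : nat).
Local Notation rV := 'rV[R]_d.

(* [partials [:: i_1; ..; i_k] f] is d_{i_1} .. d_{i_k} f *)
Definition partials (s : seq 'I_d) (f : rV -> R) : rV -> R :=
  foldr (fun i g => fun x => 'D_(delta_mx ord0 i) g x) f s.

Definition cpartials (s : seq 'I_d) (phi : rV -> R[i]) (x : rV) : R[i] :=
  partials s (fun y => complex.Re (phi y)) x +i*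
  partials s (fun y => complex.Im (phi y)) x.

Definition smooth (f : rV -> R) : Prop :=
  forall (s : seq 'I_d) (x : rV), differentiable (partials s f) x.

Definition csmooth (phi : rV -> R[i]) : Prop :=
  smooth (fun x => complex.Re (phi x)) /\ smooth (fun x => complex.Im (phi x)).

Definition test_function (phi : rV -> R[i]) : Prop :=
  csmooth phi /\
  exists2 K : set rV, compact K & forall x, ~ K x -> phi x = 0.

(* [M] bounds the [N]-th Schwartz seminorm of [phi] *)
Definition schwartz_bound (N : nat) (phi : rV -> R[i]) (M : R) : Prop :=
  forall (s : seq 'I_d) (x : rV), (size s <= N)%N ->
    ((1 + `|x|) ^+ N)%:C * `|cpartials s phi x| <= M%:C.

Definition schwartz (phi : rV -> R[i]) : Prop :=
  csmooth phi /\ forall N, exists M, schwartz_bound N phi M.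

Definition fourier (phi : rV -> R[i]) (xi : rV) : R[i] :=
  cintegral (leb_rV d) (fun x => expi (- dotrV xi x) * phi x).

Definition tempered_distribution (u : (rV -> R[i]) -> R[i]) : Prop :=
  (forall (a : R[i]) (phi psi : rV -> R[i]), schwartz phi -> schwartz psi ->
     u (fun x => a * phi x + psi x) = a * u phi + u psi) /\
  (exists (N : nat) (C : R), forall (phi : rV -> R[i]) (M : R),
     schwartz phi -> schwartz_bound N phi M -> `|u phi| <= (C * M)%:C).

Definition distribution_of (f : rV -> R) (phi : rV -> R[i]) : R[i] :=
  cintegral (leb_rV d) (fun x => (f x)%:C * phi x).

(* [f] is a measurable function belonging to S'(R^d) *)
Definition tempered_function (f : rV -> R) : Prop :=
  [/\ measurable_fun setT f,
      forall phi, schwartz phi ->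
        cintegrable (leb_rV d) (fun x => (f x)%:C * phi x) &
      tempered_distribution (distribution_of f)].

Definition fourier_distribution (u : (rV -> R[i]) -> R[i])
  (phi : rV -> R[i]) : R[i] := u (fourier phi).

(* The function [g] is the Fourier transform in S'(R^d) of the function [f]. *)
Definition is_fourier_transform (f g : rV -> R) : Prop :=
  [/\ tempered_function f, tempered_function g &
      forall phi, schwartz phi ->
        fourier_distribution (distribution_of f) phi = distribution_of g phi].

(* Nonnegative-definiteness in the sense of distributions: pointwise sums
   are meaningless since [f 0] may stand for an infinite value. *)
Definition nonneg_definite (f : rV -> R) : Prop :=
  forall phi, test_function phi ->
    0 <= cintegral (leb_rV d) (fun x => cintegral (leb_rV d) (fun y =>
           (f (x - y))%:C * phi x * conjc (phi y))).

(* [fine] replaces the value +oo, which the last field allows at the origin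
   only, hence on a null set, by 0. *)
Record correlation_function (gamma : rV -> \bar R) (ghat : rV -> R) : Prop := {
  correlation_sym : forall x, gamma (- x) = gamma x ;
  correlation_nonneg_definite : nonneg_definite (fun x => fine (gamma x)) ;
  correlation_ge0 : forall x, (0 <= gamma x)%E ;
  correlation_locally_integrable :
    forall K : set rV, compact K -> (leb_rV d).-integrable K gamma ;
  correlation_fourier : is_fourier_transform (fun x => fine (gamma x)) ghat ;
  correlation_fourier_ge0 : {ae leb_rV d, forall xi, 0 <= ghat xi} ;
  correlation_continuous : continuous gamma ;
  correlation_finite :
    (forall x, (gamma x < +oo)%E <-> x <> 0) \/
    (finite_norm (leb_rV d) +oo%E ghat /\
     forall x, x <> 0 -> (gamma x < +oo)%E)
}.

End distributions.

(* Processes are indexed by [R]; only times t >= 0 are relevant. *)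
Section levy.
Context (R : realType) (d : nat) (dO : measure_display)
  (Omega : measurableType dO) (P : probability Omega R).
Local Notation rV := 'rV[R]_d.
Implicit Type X : R -> Omega -> rV.

Definition independent_increments X : Prop :=
  forall (n : nat) (t : nat -> R), 0 <= t 0%N -> (forall i, t i < t i.+1) ->
  forall A : nat -> set rV, (forall i, measurable (A i)) ->
    P [set w | forall i, (i < n)%N -> A i (X (t i.+1) w - X (t i) w)] =
    (\prod_(i < n) P [set w | A i (X (t i.+1) w - X (t i) w)%R])%E.

Definition stationary_increments X : Prop :=
  forall s t, 0 <= s -> 0 <= t -> forall A : set rV, measurable A ->
    P [set w | A (X (s + t) w - X s w)] = P [set w | A (X t w - X 0 w)].

Definition stochastically_continuous X : Prop :=
  forall t e, 0 <= t -> 0 < e ->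
    P [set w | e < `|X s w - X t w|] @[s --> within [set s | 0 <= s] (nbhs t)]
      --> 0%E.

Definition cadlag (x : R -> rV) : Prop :=
  (forall t, 0 <= t -> x s @[s --> t^'+] --> x t) /\
  (forall t, 0 < t -> cvg (x s @[s --> t^'-])).

Record levy_process X : Prop := {
  levy_measurable : forall t, 0 <= t -> measurable_fun setT (X t) ;
  levy_start : {ae P, forall w, X 0 w = 0} ;
  levy_independent : independent_increments X ;
  levy_stationary : stationary_increments X ;
  levy_stochastically_continuous : stochastically_continuous X ;
  levy_cadlag : {ae P, forall w, cadlag (fun t => X t w)}
}.

Definition symmetric_process X : Prop :=
  forall t, 0 <= t -> forall A : set rV, measurable A ->
    P [set w | A (- X t w)] = P [set w | A (X t w)].

Definition has_transition_densities X : Prop :=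
  exists q : R -> rV -> R, forall t, 0 < t ->
    [/\ measurable_fun setT (q t), forall x, 0 <= q t x &
        forall A : set rV, measurable A ->
          P [set w | A (X t w)] = (\int[leb_rV d]_(x in A) (q t x)%:E)%E].

Definition characteristic_exponent X (Psi : rV -> R) : Prop :=
  forall t xi, 0 <= t ->
    cintegral P (fun w => expi (dotrV xi (X t w))) = (expR (- (t * Psi xi)))%:C.

End levy.

(* Main.v *)
Require Import Defs.
From HB Require Import structures.
From mathcomp Require Import all_boot all_order all_algebra.
From mathcomp Require Import all_classical all_reals all_analysis.
From mathcomp Require Import complex measurable_realfun.
From mathcomp Require Import ring lra.

(** The exponential moment is finite because, seen from a fixed last time, the
    contributions of earlier times are controlled by independent increments.

    Bound for one increment. Since [gamma] is nonnegative and continuous into the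
    extended half-line, it is at most a constant times the lower limit of its
    Gaussian averages ([correlation_le_mollified]). Tested on Gaussians, the
    relation between [gamma] and [ghat] writes such an average at [z] as an
    integral of [ghat] against a damped cosine wave in [z]. Averaging over
    [z = X_t - X_s + y] turns the wave into [exp (- (t - s) Psi)] times a factor of
    modulus at most one. Hence [E (gamma (X_t - X_s + y))] is bounded, uniformly
    in [y], by [K (t - s)], a constant times the integral of
    [exp (- (t - s) Psi)] against the spectral measure
    ([expectation_correlation_le]).

    Integrability in time. Integrating [s ^ (- beta0) exp (- s a)] over a bounded
    interval gives at most a constant times [1 / (1 + a ^ (1 - beta0))]
    ([laplace_powRN_le]). So the hypothesis says that
    [k s = s ^ (- beta0) K s] is integrable near 0 ([integral_time_kernel_lty]),
    and a damping factor [exp (- M s)] makes its integral as small as desired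
    ([exp_damping]).

    Moments. By symmetry the double integral is twice the integral over the last
    time [r] of
    [I r], the integral over [0 < s < r] of [(r - s) ^ (- beta0) gamma (X_r - X_s)],
    and by Jensen's inequality it suffices to bound [E (exp (theta I r))]
    uniformly for [r <= t]. The [n]-th power of [I r] is [n!] times an integral
    over the simplex [0 < s_1 < ... < s_n < r]. There each [X_r - X_(s_i)] is a sum
    of consecutive increments, and integrating these out from the first one on,
    with the remaining ones frozen as a shift, bounds the expected product by
    [K (s_2 - s_1) ... K (r - s_n)] ([expectation_prod_correlation_le]). The
    weight [(r - s_i) ^ (- beta0)] is smaller than the one with [s_(i+1)] in place
    of [r], so the simplex integral is at most [exp (M r) delta ^ n], where
    [delta] is the integral of the damped [k] ([iterated_moment_le]). The
    resulting geometric series converges once [theta delta <= 1/2]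
    ([khasminskii]).

    Joint measurability in time and chance, needed for Tonelli, comes from the
    right-continuity of almost all paths ([measurable_path_version]); the
    exceptional null set is removed with [integral_le_of_ae]. *)


Set Implicit Arguments.
Unset Strict Implicit.
Unset Printing Implicit Defensive.

Import Order.TTheory GRing.Theory Num.Theory.
Import numFieldNormedType.Exports.

Local Open Scope classical_set_scope.
Local Open Scope ring_scope.

(** * Reflection of Lebesgue measure *)
Section reflection.
Context {R : realType}.
Local Notation mu := (@lebesgue_measure R).
Local Open Scope ereal_scope.

Let reflect (c : R) : measurableTypeR R -> measurableTypeR R := fun x => (c - x)%R.

Let measurable_reflect (c : R) : measurable_fun setT (reflect c).
Proof. by rewrite /reflect; apply: measurable_funB. Qed.

Let nu (c : R) := measure_function_pushforward__canonical__measure_function_Measure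
  mu (measurable_reflect c).

Let nuE (c : R) (A : set R) : measurable A -> nu c A = mu A.
Proof.
move=> mA.
apply/esym/(@lebesgue_measure_unique _ (nu c)) => //= _ [[a b]] _ <-.
rewrite /pushforward (_ : _ @^-1` _ = `[c - b, c - a[%classic%R); last first.
  apply/seteqP; split=> x; rewrite /= /reflect !in_itv/= => /andP[h1 h2];
    apply/andP; split; lra.
rewrite !lebesgue_measure_itv/= !lte_fin.
rewrite (_ : (c - b < c - a)%R = (a < b)%R); last by rewrite ltrD2l ltrN2.
by case: ifP => // _; rewrite -!EFinB; congr EFin; ring.
Qed.

(** The image of Lebesgue measure under [x |-> c - x] agrees with it on
    half-open intervals up to end points, hence everywhere. *)
Lemma ge0_integral_reflect (c : R) (D : set R) (f : R -> \bar R) : measurable D ->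
  measurable_fun D f -> {in D, forall x, 0 <= f x} ->
  \int[mu]_(x in (fun x => c - x)%R @^-1` D) f (c - x)%R = \int[mu]_(x in D) f x.
Proof.
move=> mD mf f0.
have -> : \int[mu]_(x in D) f x = \int[nu c]_(x in D) f x.
  by apply: eq_measure_integral => A mA _; exact/esym/nuE.
by rewrite (ge0_integral_pushforward (measurable_reflect c) mu mD mf).
Qed.

Lemma integral_reflect (c : R) (f : R -> \bar R) : measurable_fun setT f ->
  \int[mu]_x f (c - x)%R = \int[mu]_x f x.
Proof.
move=> mf; rewrite [RHS]integralE [LHS]integralE.
congr (_ - _).
  rewrite -(@ge0_integral_reflect c setT f^\+)%E//; last first.
    by apply: measurable_funepos; exact: mf.
  rewrite preimage_setT; apply: eq_integral => x _.
  exact: (congr1 (fun h => h x) (funepos_comp f (fun y => c - y)%R)).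
rewrite -(@ge0_integral_reflect c setT f^\-)%E//; last first.
  by apply: measurable_funeneg; exact: mf.
rewrite preimage_setT; apply: eq_integral => x _.
exact: (congr1 (fun h => h x) (funeneg_comp f (fun y => c - y)%R)).
Qed.

End reflection.

(** * The Gaussian on the line and its cosine transform *)
Section gauss1.
Context {R : realType}.
Implicit Types (e x z : R).
Local Notation mu := (@lebesgue_measure R).

Definition gauss1 e x : R := expR (- (e * x ^+ 2)).

Lemma gauss1_gt0 e x : 0 < gauss1 e x.
Proof. exact: expR_gt0. Qed.

Lemma continuous_gauss1 e : continuous (gauss1 e).
Proof.
move=> x; apply: continuous_comp; last exact: continuous_expR.
by apply/continuousN/continuousM; [exact: cst_continuous|exact: exprn_continuous].
Qed.

Lemma measurable_gauss1 e : measurable_fun setT (gauss1 e).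
Proof. by apply: continuous_measurable_fun; exact: continuous_gauss1. Qed.

Lemma gauss1_integrable e : 0 < e ->
  mu.-integrable setT (fun x => (gauss1 e x)%:E).
Proof.
move=> e0; pose s := Num.sqrt ((e *+ 2)^-1).
have s0 : s != 0 by rewrite gt_eqF// sqrtr_gt0 invr_gt0 pmulrn_rgt0.
have s2 : s ^+ 2 = (e *+ 2)^-1 by rewrite sqr_sqrtr// invr_ge0 mulrn_wge0// ltW.
have p0 := normal_peak_gt0 s0.
rewrite [X in _.-integrable _ X](_ : _ =
  fun x => (normal_peak s)^-1%:E * (normal_pdf 0 s x)%:E)%E.
  by apply: integrableZl => //; exact: integrable_normal_pdf.
apply/funext => x; rewrite -EFinM; congr EFin.
rewrite normal_pdfE// mulKf ?gt_eqF//.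
rewrite /gauss1 /normal_fun subr0 s2; congr expR.
by field; rewrite gt_eqF.
Qed.

(** Trading half of the exponent for a factor [|x|], which gives the
    integrable majorant needed to differentiate under the integral sign. *)
Lemma gauss1_shrink e x : 0 < e ->
  `|x| * gauss1 e x <= (1 + 2 / e) * gauss1 (e / 2) x.
Proof.
move=> e0; rewrite /gauss1.
have -> : - (e * x ^+ 2) = e / 2 * x ^+ 2 *- 1 + - (e / 2 * x ^+ 2) by field.
rewrite expRD mulrA ler_wpM2r ?expR_ge0// expRN ler_pdivrMr ?expR_gt0//.
have h1 : 1 + e / 2 * x ^+ 2 <= expR (e / 2 * x ^+ 2) by exact: expR_ge1Dx.
have h2 : `|x| <= 1 + x ^+ 2.
  by rewrite -real_normK ?num_real//; have := normr_ge0 x; nra.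
apply: (le_trans h2); apply: le_trans (ler_wpM2l _ h1); last first.
  by rewrite addr_ge0// divr_ge0// ltW.
have -> : (1 + 2 / e) * (1 + e / 2 * x ^+ 2) =
  1 + x ^+ 2 + (2 / e + e / 2 * x ^+ 2) by field; rewrite gt_eqF.
have := ltW e0 => e0'.
by rewrite lerDl addr_ge0//; [exact: divr_ge0|apply: mulr_ge0; [exact: divr_ge0|exact: sqr_ge0]].
Qed.

Lemma integrable_trig_gauss1 (f : R -> R) e : 0 < e ->
  measurable_fun setT f -> (forall x, `|f x| <= 1) ->
  mu.-integrable setT (fun x => (f x * gauss1 e x)%:E).
Proof.
move=> e0 mf f1; apply: le_integrable (gauss1_integrable e0) => //.
  apply/measurable_EFinP/measurable_funM => //; exact: measurable_gauss1.
move=> x _; rewrite !abse_EFin lee_fin normrM.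
by rewrite ler_piMl.
Qed.

Lemma integrable_xtrig_gauss1 (f : R -> R) e : 0 < e ->
  measurable_fun setT f -> (forall x, `|f x| <= 1) ->
  mu.-integrable setT (fun x => (x * (f x * gauss1 e x))%:E).
Proof.
move=> e0 mf f1.
have e20 : 0 < e / 2 by rewrite divr_gt0.
apply: le_integrable (integrableZl measurableT (1 + 2 / e) (gauss1_integrable e20)) => //.
  apply/measurable_EFinP/measurable_funM => //; apply/measurable_funM => //.
  exact: measurable_gauss1.
move=> x _; rewrite -EFinM !abse_EFin lee_fin !normrM.
rewrite (ger0_norm (ltW (gauss1_gt0 e x))) (ger0_norm (ltW (gauss1_gt0 _ x))).
rewrite (@ger0_norm _ (1 + 2 / e)); last by rewrite addr_ge0 ?divr_ge0// ltW.
apply: le_trans (gauss1_shrink x e0).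
rewrite mulrCA ler_piMl ?mulr_ge0 ?expR_ge0//.
Qed.

(** The integrand is the derivative of [sin (z x) exp (- e x^2)], which vanishes
    at both infinities: this is the integration by parts behind the
    differential equation satisfied by the cosine transform. *)
Lemma integral_deriv_sin_gauss1 e z : 0 < e ->
  \int[mu]_x (z * (cos (z * x) * gauss1 e x) -
     e *+ 2 * (x * (sin (z * x) * gauss1 e x))) = 0 :> R.
Proof.
move=> e0.
pose h x : R := sin (z * x) * gauss1 e x.
pose h' x : R := z * (cos (z * x) * gauss1 e x) -
     e *+ 2 * (x * (sin (z * x) * gauss1 e x)).
have csin : continuous (fun x : R => sin (z * x)).
  move=> x; apply: continuous_comp; last exact: continuous_sin.
  exact: mulrl_continuous.
have ccos : continuous (fun x : R => cos (z * x)).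
  move=> x; apply: continuous_comp; last exact: continuous_cos.
  exact: mulrl_continuous.
have dh x : is_derive x 1 h (h' x).
  rewrite /h; apply: is_derive_eq.
  rewrite /gauss1.
  by rewrite /GRing.scale/= /h' /gauss1; ring.
have ch : continuous h.
  by move=> x; apply: continuousM; [exact: csin|exact: continuous_gauss1].
have ch' : continuous h'.
  move=> x; apply: (@continuousB _ _ _ (fun x => z * (cos (z * x) * gauss1 e x))
      (fun x => e *+ 2 * (x * (sin (z * x) * gauss1 e x)))).
    apply: continuousM; first exact: cst_continuous.
    by apply: continuousM; [exact: ccos|exact: continuous_gauss1].
  apply: continuousM; first exact: cst_continuous.
  apply: continuousM; first exact: cvg_id.
  by apply: continuousM; [exact: csin|exact: continuous_gauss1].
have ih' : mu.-integrable setT (EFin \o h').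
  have i1 : mu.-integrable setT
      (fun x => z%:E * (cos (z * x) * gauss1 e x)%:E)%E.
    apply: integrableZl => //; apply: integrable_trig_gauss1 => //.
      exact: continuous_measurable_fun.
    by move=> x; rewrite ler_norml cos_geN1 cos_le1.
  have i2 : mu.-integrable setT
      (fun x => (e *+ 2)%:E * (x * (sin (z * x) * gauss1 e x))%:E)%E.
    apply: integrableZl => //; apply: integrable_xtrig_gauss1 => //.
      exact: continuous_measurable_fun.
    by move=> x; rewrite ler_norml sin_geN1 sin_le1.
  exact: integrableB i1 i2.
pose I n : set R := `[(- n.+1%:R)%R, n.+1%:R]%classic.
have mI n : measurable (I n) by exact: measurable_itv.
have FTC n : (\int[mu]_(x in I n) (h' x)%:E =
    (h n.+1%:R)%:E - (h (- n.+1%:R)%R)%:E)%E.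
  apply: continuous_FTC2.
  - by rewrite gtrN// ltr0n.
  - exact: continuous_subspaceT.
  - split.
    + by move=> x _; have [] := dh x.
    + exact/cvg_at_right_filter/ch.
    + exact/cvg_at_left_filter/ch.
  - by move=> x _; rewrite derive1E; have [_ ->] := dh x.
(* exhaust the line by the intervals [I n] in two ways *)
have lim1 : (\int[mu]_(x in I n) (h' x)%:E)%E @[n --> \oo] -->
    (\int[mu]_x (h' x)%:E)%E.
  under eq_fun do rewrite integral_mkcond.
  apply: (@dominated_cvg _ _ _ mu setT measurableT _ _ (fun x => `|(h' x)%:E|)%E).
  - move=> n; apply: (measurable_restrictT _ (mI n)).1.
    by apply: measurable_funTS; apply/measurable_EFinP; exact: continuous_measurable_fun.
  - move=> x _; apply: cvg_near_cst; near=> n.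
    rewrite /patch; suff -> : x \in I n by [].
    rewrite inE /I /= in_itv/= -ler_norml.
    apply: le_trans (ltW (archi_boundP (normr_ge0 x))) _.
    rewrite ler_nat; apply: leqW; near: n; exact: nbhs_infty_ge.
  - by [].
  - exact: integrable_abse.
  - move=> n x _; rewrite /patch; case: ifPn => // _.
    by rewrite abse0.
have lim0 : (\int[mu]_(x in I n) (h' x)%:E)%E @[n --> \oo] --> 0%E.
  rewrite (_ : (fun n => _) = (fun n => (h n.+1%:R - h (- n.+1%:R)%R)%:E)).
    apply: cvg_EFin; first exact: nearW.
    apply: (@squeeze_cvgr _ _ _ _ (fun n => - ((2 / e) * n.+1%:R^-1))
       (fun n => (2 / e) * n.+1%:R^-1)).
    + apply: nearW => n /=; rewrite -ler_norml.
      have hb (x : R) : `|x| = n.+1%:R -> `|h x| <= e^-1 * n.+1%:R^-1.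
        move=> xn; rewrite /h normrM (ger0_norm (ltW (gauss1_gt0 _ _))).
        apply: (@le_trans _ _ (gauss1 e x)).
          by rewrite ler_piMl ?expR_ge0// ler_norml sin_geN1 sin_le1.
        rewrite /gauss1 expRN -invfM lef_pV2 ?posrE ?expR_gt0 ?mulr_gt0//.
        apply: le_trans (expR_ge1Dx _); rewrite -real_normK ?num_real// xn.
        have n1 : 1 <= n.+1%:R :> R by rewrite ler1n.
        by rewrite -[X in X <= _]add0r lerD// ler_pM2l// expr2 ler_peMl// ltW// ltr0n.
      apply: (le_trans (ler_normB _ _)).
      have -> : 2 / e * n.+1%:R^-1 = e^-1 * n.+1%:R^-1 + e^-1 * n.+1%:R^-1 :> R.
        by rewrite -mulrDl -mulr2n mulr_natl.
      by apply: lerD; apply: hb; rewrite ?normrN ger0_norm.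
    + rewrite -oppr0; apply: cvgN.
      rewrite -[X in _ --> X](mulr0 (2 / e)); apply: cvgMr.
      exact: cvg_harmonic.
    + rewrite -[X in _ --> X](mulr0 (2 / e)); apply: cvgMr.
      exact: cvg_harmonic.
  by apply/funext => n; rewrite EFinB -FTC.
rewrite -/h' /Rintegral.
by have -> : (\int[mu]_x (h' x)%:E = 0)%E by apply: cvg_unique lim1 lim0.
Unshelve. all: by end_near. Qed.

Lemma is_derive_cos_gauss1 e z : 0 < e ->
  is_derive z 1 (fun z => \int[mu]_x (cos (z * x) * gauss1 e x))
    (- (z / (2 * e)) * \int[mu]_x (cos (z * x) * gauss1 e x)).
Proof.
move=> e0.
have ms w : measurable_fun setT (fun x : R => sin (w * x)).
  apply: continuous_measurable_fun => x.
  apply: continuous_comp; last exact: continuous_sin.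
  exact: mulrl_continuous.
have mc w : measurable_fun setT (fun x : R => cos (w * x)).
  apply: continuous_measurable_fun => x.
  apply: continuous_comp; last exact: continuous_cos.
  exact: mulrl_continuous.
have bs w x : `|sin (w * x) : R| <= 1 by rewrite ler_norml sin_geN1 sin_le1.
have bc w x : `|cos (w * x) : R| <= 1 by rewrite ler_norml cos_geN1 cos_le1.
pose f (w x : R) : R := cos (w * x) * gauss1 e x.
have df (w x : R) : is_derive w 1 (f ^~ x) (- (x * (sin (w * x) * gauss1 e x))).
  rewrite /f; apply: is_derive_eq.
  by rewrite /GRing.scale/= /gauss1; ring.
have d1 w x : partial1of2 f w x = - (x * (sin (w * x) * gauss1 e x)).
  by rewrite partial1of2E; have [_ ->] := df w x.
have zI : `]z - 1, z + 1[%classic z by rewrite /= in_itv/= ltrBlDr ltrDl ltr01.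
have intf w : `]z - 1, z + 1[%classic w ->
    mu.-integrable setT (EFin \o f w).
  by move=> _; exact: integrable_trig_gauss1.
have derf (w x : R) : `]z - 1, z + 1[%classic w -> [set: R] x -> derivable (f ^~ x) w 1.
  by move=> _ _; have [] := df w x.
have G0 x : 0 <= `|x| * gauss1 e x by rewrite mulr_ge0// expR_ge0.
have iG : mu.-integrable setT (EFin \o (fun x : R => `|x| * gauss1 e x)).
  have b1 (x : R) : `|cst (1 : R) x| <= 1 :> R by rewrite normr1.
  have := integrable_xtrig_gauss1 e0 (measurable_cst _) b1.
  move=> /integrable_abse; apply: eq_integrable => //.
  by move=> x _ /=; rewrite mul1r normrM (ger0_norm (ltW (gauss1_gt0 _ _))).
have Gub (w x : R) : `]z - 1, z + 1[%classic w -> [set: R] x ->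
    `|partial1of2 f w x| <= `|x| * gauss1 e x.
  move=> _ _; rewrite d1 normrN !normrM (ger0_norm (ltW (gauss1_gt0 _ _))).
  by rewrite ler_wpM2l// ler_piMl// expR_ge0.
split.
  exact: (@derivable_under_integral _ _ _ mu f setT measurableT z _ _ zI intf derf _ G0 iG Gub).
rewrite -derive1E (@differentiation_under_integral _ _ _ mu f setT measurableT z _ _ zI intf derf _ G0 iG Gub).
have := integral_deriv_sin_gauss1 z e0.
rewrite RintegralB//; last 2 first.
- exact: (integrableZl measurableT z (integrable_trig_gauss1 e0 (mc z) (bc z))).
- exact: (integrableZl measurableT (e *+ 2) (integrable_xtrig_gauss1 e0 (ms z) (bs z))).
rewrite !RintegralZl//; last 2 first.
- exact: (integrable_xtrig_gauss1 e0 (ms z) (bs z)).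
- exact: (integrable_trig_gauss1 e0 (mc z) (bc z)).
move=> /eqP; rewrite subr_eq0 => /eqP E.
under eq_Rintegral do rewrite d1 -mulN1r.
rewrite RintegralZl//; last exact: (integrable_xtrig_gauss1 e0 (ms z) (bs z)).
apply: (@mulfI _ (e *+ 2)); first by rewrite gt_eqF// mulrn_wgt0.
rewrite mulrCA -E; field.
by rewrite gt_eqF.
Qed.

(** The Gaussian is, up to a constant, its own Fourier transform: the cosine
    transform solves the linear equation y' = - z / (2 e) y. *)
Lemma integral_cos_gauss1 e z : 0 < e ->
  \int[mu]_x (cos (z * x) * gauss1 e x) =
  (\int[mu]_x gauss1 e x) * gauss1 ((4 * e)^-1) z.
Proof.
move=> e0; pose F (w : R) := \int[mu]_x (cos (w * x) * gauss1 e x).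
pose K (w : R) := F w * expR ((4 * e)^-1 * w ^+ 2).
have dK (w : R) : is_derive w 1 K 0.
  have dF := is_derive_cos_gauss1 w e0.
  rewrite /K /F; apply: is_derive_eq.
  by rewrite /GRing.scale/=; field; rewrite gt_eqF.
have := is_derive_0_is_cst z 0 dK.
rewrite /K expr0n/= mulr0 expR0 mulr1 => E.
rewrite /gauss1 expRN; apply/eqP; rewrite -/(F z) eq_sym.
rewrite -(inj_eq (mulIf (lt0r_neq0 (expR_gt0 ((4 * e)^-1 * z ^+ 2))))).
rewrite mulfVK ?lt0r_neq0 ?expR_gt0// E; apply/eqP; rewrite /F.
by apply: eq_Rintegral => x _; rewrite mul0r cos0 mul1r.
Qed.

(** An odd integrand, so reflection changes the sign of the integral. *)
Lemma integral_sin_gauss1 e z : 0 < e ->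
  \int[mu]_x (sin (z * x) * gauss1 e x) = 0 :> R.
Proof.
move=> e0.
have ms : measurable_fun setT (fun x : R => sin (z * x)).
  apply: continuous_measurable_fun => x.
  apply: continuous_comp; last exact: continuous_sin.
  exact: mulrl_continuous.
have bs x : `|sin (z * x) : R| <= 1 by rewrite ler_norml sin_geN1 sin_le1.
have I1 := integrable_trig_gauss1 e0 ms bs.
have : \int[mu]_x (sin (z * x) * gauss1 e x) =
    - \int[mu]_x (sin (z * x) * gauss1 e x) :> R.
  rewrite -mulN1r -RintegralZl// [LHS]/Rintegral -(integral_reflect 0 (measurable_int _ I1)).
  congr fine; apply: eq_integral => x _ /=.
  by rewrite sub0r mulrN sinN /gauss1 sqrrN mulN1r mulNr.
lra.
Qed.

(** On [|x| <= 1 / sqrt e] the Gaussian is at least [exp (-1)]. *)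
Lemma integral_gauss1_gt0 e : 0 < e -> 2 * expR (- 1) / Num.sqrt e <= \int[mu]_x gauss1 e x.
Proof.
move=> e0; pose s := (Num.sqrt e)^-1.
have s0 : 0 < s by rewrite invr_gt0 sqrtr_gt0.
rewrite -lee_fin /Rintegral fineK; last first.
  exact: (integrable_fin_num measurableT (gauss1_integrable e0)).
apply: (@le_trans _ _ (\int[mu]_(x in `[(- s)%R, s]) (gauss1 e x)%:E)%E); last first.
  apply: ge0_subset_integral => //.
  - by apply/measurable_EFinP; exact: measurable_gauss1.
  - by move=> x _; rewrite lee_fin expR_ge0.
apply: (@le_trans _ _ (\int[mu]_(x in `[(- s)%R, s]) (expR (- 1))%:E)%E).
  rewrite integral_cst//= [X in (_ * X)%E]lebesgue_measure_itv/= lte_fin gtrN//.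
  by rewrite -EFinD -EFinM lee_fin opprK/= -/s; lra.
apply: ge0_le_integral => //.
- by apply: measurable_funTS; apply/measurable_EFinP; exact: measurable_gauss1.
- move=> x; rewrite /= in_itv/= -ler_norml => xs.
  rewrite lee_fin ler_expR lerN2 -real_normK ?num_real//.
  have : `|x| ^+ 2 <= s ^+ 2 by rewrite ler_sqr ?nnegrE// (ltW s0).
  rewrite /s exprVn (sqr_sqrtr (ltW e0)) => h.
  by rewrite mulrC -ler_pdivlMr// mul1r.
Qed.

End gauss1.

(** * Gaussian waves are Schwartz functions *)
Section schwartz_class.
Context {R : realType} (d : nat).
Local Notation rV := 'rV[R]_d.
Implicit Types (e : R) (a xi x : rV).

Definition gaussd e a x : R := expR (- (e * \sum_(i < d) (x ord0 i - a ord0 i) ^+ 2)).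

(** A class of Gaussian-damped trigonometric polynomials that is closed under
    partial differentiation, so that smoothness and all Schwartz seminorms are
    obtained by induction rather than by explicit formulas. *)
Inductive gauss_wave e a xi : (rV -> R) -> Prop :=
| gauss_wave_cos : gauss_wave e a xi (fun x => cos (dotrV xi x) * gaussd e a x)
| gauss_wave_sin : gauss_wave e a xi (fun x => sin (dotrV xi x) * gaussd e a x)
| gauss_wave_scale k f : gauss_wave e a xi f -> gauss_wave e a xi (fun x => k * f x)
| gauss_wave_add f g : gauss_wave e a xi f -> gauss_wave e a xi g ->
    gauss_wave e a xi (fun x => f x + g x)
| gauss_wave_coord i f : gauss_wave e a xi f ->
    gauss_wave e a xi (fun x => x ord0 i * f x).

Lemma is_derive_comp1 (g : R -> R) (h : rV -> R) x v (dg dh : R) :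
  differentiable h x -> is_derive (h x) (1 : R) g dg -> is_derive x v h dh ->
  is_derive x v (g \o h) (dh * dg).
Proof.
move=> dfh [dg1 dg2] [dh1 dh2].
have dfg : differentiable g (h x) by exact/derivable1_diffP.
have dgh : differentiable (g \o h) x by exact: differentiable_comp.
split; first exact: diff_derivable.
rewrite deriveE// diff_comp//= diff1E//= -deriveE// dh2.
by rewrite derive1E dg2.
Qed.

Lemma is_derive_coord i x v :
  is_derive x v (fun x : rV => x ord0 i : R) (v ord0 i).
Proof.
split; first exact/diff_derivable/differentiable_coord.
rewrite deriveE; last exact: differentiable_coord.
have @f : {linear 'M[R]_(1, d) -> R}.
  by exists (fun N : 'M[R]_(_, _) => N ord0 i); do 2![eexists]; do ?[constructor];
     rewrite ?mxE// => ? *; rewrite ?mxE//; move=> ?; rewrite !mxE.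
rewrite (_ : (fun _ => _) = f)// diff_lin//.
exact: coord_continuous.
Qed.

Lemma differentiable_dotrV xi x : differentiable (dotrV xi) x.
Proof.
rewrite (_ : dotrV xi = \sum_(i < d) (fun x : rV => xi ord0 i * x ord0 i)).
  apply: differentiable_sum => i; apply: differentiableM => //.
  exact: differentiable_coord.
by apply/funext => y; rewrite fct_sumE.
Qed.

Lemma is_derive_dotrV xi x v : is_derive x v (dotrV xi) (dotrV xi v).
Proof.
have E : dotrV xi = \sum_(i < d) (fun x : rV => xi ord0 i * x ord0 i).
  by apply/funext => y; rewrite fct_sumE.
rewrite {1}E /dotrV; apply: is_derive_sum => i.
have h := is_derive_coord i x v; apply: is_derive_eq.
by rewrite /GRing.scale/= ?mulr0 ?addr0.
Qed.

Definition sqdist a x : R := \sum_(i < d) (x ord0 i - a ord0 i) ^+ 2.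

Lemma differentiable_sqdist a x : differentiable (sqdist a) x.
Proof.
rewrite (_ : sqdist a = \sum_(i < d) (fun x : rV => (x ord0 i - a ord0 i) ^+ 2)).
  apply: differentiable_sum => i.
  rewrite (_ : (fun _ => _) = (fun x : rV => x ord0 i - a ord0 i) *
      (fun x : rV => x ord0 i - a ord0 i)); last first.
    by apply/funext => y; rewrite expr2.
  apply: differentiableM.
    by apply: differentiableB => //; exact: differentiable_coord.
  by apply: differentiableB => //; exact: differentiable_coord.
by apply/funext => y; rewrite fct_sumE.
Qed.

Lemma is_derive_sqdist a x i :
  is_derive x (delta_mx ord0 i) (sqdist a) (2 * (x ord0 i - a ord0 i)).
Proof.
pose g (j : 'I_d) := fun x : rV => (x ord0 j - a ord0 j) ^+ 2.
rewrite (_ : sqdist a = \sum_(i < d) g i); last first.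
  by apply/funext => y; rewrite fct_sumE.
have -> : 2 * (x ord0 i - a ord0 i) =
    \sum_(j < d) (if j == i then 2 * (x ord0 i - a ord0 i) else 0).
  by rewrite -big_mkcond big_pred1_eq.
apply: is_derive_sum => j.
have h := is_derive_coord j x (delta_mx ord0 i).
rewrite /g; apply: is_derive_eq.
rewrite !mxE eqxx/= eq_sym; case: eqVneq => [->|_]/=.
  by rewrite /GRing.scale/=; ring.
by rewrite /GRing.scale/=; ring.
Qed.

Lemma differentiable_gaussd e a x : differentiable (gaussd e a) x.
Proof.
apply: (@differentiable_comp _ _ _ _ (fun x => - (e * sqdist a x)) expR).
  by apply: differentiableN; apply: differentiableM => //; exact: differentiable_sqdist.
exact/derivable1_diffP/derivable_expR.
Qed.

Lemma is_derive_gaussd e a x i : is_derive x (delta_mx ord0 i) (gaussd e a)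
   (- (e * (2 * (x ord0 i - a ord0 i))) * gaussd e a x).
Proof.
apply: (@is_derive_comp1 expR (fun x => - (e * sqdist a x))).
  by apply: differentiableN; apply: differentiableM => //; exact: differentiable_sqdist.
have h := is_derive_sqdist a x i.
by apply: is_derive_eq; rewrite /GRing.scale/=; ring.
Qed.

Lemma gauss_wave_differentiable e a xi f x :
  gauss_wave e a xi f -> differentiable f x.
Proof.
elim=> [||k g _ IH|g h _ IHg _ IHh|i g _ IH].
- apply: differentiableM; last exact: differentiable_gaussd.
  apply: (@differentiable_comp _ _ _ _ (dotrV xi) cos); first exact: differentiable_dotrV.
  exact/derivable1_diffP.
- apply: differentiableM; last exact: differentiable_gaussd.
  apply: (@differentiable_comp _ _ _ _ (dotrV xi) sin); first exact: differentiable_dotrV.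
  exact/derivable1_diffP.
- exact: differentiableM.
- exact: differentiableD.
- by apply: differentiableM => //; exact: differentiable_coord.
Qed.

(** Differentiation exchanges cosine and sine, and the Gaussian factor brings
    down an affine function of the coordinates. *)
Lemma gauss_wave_derive e a xi f i : gauss_wave e a xi f ->
  exists2 g, gauss_wave e a xi g & forall x, is_derive x (delta_mx ord0 i) f (g x).
Proof.
have base (s s' : R -> R) (w : R) :
    gauss_wave e a xi (fun x => s (dotrV xi x) * gaussd e a x) ->
    gauss_wave e a xi (fun x => s' (dotrV xi x) * gaussd e a x) ->
    (forall y : R, is_derive y (1 : R) s (w * s' y)) ->
    exists2 g, gauss_wave e a xi g & forall x, is_derive x (delta_mx ord0 i)
       (fun x => s (dotrV xi x) * gaussd e a x) (g x).
  move=> ws ws' ds.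
  exists (fun x => w * xi ord0 i * (s' (dotrV xi x) * gaussd e a x) +
    ((2 * e * a ord0 i) * (s (dotrV xi x) * gaussd e a x) +
     (- (2 * e)) * (x ord0 i * (s (dotrV xi x) * gaussd e a x)))).
    apply: gauss_wave_add; first exact: gauss_wave_scale.
    by apply: gauss_wave_add; apply: gauss_wave_scale => //; exact: gauss_wave_coord.
  move=> x.
  have h1 := is_derive_gaussd e a x i.
  have h2 := is_derive_dotrV xi x (delta_mx ord0 i).
  have h3 := is_derive_comp1 (differentiable_dotrV xi x) (ds _) h2.
  have h4 : is_derive x (delta_mx ord0 i) ((s \o dotrV xi) * gaussd e a)
    (s (dotrV xi x) *: (- (e * (2 * (x ord0 i - a ord0 i))) * gaussd e a x) +
     gaussd e a x *: (dotrV xi (delta_mx ord0 i) * (w * s' (dotrV xi x)))).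
    exact: is_deriveM.
  apply: (is_derive_eq h4).
  have -> : dotrV xi (delta_mx ord0 i) = xi ord0 i.
    rewrite /dotrV (bigD1 i)//= big1 ?addr0 ?mxE ?eqxx ?mulr1// => j ji.
    by rewrite mxE (negbTE ji) andbF mulr0.
  by rewrite /GRing.scale/=; ring.
elim=> [||k g _ [g' wg' dg]|g h wg [g' wg' dg] wh [h' wh' dh]|j g wg [g' wg' dg]].
- apply: (base cos sin (-1)); [exact: gauss_wave_cos|exact: gauss_wave_sin|].
  by move=> y; apply: is_derive_eq; rewrite mulN1r.
- apply: (base sin cos 1); [exact: gauss_wave_sin|exact: gauss_wave_cos|].
  by move=> y; apply: is_derive_eq; rewrite mul1r.
- exists (fun x => k * g' x); first exact: gauss_wave_scale.
  by move=> x; have := dg x => dgx; apply: is_derive_eq.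
- exists (fun x => g' x + h' x); first exact: gauss_wave_add.
  by move=> x; apply: is_deriveD.
- exists (fun x => (j == i)%:R * g x + x ord0 j * g' x).
    by apply: gauss_wave_add; [exact: gauss_wave_scale|exact: gauss_wave_coord].
  move=> x; have dgx := dg x; have dj := is_derive_coord j x (delta_mx ord0 i).
  apply: is_derive_eq.
  by rewrite mxE eqxx/= /GRing.scale/= [RHS]addrC [g x * _]mulrC.
Qed.

Lemma gauss_wave_partials e a xi f s : gauss_wave e a xi f ->
  gauss_wave e a xi (partials s f).
Proof.
move=> wf; elim: s => [//|i s IH] /=.
have [g wg dg] := gauss_wave_derive i IH.
rewrite (_ : (fun x => _) = g)//.
by apply/funext => x; have [_ ->] := dg x.
Qed.

Lemma expR_ge_pow (N : nat) (y : R) : 0 <= y -> y ^+ N <= N`!%:R * expR y.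
Proof.
move=> y0; rewrite mulrC -ler_pdivrMr ?ltr0n ?fact_gt0//.
case: N => [|N]; first by rewrite fact0 expr0 divr1 (le_trans _ (expR_ge1Dx y))// lerDl.
by rewrite (le_trans _ (expR_ge1Dxn N y0))// lerDr.
Qed.

(** Every polynomial weight is beaten by the Gaussian; multiplication by a
    coordinate is absorbed by raising the weight, hence [N] is quantified inside
    the induction. *)
Lemma gauss_wave_bound e a xi f (N : nat) : 0 < e -> gauss_wave e a xi f ->
  exists2 M, 0 <= M & forall x, (1 + `|x|) ^+ N * `|f x| <= M.
Proof.
move=> e0 wf.
have rge0 x : 0 <= 1 + `|x| by rewrite addr_ge0.
have rge1 x : 1 <= 1 + `|x| by rewrite lerDl.
have base (c : rV -> R) (k : nat) : (forall x, `|c x| <= 1) ->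
    exists2 M, 0 <= M & forall x, (1 + `|x|) ^+ k * `|c x * gaussd e a x| <= M.
  move=> c1; exists (((2 + `|a|) * (1 + e^-1)) ^+ k * (k`!%:R * expR 1)).
    by rewrite !mulr_ge0 ?exprn_ge0 ?mulr_ge0 ?addr_ge0 ?invr_ge0 ?expR_ge0 ?(ltW e0)// ler0n.
  move=> x; rewrite normrM (ger0_norm (expR_ge0 _)).
  apply: (@le_trans _ _ ((1 + `|x|) ^+ k * gaussd e a x)).
    by rewrite ler_wpM2l ?exprn_ge0// ler_piMl ?expR_ge0.
  rewrite /gaussd -/(sqdist a x); set S := sqdist a x.
  have S0 : 0 <= S by apply: sumr_ge0 => i _; exact: sqr_ge0.
  have xa : `|x - a| <= 1 + S.
    rewrite [leLHS]mx_normrE; apply/bigmax_leP; split; first by rewrite addr_ge0.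
    move=> [i j] _ /=; rewrite !mxE (ord1 i).
    have : (x ord0 j - a ord0 j) ^+ 2 <= S.
      rewrite /S /sqdist (bigD1 j)//= lerDl; apply: sumr_ge0 => l _; exact: sqr_ge0.
    set y := _ - _; rewrite -real_normK ?num_real//.
    by have := normr_ge0 y; nra.
  have h1 : 1 + `|x| <= (2 + `|a|) * (1 + S).
    have : `|x| <= `|x - a| + `|a| by rewrite -{1}(subrK a x) ler_normD.
    by have := normr_ge0 a; nra.
  have h2 : 1 + S <= (1 + e^-1) * (1 + e * S).
    have -> : (1 + e^-1) * (1 + e * S) = 1 + S + (e^-1 + e * S).
      by field; rewrite gt_eqF.
    by rewrite lerDl addr_ge0 ?invr_ge0 ?mulr_ge0 ?(ltW e0).
  have eS0 : 0 <= 1 + e * S by rewrite addr_ge0 ?mulr_ge0 ?(ltW e0).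
  have h3 : (1 + `|x|) ^+ k <= ((2 + `|a|) * (1 + e^-1)) ^+ k * (1 + e * S) ^+ k.
    rewrite -exprMn lerXn2r ?nnegrE//.
      by rewrite !mulr_ge0 ?addr_ge0 ?mulr_ge0 ?invr_ge0 ?(ltW e0).
    by rewrite (le_trans h1)// -mulrA ler_wpM2l// addr_ge0.
  apply: (le_trans (ler_wpM2r (expR_ge0 _) h3)).
  rewrite -mulrA ler_wpM2l ?exprn_ge0 ?mulr_ge0 ?addr_ge0 ?invr_ge0 ?(ltW e0)//.
  have h4 := expR_ge_pow k eS0.
  apply: (le_trans (ler_wpM2r (expR_ge0 _) h4)).
  by rewrite -mulrA -expRD addrK.
elim: wf N => [||k g _ IH|g h _ IHg _ IHh|j g _ IH] N.
- by apply: base => x; rewrite ler_norml cos_geN1 cos_le1.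
- by apply: base => x; rewrite ler_norml sin_geN1 sin_le1.
- have [M M0 HM] := IH N; exists (`|k| * M); first exact: mulr_ge0.
  by move=> x; rewrite normrM mulrCA ler_wpM2l.
- have [M M0 HM] := IHg N; have [M' M'0 HM'] := IHh N.
  exists (M + M'); first exact: addr_ge0.
  move=> x; apply: (@le_trans _ _ ((1 + `|x|) ^+ N * (`|g x| + `|h x|))).
    by rewrite ler_wpM2l ?exprn_ge0// ler_normD.
  by rewrite mulrDr lerD.
- have [M M0 HM] := IH N.+1; exists M => // x.
  apply: (le_trans _ (HM x)); rewrite exprSr -mulrA ler_wpM2l ?exprn_ge0//.
  rewrite normrM ler_wpM2r//.
  apply: (@le_trans _ _ `|x|); last by rewrite lerDr.
  rewrite [leRHS]mx_normrE; apply/bigmax_geP; right; by exists (ord0, j).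
Qed.

(** There are finitely many multi-indices of a given length, so the bounds for
    the individual derivatives can be added up. *)
Lemma gauss_wave_partials_bound e a xi f (N n : nat) : 0 < e -> gauss_wave e a xi f ->
  exists2 M, 0 <= M & forall s, (size s <= n)%N ->
    forall x, (1 + `|x|) ^+ N * `|partials s f x| <= M.
Proof.
move=> e0; elim: n f => [|n IH] f wf.
  have [M M0 HM] := gauss_wave_bound N e0 wf.
  by exists M => // -[|//] _.
have [M M0 HM] := gauss_wave_bound N e0 wf.
have : forall i, exists M, 0 <= M /\ forall s, (size s <= n)%N ->
    forall x, (1 + `|x|) ^+ N * `|partials s (partials [:: i] f) x| <= M.
  move=> i; have [M' ? ?] := IH _ (gauss_wave_partials [:: i] wf).
  by exists M'.
move=> /choice[K HK].
have K0 : 0 <= \sum_i K i by apply: sumr_ge0 => i _; have [] := HK i.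
exists (M + \sum_i K i); first exact: addr_ge0.
move=> s; case/lastP: s => [_ x|s i].
  by rewrite (le_trans (HM x))// lerDl.
rewrite size_rcons ltnS => sn x.
rewrite (_ : partials _ _ = partials s (partials [:: i] f)); last first.
  by rewrite /partials -cats1 foldr_cat.
have [_ /(_ s sn x) h] := HK i; apply: (le_trans h).
rewrite (bigD1 i)//= addrCA lerDl addr_ge0//.
by apply: sumr_ge0 => j _; have [] := HK j.
Qed.

Lemma gauss_wave_schwartz e a xi f : 0 < e -> gauss_wave e a xi f ->
  schwartz (fun x => (f x)%:C%C).
Proof.
move=> e0 wf.
have p0 s : partials s (fun _ : rV => 0 : R) = (fun _ => 0).
  elim: s => // i s /= ->; apply/funext => x; exact: derive_cst.
split; first split => s x /=.
- exact: gauss_wave_differentiable (gauss_wave_partials s wf).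
- by rewrite p0.
move=> N; have [M M0 HM] := gauss_wave_partials_bound N N e0 wf.
exists M => s x sN; rewrite /cpartials/= p0 normc_def/= expr0n/= addr0 sqrtr_sqr.
by rewrite -rmorphM lecR; exact: HM.
Qed.

End schwartz_class.

(** * Integration one coordinate at a time *)
Section rV_cons_theory.
Context {R : realType}.

Lemma rV_cons0 d (p : R * 'rV[R]_d) : rV_cons p ord0 ord0 = p.1.
Proof. by have := rV_consK p; case: p => a v []. Qed.

Lemma rV_consS d (p : R * 'rV[R]_d) i : rV_cons p ord0 (lift ord0 i) = p.2 ord0 i.
Proof.
rewrite (_ : lift ord0 i = rshift 1 i); last exact: val_inj.
by rewrite /rV_cons (@row_mxEr R 1 1 d).
Qed.

Definition rV_tail d (z : 'rV[R]_d.+1) : 'rV[R]_d := \row_i z ord0 (lift ord0 i).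

Lemma dotrV_cons d (z : 'rV[R]_d.+1) p :
  dotrV z (rV_cons p) = z ord0 ord0 * p.1 + dotrV (rV_tail z) p.2.
Proof.
rewrite /dotrV big_ord_recl rV_cons0; congr (_ + _).
by apply: eq_bigr => i _; rewrite rV_consS mxE.
Qed.

Lemma gaussd_cons e d p : gaussd e (0 : 'rV[R]_d.+1) (rV_cons p) =
  gauss1 e p.1 * gaussd e (0 : 'rV[R]_d) p.2.
Proof.
rewrite /gaussd /gauss1 -expRD big_ord_recl rV_cons0 mxE subr0 mulrDr opprD.
congr (expR (_ - _ * _)); apply: eq_bigr => i _.
by rewrite rV_consS !mxE.
Qed.

Lemma measurable_dotrV d (z : 'rV[R]_d) : measurable_fun setT (dotrV z).
Proof.
apply: measurable_sum => i; apply: measurable_funM => //.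
exact: measurable_rV_coord.
Qed.

Lemma measurable_gaussd e d (a : 'rV[R]_d) : measurable_fun setT (gaussd e a).
Proof.
apply: measurableT_comp => //; apply: measurableT_comp => //.
apply: measurable_funM => //; apply: measurable_sum => i.
apply: measurable_funX; apply: measurable_funB => //.
exact: measurable_rV_coord.
Qed.

Local Open Scope ereal_scope.

Let mcons d : measurable_fun [set: (measurableTypeR R * 'rV[R]_d)%type]
    (@rV_cons R d : measurableTypeR R * 'rV[R]_d -> 'rV[R]_d.+1).
Proof. exact: (@measurable_rV_cons R d). Qed.

Let nu d := measure_function_pushforward__canonical__measure_function_Measure
     (@lebesgue_measure R \x leb_rV d) (mcons (d:=d)).

Lemma ge0_integral_leb_rVS d (f : 'rV[R]_d.+1 -> \bar R) :
  measurable_fun setT f -> (forall x, 0 <= f x) ->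
  \int[leb_rV d.+1]_x f x =
  \int[lebesgue_measure]_a \int[leb_rV d]_v f (rV_cons (a, v)).
Proof.
move=> mf f0.
transitivity (\int[nu d]_x f x); first exact: eq_measure_integral.
rewrite (ge0_integral_pushforward (mcons (d:=d))
  (@lebesgue_measure R \x leb_rV d) measurableT mf)//.
rewrite preimage_setT.
rewrite fubini_tonelli1//=.
by apply: measurableT_comp => //; exact: measurable_rV_cons.
Qed.

Lemma integral_leb_rVS d (f : 'rV[R]_d.+1 -> \bar R) :
  (leb_rV d.+1).-integrable setT f ->
  \int[leb_rV d.+1]_x f x =
  \int[lebesgue_measure]_a \int[leb_rV d]_v f (rV_cons (a, v)).
Proof.
move=> fi; have mf := measurable_int _ fi.
have mfc : measurable_fun setT (f \o @rV_cons R d).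
  by apply: measurableT_comp => //; exact: measurable_rV_cons.
have ifc : (lebesgue_measure \x leb_rV d).-integrable setT (f \o @rV_cons R d).
  apply/integrable12ltyP => //=.
  have maf : measurable_fun setT (abse \o f) by apply: measurableT_comp.
  have af0 x : 0 <= (abse \o f) x by exact: abse_ge0.
  have <- := ge0_integral_leb_rVS maf af0.
  by have /integrableP[] := fi.
transitivity (\int[nu d]_x f x); first exact: eq_measure_integral.
rewrite (integral_pushforward (mcons (d:=d)) mf ifc measurableT)//.
rewrite preimage_setT.
by rewrite -integral12_prod_meas1.
Qed.

End rV_cons_theory.

(** * Fourier transform of Gaussians in several variables *)
Section gaussd_fourier.
Context {R : realType}.
Implicit Types (e : R).

Definition gauss1_mass e : R := \int[@lebesgue_measure R]_x gauss1 e x.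

Lemma gauss1_massE e : 0 < e ->
  (\int[@lebesgue_measure R]_x (gauss1 e x)%:E = (gauss1_mass e)%:E)%E.
Proof.
move=> e0; rewrite /gauss1_mass /Rintegral fineK//.
exact: (integrable_fin_num measurableT (gauss1_integrable e0)).
Qed.

Lemma ge0_integral_gaussd e d : 0 < e ->
  (\int[leb_rV d]_x (gaussd e (0 : 'rV[R]_d) x)%:E = (gauss1_mass e ^+ d)%:E)%E.
Proof.
move=> e0; elim: d => [|d IH].
  rewrite /= integral_dirac//; last first.
    by apply/measurable_EFinP; exact: measurable_gaussd.
  by rewrite diracT mul1e /gaussd big_ord0 mulr0 oppr0 expR0.
rewrite ge0_integral_leb_rVS; last 2 first.
- by apply/measurable_EFinP; exact: measurable_gaussd.
- by move=> x; rewrite lee_fin expR_ge0.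
under eq_integral => a _.
  under eq_integral do rewrite gaussd_cons/= EFinM.
  rewrite ge0_integralZl//=; last 3 first.
  - by apply/measurable_EFinP; exact: measurable_gaussd.
  - by move=> x _; rewrite lee_fin expR_ge0.
  - by rewrite lee_fin expR_ge0.
  rewrite IH; over.
rewrite ge0_integralZr//; last 3 first.
- by apply/measurable_EFinP; exact: measurable_gauss1.
- by move=> x _; rewrite lee_fin expR_ge0.
- rewrite lee_fin exprn_ge0// /gauss1_mass; apply: Rintegral_ge0 => x _.
  exact: expR_ge0.
by rewrite gauss1_massE// -EFinM exprS.
Qed.

Lemma integrable_bounded_gaussd e d (f : 'rV[R]_d -> R) : 0 < e ->
  measurable_fun setT f -> (forall x, `|f x| <= 1) ->
  (leb_rV d).-integrable setT (fun x => (f x * gaussd e 0 x)%:E).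
Proof.
move=> e0 mf f1; apply/integrableP; split.
  by apply/measurable_EFinP; apply: measurable_funM => //; exact: measurable_gaussd.
apply: le_lt_trans (ltry (gauss1_mass e ^+ d)).
rewrite -ge0_integral_gaussd//; apply: ge0_le_integral => //.
- apply: measurableT_comp => //; apply/measurable_EFinP.
  by apply: measurable_funM => //; exact: measurable_gaussd.
- by apply/measurable_EFinP; exact: measurable_gaussd.
- move=> x _; rewrite abse_EFin lee_fin normrM.
  by rewrite (ger0_norm (expR_ge0 _)) ler_piMl// expR_ge0.
Qed.

Lemma measurable_cos_dotrV d (z : 'rV[R]_d) :
  measurable_fun setT (fun x => cos (dotrV z x)).
Proof.
apply: (@measurableT_comp _ _ _ _ _ _ (@cos R)); last exact: measurable_dotrV.
by apply: continuous_measurable_fun; exact: continuous_cos.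
Qed.

Lemma measurable_sin_dotrV d (z : 'rV[R]_d) :
  measurable_fun setT (fun x => sin (dotrV z x)).
Proof.
apply: (@measurableT_comp _ _ _ _ _ _ (@sin R)); last exact: measurable_dotrV.
by apply: continuous_measurable_fun; exact: continuous_sin.
Qed.

Lemma cos_bound (x : R) : `|cos x| <= 1.
Proof. by rewrite ler_norml cos_geN1 cos_le1. Qed.

Lemma sin_bound (x : R) : `|sin x| <= 1.
Proof. by rewrite ler_norml sin_geN1 sin_le1. Qed.

(** Induction on the dimension: splitting off the first coordinate with the
    addition formula leaves a cosine term, and a sine term whose integral in
    the first variable vanishes. *)
Lemma integral_cos_gaussd e d (z : 'rV[R]_d) : 0 < e ->
  (\int[leb_rV d]_x (cos (dotrV z x) * gaussd e 0 x)%:E =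
   (gauss1_mass e ^+ d * gaussd (4 * e)^-1 0 z)%:E)%E.
Proof.
move=> e0; elim: d z => [|d IH] z.
  rewrite /= integral_dirac//; last first.
    apply/measurable_EFinP; apply: measurable_funM.
      exact: measurable_cos_dotrV.
    exact: measurable_gaussd.
  by rewrite diracT mul1e /dotrV /gaussd !big_ord0 cos0 !mulr0 oppr0 expR0 expr0.
have iC := integrable_bounded_gaussd e0 (measurable_cos_dotrV (rV_tail z))
  (fun x => cos_bound _).
have iS := integrable_bounded_gaussd e0 (measurable_sin_dotrV (rV_tail z))
  (fun x => sin_bound _).
pose z0 := z ord0 ord0.
pose C := gauss1_mass e ^+ d * gaussd (4 * e)^-1 0 (rV_tail z).
pose S := \int[leb_rV d]_v (sin (dotrV (rV_tail z) v) * gaussd e 0 v).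
rewrite integral_leb_rVS; last first.
  exact: integrable_bounded_gaussd (measurable_cos_dotrV z) (fun x => cos_bound _).
have c1 : continuous (fun a : R => cos (z0 * a)).
  move=> x; apply: continuous_comp; last exact: continuous_cos.
  exact: mulrl_continuous.
have s1 : continuous (fun a : R => sin (z0 * a)).
  move=> x; apply: continuous_comp; last exact: continuous_sin.
  exact: mulrl_continuous.
have iC1 := integrable_trig_gauss1 e0 (continuous_measurable_fun c1)
  (fun x => cos_bound _).
have iS1 := integrable_trig_gauss1 e0 (continuous_measurable_fun s1)
  (fun x => sin_bound _).
transitivity (\int[lebesgue_measure]_a
    (C%:E * (cos (z0 * a) * gauss1 e a)%:E - S%:E * (sin (z0 * a) * gauss1 e a)%:E))%E.
  apply: eq_integral => a _.
  transitivity (\int[leb_rV d]_v ((cos (z0 * a) * gauss1 e a)%:E *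
      (cos (dotrV (rV_tail z) v) * gaussd e 0 v)%:E -
      (sin (z0 * a) * gauss1 e a)%:E *
      (sin (dotrV (rV_tail z) v) * gaussd e 0 v)%:E))%E.
    apply: eq_integral => v _.
    rewrite dotrV_cons gaussd_cons/= cosD -!EFinM -EFinB; congr EFin.
    by rewrite -/z0; ring.
  rewrite integralB//; last 2 first.
  - exact: integrableZl.
  - exact: integrableZl.
  rewrite !integralZl// IH -/C /S muleC; congr (_ - _)%E.
  rewrite muleC; congr (_ * _)%E.
  by rewrite /Rintegral fineK//; exact: integrable_fin_num.
rewrite integralB//; last 2 first.
- exact: integrableZl.
- exact: integrableZl.
rewrite !integralZl//.
have -> : (\int[lebesgue_measure]_x (sin (z0 * x) * gauss1 e x)%:E = 0)%E.
  rewrite -[LHS]fineK; last exact: (integrable_fin_num measurableT iS1).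
  by congr EFin; exact: integral_sin_gauss1.
have -> : (\int[lebesgue_measure]_x (cos (z0 * x) * gauss1 e x)%:E =
   (gauss1_mass e * gauss1 ((4 * e)^-1) z0)%:E)%E.
  rewrite -[LHS]fineK; last exact: (integrable_fin_num measurableT iC1).
  by congr EFin; exact: integral_cos_gauss1.
rewrite mule0 sube0 -EFinM /C; congr EFin.
have -> : gaussd (4 * e)^-1 0 z = gauss1 (4 * e)^-1 z0 * gaussd (4 * e)^-1 0 (rV_tail z).
  rewrite /gaussd /gauss1 -expRD big_ord_recl mxE subr0 mulrDr opprD.
  congr (expR (_ - _ * _)); apply: eq_bigr => i _.
  by rewrite !mxE.
by rewrite exprS; ring.
Qed.

End gaussd_fourier.

(** * Tempered functions tested against Gaussian waves *)
Section tempered.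
Context {R : realType} (d : nat).
Local Notation rV := 'rV[R]_d.
Local Open Scope complex_scope.
Implicit Types (f g : rV -> R) (e : R) (a x z xi : rV).

Lemma dotrV0l x : dotrV (0 : rV) x = 0.
Proof. by rewrite /dotrV big1// => i _; rewrite mxE mul0r. Qed.

Lemma tempered_integrable_wave f e a xi h : tempered_function f -> 0 < e ->
  gauss_wave e a xi h -> (leb_rV d).-integrable setT (fun x => (f x * h x)%:E).
Proof.
move=> [_ fi _] e0 wh; have [+ _] := fi _ (gauss_wave_schwartz e0 wh).
by apply: eq_integrable => // x _ /=; rewrite mul0r subr0.
Qed.

Lemma tempered_integrable_gaussd f e a : tempered_function f -> 0 < e ->
  (leb_rV d).-integrable setT (fun x => (f x * gaussd e a x)%:E).
Proof.
move=> tf e0.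
apply: eq_integrable (tempered_integrable_wave tf e0 (gauss_wave_cos e a 0)) => //.
by move=> x _ /=; rewrite dotrV0l cos0 mul1r.
Qed.

(** Only the real part is computed: it suffices to pair the transform with real
    functions. The two bumps come from writing the product of two cosines as a
    sum. *)
Lemma Re_fourier_wave e xi z : 0 < e ->
  complex.Re (fourier (fun x => (cos (dotrV xi x) * gaussd e 0 x)%:C) z) =
  gauss1_mass e ^+ d / 2 * (gaussd (4 * e)^-1 xi z + gaussd (4 * e)^-1 (- xi) z).
Proof.
move=> e0; rewrite /fourier /=.
have i1 := integrable_bounded_gaussd e0 (measurable_cos_dotrV (z - xi)) (fun x => cos_bound _).
have i2 := integrable_bounded_gaussd e0 (measurable_cos_dotrV (z + xi)) (fun x => cos_bound _).
have dB x y : dotrV (z + y) x = dotrV z x + dotrV y x.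
  by rewrite /dotrV -big_split/=; apply: eq_bigr => i _; rewrite mxE mulrDl.
have dN x : dotrV (- xi) x = - dotrV xi x.
  by rewrite /dotrV -sumrN; apply: eq_bigr => i _; rewrite mxE mulNr.
rewrite /Rintegral.
transitivity (fine (\int[leb_rV d]_x (2^-1%:E * ((cos (dotrV (z - xi) x) * gaussd e 0 x)%:E +
   (cos (dotrV (z + xi) x) * gaussd e 0 x)%:E)))%E).
  congr fine; apply: eq_integral => x _.
  rewrite -EFinD -EFinM; congr EFin.
  rewrite !dB dN /= cosB cosD cosN mulr0 subr0; by field.
rewrite integralZl//; last exact: integrableD.
rewrite integralD// !integral_cos_gaussd//= /gaussd.
rewrite (_ : \sum_(i < d) ((z - xi) ord0 i - (0 : rV) ord0 i) ^+ 2 = \sum_(i < d) (z ord0 i - xi ord0 i) ^+ 2); last first.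
  by apply: eq_bigr => i _; rewrite !mxE subr0.
rewrite (_ : \sum_(i < d) ((z + xi) ord0 i - (0 : rV) ord0 i) ^+ 2 = \sum_(i < d) (z ord0 i - (- xi) ord0 i) ^+ 2); last first.
  by apply: eq_bigr => i _; rewrite !mxE subr0 opprK.
by ring.
Qed.

(** The Fourier relation in the sense of distributions, tested on a Gaussian
    wave: a Gaussian average of [f] around [xi] and [- xi] is an integral of [g]
    against a damped wave. *)
Lemma gaussian_duality f g e xi : is_fourier_transform f g -> 0 < e ->
  \int[leb_rV d]_z (f z * (gauss1_mass e ^+ d / 2 *
      (gaussd (4 * e)^-1 xi z + gaussd (4 * e)^-1 (- xi) z))) =
  \int[leb_rV d]_x (g x * (cos (dotrV xi x) * gaussd e 0 x)).
Proof.
move=> [_ _ fg] e0.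
have := fg _ (gauss_wave_schwartz e0 (gauss_wave_cos e 0 xi)).
rewrite /fourier_distribution /distribution_of => /(congr1 (@complex.Re R)) /= E.
transitivity (\int[leb_rV d]_z (complex.Re ((f z)%:C * fourier (fun x => (cos (dotrV xi x) * gaussd e 0 x)%:C) z))).
  apply: eq_Rintegral => z _.
  by rewrite -Re_fourier_wave//; case: (fourier _ _) => u v /=; rewrite mul0r subr0.
rewrite E; apply: eq_Rintegral => x _ /=.
by rewrite mul0r subr0.
Qed.

End tempered.

(** * Lower limits *)
Section limn_einf_extra.
Context {R : realType}.
Implicit Types (u : (\bar R)^nat).
Local Open Scope ereal_scope.

Lemma limn_einf_supE u : limn_einf u = ereal_sup (range (einfs u)).
Proof. by rewrite limn_einf_lim; apply/cvg_lim => //; exact: cvg_einfs_sup. Qed.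

Lemma near_le_limn_einf u (c : \bar R) : (\forall n \near \oo, c <= u n) ->
  c <= limn_einf u.
Proof.
move=> [N _ cu]; rewrite limn_einf_supE.
apply: (@le_trans _ _ (einfs u N)); last by apply: ereal_sup_ubound; exists N.
by apply: le_ereal_inf_tmp => _ [n /= Nn <-]; exact: cu.
Qed.

Lemma limn_einf_le u (c : \bar R) : (forall n, u n <= c) -> limn_einf u <= c.
Proof.
move=> uc; rewrite limn_einf_supE; apply: ge_ereal_sup => _ [n _ <-].
apply: le_trans (uc n); apply: ereal_inf_lbound; by exists n => /=.
Qed.

(** Testing only finite levels [c] below [y] covers the case [y = +oo]. *)
Lemma lt_near_le_limn_einf u (y : \bar R) :
  (forall n, 0 <= u n) ->
  (forall c : R, (0 <= c)%R -> c%:E < y -> \forall n \near \oo, c%:E <= u n) ->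
  y <= limn_einf u.
Proof.
move=> u0 H; rewrite leNgt; apply/negP.
have : 0 <= limn_einf u by apply: near_le_limn_einf; exact: nearW.
case E : (limn_einf u) => [r| |] //=; last by move=> _; rewrite ltNge leey.
rewrite lee_fin => r0 ry.
have [c rc cy] : exists2 c, (r < c)%R & c%:E < y.
  case: y ry {H} => [y| |]//=.
    rewrite lte_fin => ry; exists ((r + y) / 2)%R; [lra|rewrite lte_fin; lra].
  by exists (r + 1)%R; [rewrite ltrDl|rewrite ltry].
have := near_le_limn_einf (H c (le_trans r0 (ltW rc)) cy).
by rewrite E lee_fin leNgt rc.
Qed.

End limn_einf_extra.

(** * Boxes and the origin *)
Section rV_measure.
Context {R : realType}.

Lemma measurable_rV_box d (A : 'I_d -> set R) : (forall i, measurable (A i)) ->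
  measurable [set x : 'rV[R]_d | forall i, A i (x ord0 i)].
Proof.
move=> mA; rewrite (_ : [set _ | _] = \bigcap_(i in [set: 'I_d])
    ((fun x : 'rV[R]_d => x ord0 i) @^-1` A i)).
  apply: fin_bigcap_measurable => // i _.
  by rewrite -[X in measurable X]setTI; apply: measurable_rV_coord.
by apply/seteqP; split => x /= h i; [move=> _|]; exact: h.
Qed.

Let set0E d : [set 0] = [set x : 'rV[R]_d | forall i, [set 0] (x ord0 i)].
Proof.
apply/seteqP; split=> [_ -> i /=|x /= x0]; first by rewrite mxE.
by apply/rowP => i; rewrite mxE; exact: x0.
Qed.

Lemma measurable_rV_set0 d : measurable [set (0 : 'rV[R]_d)].
Proof.
rewrite set0E; apply: (@measurable_rV_box d (fun=> [set 0])) => i.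
exact: measurable_set1.
Qed.

Lemma leb_rV_set0 d : (1 <= d)%N -> leb_rV d [set (0 : 'rV[R]_d)] = 0%E.
Proof.
case: d => // d _; rewrite set0E (@leb_rV_box _ d.+1 (fun=> [set 0])); last by move=> i; exact: measurable_set1.
rewrite big_ord_recl; have -> : @lebesgue_measure R [set 0] = 0%E.
  exact: lebesgue_measure_set1.
by rewrite mul0e.
Qed.

End rV_measure.

(** * Gaussian regularization of a correlation function *)
Section correlation.
Context {R : realType} (d : nat) (hd : (1 <= d)%N).
Local Notation rV := 'rV[R]_d.
Context (gamma : rV -> \bar R) (ghat : rV -> R).
Hypothesis hgamma : correlation_function gamma ghat.

Let f x := fine (gamma x).

Lemma correlation_lty x : x <> 0 -> (gamma x < +oo)%E.
Proof. by case: (correlation_finite hgamma) => [h|[_ h]]; [move=> /h|exact: h]. Qed.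

Lemma correlation_fineK x : x <> 0 -> (f x)%:E = gamma x.
Proof.
move=> x0; rewrite /f fineK// ge0_fin_numE ?correlation_lty//.
exact: correlation_ge0 hgamma _.
Qed.

Let tf : tempered_function f.
Proof. by have [] := correlation_fourier hgamma. Qed.

Let tg : tempered_function ghat.
Proof. by have [] := correlation_fourier hgamma. Qed.

Let f_ge0 x : 0 <= f x.
Proof. by rewrite fine_ge0//; exact: correlation_ge0 hgamma _. Qed.

(** Off the origin [gamma] is the tempered function [f], and the origin is a
    measurable point. *)
Lemma measurable_correlation : measurable_fun setT gamma.
Proof.
have mf : measurable_fun setT (EFin \o f) by apply/measurable_EFinP; case: tf.
rewrite (_ : gamma = fun x => if x \in [set 0] then gamma 0 else (f x)%:E).
  apply: measurable_fun_ifT => //.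
  apply: (@measurable_fun_bool _ _ _ _ true); rewrite setTI.
  rewrite (_ : _ @^-1` _ = [set 0]); first exact: measurable_rV_set0.
  by apply/seteqP; split=> x /=; [move/set_mem|move/(@mem_set _ [set 0])].
apply/funext => x; case: ifPn => [/set_mem -> //|/negP x0].
by rewrite correlation_fineK// => x00; apply: x0; exact: mem_set.
Qed.

(** By [mollifiedE] this is a Gaussian average of [gamma] around [x] and [- x], of
    width [sqrt e]; the formula on the Fourier side makes the dependence on [x]
    a pure phase. *)
Definition mollified (e : R) (x : rV) : R :=
  \int[leb_rV d]_xi (ghat xi * (cos (dotrV x xi) * gaussd e 0 xi)).

Let gauss1_mass_ge0 (e : R) : 0 <= gauss1_mass e.
Proof. by apply: Rintegral_ge0 => x _; exact: expR_ge0. Qed.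

Let mollifiedE e x : 0 < e -> mollified e x =
  \int[leb_rV d]_z (f z * (gauss1_mass e ^+ d / 2 *
      (gaussd (4 * e)^-1 x z + gaussd (4 * e)^-1 (- x) z))).
Proof. by move=> e0; rewrite (gaussian_duality _ (correlation_fourier hgamma)). Qed.

Lemma mollified_ge0 e x : 0 < e -> 0 <= mollified e x.
Proof.
move=> e0; rewrite mollifiedE//; apply: Rintegral_ge0 => z _.
by rewrite !mulr_ge0 ?exprn_ge0 ?addr_ge0 ?expR_ge0.
Qed.

(** The box of half-width [sqrt e] has volume [(2 sqrt e)^d], on it the Gaussian
    is at least [exp (- d / 4)], and the normalizing factor is at least
    [(2 exp (-1) / sqrt e)^d / 2]; this is the inverse of the product. *)
Definition mollify_cst : R := 2 * (expR (5 / 4) / 4) ^+ d.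

Lemma mollify_cst_ge0 : 0 <= mollify_cst.
Proof. by rewrite mulr_ge0// exprn_ge0// divr_ge0// expR_ge0. Qed.

(** As [gamma] is nonnegative, its Gaussian average dominates the contribution of
    the box of half-width [sqrt e] around [x]. *)
Lemma mollified_lb e (x : rV) (c : R) : 0 < e -> 0 <= c ->
  (forall z : rV, (forall i, `|x ord0 i - z ord0 i| <= Num.sqrt e) -> (c%:E <= gamma z)%E) ->
  c <= mollify_cst * mollified e x.
Proof.
move=> e0 c0 H.
pose A i : set R := `[x ord0 i - Num.sqrt e, x ord0 i + Num.sqrt e]%classic.
have mA i : measurable (A i) by exact: measurable_itv.
pose B := [set z : rV | forall i, A i (z ord0 i)].
have mB : measurable B by exact: measurable_rV_box.
have lebB : leb_rV d B = ((2 * Num.sqrt e) ^+ d)%:E.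
  rewrite leb_rV_box//.
  rewrite (eq_bigr (fun _ => (2 * Num.sqrt e)%:E)).
    by rewrite prodEFin prodr_const card_ord.
  move=> i _; rewrite lebesgue_measure_itv/= lte_fin.
  have se : 0 < Num.sqrt e by rewrite sqrtr_gt0.
  rewrite ltrBlDr -addrA ltrDl addr_gt0// -EFinD; congr EFin; ring.
pose K := gauss1_mass e ^+ d / 2 * expR (- (1 / 4)) ^+ d.
have e4 : 0 < (4 * e)^-1 by rewrite invr_gt0 mulr_gt0.
have i0 a := tempered_integrable_gaussd a tf e4.
have key : ((c * K * (2 * Num.sqrt e) ^+ d)%:E <= (mollified e x)%:E)%E.
  rewrite mollifiedE// /Rintegral fineK; last first.
    apply: integrable_fin_num => //.
    have := integrableZl measurableT (gauss1_mass e ^+ d / 2) (integrableD measurableT (i0 x) (i0 (- x))).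
    apply: eq_integrable => // z _.
    by rewrite -EFinD -EFinM; congr EFin; ring.
  apply: (@le_trans _ _ (\int[leb_rV d]_(z in B) (c * K)%:E)%E).
    by rewrite integral_cst//= -/B lebB EFinM.
  have mh : measurable_fun setT (fun z => (f z * (gauss1_mass e ^+ d / 2 *
      (gaussd (4 * e)^-1 x z + gaussd (4 * e)^-1 (- x) z)))%:E).
    apply/measurable_EFinP; apply: measurable_funM; first by case: tf.
    apply: measurable_funM => //; apply: measurable_funD; exact: measurable_gaussd.
  have h0 z : (0 <= (f z * (gauss1_mass e ^+ d / 2 *
      (gaussd (4 * e)^-1 x z + gaussd (4 * e)^-1 (- x) z)))%:E)%E.
    by rewrite lee_fin !mulr_ge0 ?exprn_ge0 ?addr_ge0 ?expR_ge0.
  apply: (@le_trans _ _ (\int[leb_rV d]_(z in B) (f z * (gauss1_mass e ^+ d / 2 *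
      (gaussd (4 * e)^-1 x z + gaussd (4 * e)^-1 (- x) z)))%:E)%E); last first.
    exact: ge0_subset_integral.
  have K0 : 0 <= K by rewrite !mulr_ge0 ?exprn_ge0 ?expR_ge0.
  apply: ae_ge0_le_integral => //.
  - by move=> z _; rewrite lee_fin mulr_ge0.
  - exact: measurable_funTS.
  exists [set 0]; split; [exact: measurable_rV_set0|exact: leb_rV_set0|].
  move=> z; apply: contra_notP => z0 Bz /=.
  have zB i : `|x ord0 i - z ord0 i| <= Num.sqrt e.
    by have := Bz i; rewrite /A /= in_itv/= ler_norml => /andP[h1 h2]; apply/andP; split; lra.
  rewrite lee_fin ler_pM//.
    by rewrite -lee_fin correlation_fineK// H.
  rewrite /K ler_wpM2l ?mulr_ge0 ?exprn_ge0//.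
  apply: (@le_trans _ _ (gaussd (4 * e)^-1 x z)); last by rewrite lerDl expR_ge0.
  rewrite /gaussd -expRM_natl ler_expR mulrN lerN2.
  rewrite ler_pdivrMl ?mulr_gt0//.
  apply: (@le_trans _ _ (\sum_(i < d) e)).
    apply: ler_sum => i _; rewrite -real_normK ?num_real// distrC.
    by rewrite -[leRHS](sqr_sqrtr (ltW e0)) lerXn2r ?nnegrE// sqrtr_ge0.
  rewrite sumr_const card_ord -mulr_natl le_eqVlt; apply/orP; left; apply/eqP.
  by field.
rewrite lee_fin in key.
rewrite -ler_pdivrMl; last by rewrite mulr_gt0// exprn_gt0// divr_gt0// expR_gt0.
apply: le_trans key.
have h1 := integral_gauss1_gt0 e0.
have se : 0 < Num.sqrt e by rewrite sqrtr_gt0.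
rewrite mulrC -mulrA ler_wpM2l// /K /mollify_cst.
have h2 : (2 * expR (- 1) / Num.sqrt e) ^+ d <= gauss1_mass e ^+ d.
  rewrite lerXn2r ?nnegrE// ?mulr_ge0 ?expR_ge0 ?invr_ge0 ?sqrtr_ge0//.
have h3 : 0 <= (expR (- (1 / 4)) * (2 * Num.sqrt e)) ^+ d.
  by rewrite exprn_ge0// !mulr_ge0 ?expR_ge0 ?sqrtr_ge0.
have := ler_wpM2r h3 h2; rewrite -exprMn.
have -> : 2 * expR (- 1) / Num.sqrt e * (expR (- (1 / 4)) * (2 * Num.sqrt e)) =
    (expR (5 / 4) / 4)^-1.
  have -> : (5 / 4 : R) = 1 + 1 / 4 by field.
  rewrite expRD !expRN; field.
  by rewrite !gt_eqF ?expR_gt0.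
rewrite exprVn exprMn [in leRHS]exprMn => h4.
rewrite invfM.
have -> : gauss1_mass e ^+ d / 2 * expR (- (1 / 4)) ^+ d * (2 * Num.sqrt e) ^+ d =
  2^-1 * (gauss1_mass e ^+ d * (expR (- (1 / 4)) ^+ d * (2 * Num.sqrt e) ^+ d)) by field.
by rewrite ler_wpM2l.
Qed.

(** Continuity of [gamma] into the extended half-line, used at finite levels
    below [gamma x], includes the points where [gamma] is infinite. *)
Lemma correlation_le_mollified x : (gamma x <=
  limn_einf (fun n => (mollify_cst * mollified n.+1%:R^-1 x)%:E))%E.
Proof.
apply: lt_near_le_limn_einf => [n|c c0 cx].
  by rewrite lee_fin mulr_ge0 ?mollify_cst_ge0// mollified_ge0// invr_gt0 ltr0n.
have : \forall z \near x, (c%:E < gamma z)%E.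
  have /(_ x) h := correlation_continuous hgamma.
  apply: (h [set y | (c%:E < y)%E]); apply: open_nbhs_nbhs; split => //; exact: open_ereal_gt_ereal.
move=> /nbhs_ballP[del /= del0 Hb].
near=> n; rewrite lee_fin; apply: mollified_lb => //.
move=> z xz; apply/ltW/Hb; rewrite -ball_normE /=.
rewrite [ltLHS]mx_normrE; apply/bigmax_ltP; split => //= -[i j] _ /=.
rewrite (ord1 i) !mxE; apply: le_lt_trans (xz j) _.
rewrite -[ltRHS]ger0_norm ?(ltW del0)// -sqrtr_sqr ltr_sqrt ?exprn_gt0//.
near: n; apply: (near_infty_natSinv_lt (PosNum _)); exact: exprn_gt0.
Unshelve. all: by end_near. Qed.

(** Averaging against the law of a random vector whose characteristic function
    [phi] is real and nonnegative. *)
Section expectation.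
Context d0 (Omega : measurableType d0) (P : probability Omega R).
Context (V : Omega -> rV) (phi : rV -> R).
Hypothesis mV : measurable_fun setT V.
Hypothesis hphi : forall xi, cintegral P (fun w => expi (dotrV xi (V w))) = (phi xi)%:C%C.
Hypothesis phi_ge0 : forall xi, 0 <= phi xi.

Let measurable_dot : measurable_fun [set: Omega * rV] (fun p => dotrV p.2 (V p.1)).
Proof.
apply: measurable_sum => i; apply: measurable_funM.
  exact: (measurableT_comp (measurable_rV_coord i) measurable_snd).
exact: (measurableT_comp (measurable_rV_coord i) (measurableT_comp mV measurable_fst)).
Qed.

Let mcos : measurable_fun setT (@cos R).
Proof. by apply: continuous_measurable_fun; exact: continuous_cos. Qed.

Let msin : measurable_fun setT (@sin R).
Proof. by apply: continuous_measurable_fun; exact: continuous_sin. Qed.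

Let mdot xi : measurable_fun setT (fun w => dotrV xi (V w)).
Proof. by apply: measurableT_comp => //; exact: measurable_dotrV. Qed.

Lemma integrable_cos_dotrV xi : P.-integrable setT (fun w => (cos (dotrV xi (V w)))%:E).
Proof.
apply: measurable_bounded_integrable => //.
- by rewrite (le_lt_trans (probability_le1 P measurableT))// ltry.
- by apply: measurableT_comp => //; exact: mdot.
- by exists 1; split => // M M1 w _ /=; rewrite (le_trans (cos_bound _))// ltW.
Qed.

Lemma integrable_sin_dotrV xi : P.-integrable setT (fun w => (sin (dotrV xi (V w)))%:E).
Proof.
apply: measurable_bounded_integrable => //.
- by rewrite (le_lt_trans (probability_le1 P measurableT))// ltry.
- by apply: measurableT_comp => //; exact: mdot.
- by exists 1; split => // M M1 w _ /=; rewrite (le_trans (sin_bound _))// ltW.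
Qed.

Let icos := integrable_cos_dotrV.
Let isin := integrable_sin_dotrV.

Lemma expectation_cos_charfun xi : (\int[P]_w (cos (dotrV xi (V w)))%:E = (phi xi)%:E)%E.
Proof.
have /(congr1 (@complex.Re R)) /= <- := hphi xi.
by rewrite /Rintegral fineK//; exact: integrable_fin_num.
Qed.

Let Esin xi : (\int[P]_w (sin (dotrV xi (V w)))%:E = 0)%E.
Proof.
have /(congr1 (@complex.Im R)) /= E := hphi xi.
rewrite -[LHS]fineK; last exact: integrable_fin_num.
by congr EFin.
Qed.

(** [1 + phi] is the integral of the nonnegative function
    [1 + cos (dotrV xi (V w))], measurable by Tonelli. *)
Lemma measurable_real_charfun : measurable_fun setT phi.
Proof.
have m1 : measurable_fun [set: Omega * rV] (fun p => (1 + cos (dotrV p.2 (V p.1)))%:E).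
  apply/measurable_EFinP; apply: measurable_funD => //.
  exact: (measurableT_comp mcos measurable_dot).
have m10 p : (0 <= (1 + cos (dotrV p.2 (V p.1)))%:E :> \bar R)%E.
  by rewrite lee_fin -lerBlDl sub0r cos_geN1.
have := @measurable_fun_fubini_tonelli_G _ _ _ _ _ P (fun p : Omega * rV => (1 + cos (dotrV p.2 (V p.1)))%:E) m1 m10.
rewrite (_ : fubini_G P _ = (fun xi => (1 + phi xi)%:E)); last first.
  apply/funext => xi; rewrite /fubini_G /=.
  under eq_integral do rewrite EFinD.
  rewrite integralD//; last first.
    by apply: finite_measure_integrable_cst.
  by rewrite expectation_cos_charfun integral_cst//= mul1e probability_setT.
move=> /measurable_EFinP m; rewrite (_ : phi = fun xi => 1 + phi xi - 1).
  exact: measurable_funB.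
by apply/funext => xi; rewrite addrAC subrr add0r.
Qed.

(** Fubini moves the expectation inside the integral over frequencies, where it
    produces the characteristic function; the shift [y] contributes only a
    cosine, so the bound is uniform in [y]. *)
Lemma expectation_mollified_le (e : R) (y : rV) : 0 < e ->
  measurable_fun setT (fun w => mollified e (V w + y)) /\
  (\int[P]_w (mollified e (V w + y))%:E <=
   \int[leb_rV d]_xi (Num.max (ghat xi) 0 * phi xi)%:E)%E.
Proof.
move=> e0; pose h (p : Omega * rV) : R :=
  ghat p.2 * (cos (dotrV (V p.1 + y) p.2) * gaussd e 0 p.2).
have mg : measurable_fun setT ghat by case: tg.
have dD w xi : dotrV (V w + y) xi = dotrV xi (V w) + dotrV y xi.
  by rewrite /dotrV -big_split/=; apply: eq_bigr => i _; rewrite mxE mulrDl mulrC.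
have mh : measurable_fun setT h.
  apply: measurable_funM; first exact: (measurableT_comp mg measurable_snd).
  apply: measurable_funM; last first.
    exact: (measurableT_comp (measurable_gaussd _ _) measurable_snd).
  apply: (@measurableT_comp _ _ _ _ _ _ (@cos R)) => //.
  rewrite (_ : (fun p : Omega * rV => _) = (fun p : Omega * rV => dotrV p.2 (V p.1) + dotrV y p.2)).
    apply: measurable_funD => //.
    exact: (measurableT_comp (measurable_dotrV _) measurable_snd).
  by apply/funext => p; rewrite dD.
have mG : measurable_fun setT (fun xi => ghat xi * gaussd e 0 xi).
  by apply: measurable_funM => //; exact: measurable_gaussd.
have ig := tempered_integrable_gaussd 0 tg e0.
have ih : (P \x leb_rV d)%E.-integrable setT (EFin \o h).
  apply/integrable12ltyP; first exact/measurable_EFinP.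
  apply: (@le_lt_trans _ _ (\int[P]_w \int[leb_rV d]_xi `|(ghat xi * gaussd e 0 xi)%:E|)%E).
    apply: ge0_le_integral => //.
    - by move=> w _; apply: integral_ge0.
    - apply: (measurable_fun_fubini_tonelli_F (m2 := leb_rV d) (abse \o (EFin \o h))) => //.
      by apply: measurableT_comp => //; exact/measurable_EFinP.
    - by move=> p; exact: abse_ge0.
    - move=> w _; apply: ge0_le_integral => //.
      + apply: measurableT_comp => //; apply/measurable_EFinP.
        exact: (measurableT_comp mh (pair1_measurable w)).
      + by apply: measurableT_comp => //; exact/measurable_EFinP.
      + move=> xi _; rewrite !abse_EFin lee_fin /h/= !normrM ler_wpM2l//.
        by rewrite ler_piMl// cos_bound.
  rewrite integral_cst//= probability_setT mule1.
  by have /integrableP[] := ig.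
have iw w : (leb_rV d).-integrable setT (fun xi => (h (w, xi))%:E).
  exact: (tempered_integrable_wave tg e0 (gauss_wave_cos e 0 (V w + y))).
have LE w : ((mollified e (V w + y))%:E = \int[leb_rV d]_xi (h (w, xi))%:E)%E.
  by rewrite /mollified /Rintegral fineK//; exact: (integrable_fin_num measurableT (iw w)).
split.
  apply/measurable_EFinP; rewrite /comp; under eq_fun do rewrite LE.
  exact: (measurable_fubini_F ih).
under eq_integral do rewrite LE.
rewrite (Fubini ih).
have mphi := measurable_real_charfun.
have mgp : measurable_fun setT (fun xi => Num.max (ghat xi) 0 * phi xi).
  by apply: measurable_funM => //; exact: measurable_maxr.
pose u xi := ghat xi * (cos (dotrV y xi) * phi xi * gaussd e 0 xi).
have mu_ : measurable_fun setT (EFin \o u).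
  apply/measurable_EFinP; apply: measurable_funM => //; apply: measurable_funM.
    by apply: measurable_funM => //; exact: measurable_cos_dotrV.
  exact: measurable_gaussd.
apply: (@le_trans _ _ (\int[leb_rV d]_xi (u xi)%:E)%E).
  rewrite le_eqVlt; apply/orP; left; apply/eqP; apply: eq_integral => xi _.
  transitivity (\int[P]_w ((ghat xi * gaussd e 0 xi * cos (dotrV y xi))%:E * (cos (dotrV xi (V w)))%:E -
     (ghat xi * gaussd e 0 xi * sin (dotrV y xi))%:E * (sin (dotrV xi (V w)))%:E))%E.
    apply: eq_integral => w _; rewrite /h/= -!EFinM -EFinB; congr EFin.
    by rewrite dD cosD; ring.
  rewrite integralB//; last 2 first.
  - exact: integrableZl.
  - exact: integrableZl.
  rewrite !integralZl// expectation_cos_charfun Esin mule0 sube0 -EFinM; congr EFin.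
  by rewrite /u; ring.
rewrite integralE; apply: (@le_trans _ _ (\int[leb_rV d]_xi ((EFin \o u)^\+ xi))%E).
  by rewrite geeDl// leeNl oppe0; apply: integral_ge0.
apply: ae_ge0_le_integral => //.
- exact: measurable_funepos.
- by move=> xi _; rewrite lee_fin mulr_ge0// le_max lexx orbT.
- exact/measurable_EFinP.
have := correlation_fourier_ge0 hgamma; apply: filterS => xi g0 _.
rewrite funeposE ge_max; apply/andP; split; rewrite lee_fin; last first.
  by rewrite mulr_ge0// le_max lexx orbT.
rewrite (max_idPl g0) ler_wpM2l//.
rewrite -mulrA mulrCA -[leRHS]mulr1 ler_wpM2l//.
rewrite (le_trans (ler_norm _))// normrM -[leRHS]mulr1 ler_pM//.
  exact: cos_bound.
rewrite ger0_norm ?expR_ge0// /gaussd -expR0 ler_expR oppr_le0.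
by rewrite mulr_ge0 ?(ltW e0)//; apply: sumr_ge0 => i _; exact: sqr_ge0.
Qed.

(** Fatou's lemma along the regularizations. *)
Lemma expectation_correlation_le (y : rV) :
  (\int[P]_w gamma (V w + y) <= mollify_cst%:E *
   \int[leb_rV d]_xi (Num.max (ghat xi) 0 * phi xi)%:E)%E.
Proof.
pose L n w := (mollify_cst * mollified n.+1%:R^-1 (V w + y))%:E.
have e0 n : 0 < n.+1%:R^-1 :> R by rewrite invr_gt0 ltr0n.
have mL0 n := (expectation_mollified_le y (e0 n)).1.
have mL n : measurable_fun setT (L n).
  by apply/measurable_EFinP; exact: measurable_funM.
have L0 n w : (0 <= L n w)%E.
  by rewrite lee_fin mulr_ge0 ?mollify_cst_ge0// mollified_ge0.
have mVy : measurable_fun setT (fun w => V w + y).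
  apply: measurable_fun_rVP => i.
  rewrite (_ : (fun x => _) = (fun w => V w ord0 i + y ord0 i)); last first.
    by apply/funext => w; rewrite mxE.
  apply: measurable_funD => //.
    exact: (measurableT_comp (measurable_rV_coord i) mV).
apply: (@le_trans _ _ (\int[P]_w limn_einf (L ^~ w))%E).
  apply: ge0_le_integral => //.
  - by move=> w _; exact: correlation_ge0 hgamma _.
  - by apply: measurableT_comp => //; exact: measurable_correlation.
  - rewrite (_ : (fun w => _) = (fun w => - limn_esup (-%E \o (L ^~ w)))%E).
      apply: measurableT_comp => //; apply: measurable_fun_limn_esup => n.
      exact: measurableT_comp.
    by apply/funext => w; rewrite limn_esupN oppeK.
  - by move=> w _; exact: correlation_le_mollified.
apply: (le_trans (fatou P measurableT mL _)) => //.
apply: limn_einf_le => n; rewrite /L.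
under eq_integral do rewrite EFinM.
rewrite ge0_integralZl//; last 3 first.
- exact/measurable_EFinP.
- by move=> w _; rewrite lee_fin mollified_ge0.
- by rewrite lee_fin mollify_cst_ge0.
apply: lee_wpmul2l; first by rewrite lee_fin mollify_cst_ge0.
exact: (expectation_mollified_le y (e0 n)).2.
Qed.

End expectation.

End correlation.

(** * Integrability of the singular time kernel *)
Section time_kernel.
Context {R : realType} (b : R) (hb : 0 < b < 1).
Local Notation mu := (@lebesgue_measure R).

Let b0 : 0 < b. Proof. by case/andP: hb. Qed.
Let b1 : 0 < 1 - b. Proof. by rewrite subr_gt0; case/andP: hb. Qed.

Let one_powR r : 1 `^ r = 1 :> R. Proof. by rewrite powR1. Qed.

Lemma measurable_powRN : measurable_fun setT (fun s : R => s `^ (- b)).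
Proof. exact: measurable_powR. Qed.

Lemma integral_powRN_seg (e u : R) : 0 < e -> e < u ->
  (\int[mu]_(s in `[e, u]) (s `^ (- b))%:E <= (u `^ (1 - b) / (1 - b))%:E)%E.
Proof.
move=> e0 eu; pose F (s : R) := s `^ (1 - b) / (1 - b).
have pos s : e <= s -> 0 < s by move=> es; exact: lt_le_trans e0 es.
have dF (s : R) : 0 < s -> is_derive s 1 F (s `^ (- b)).
  move=> s0.
  have h : is_derive s 1 (fun s : R => (1 - b)^-1 * s `^ (1 - b))
      ((1 - b)^-1 * ((1 - b) * s `^ (1 - b - 1))).
    have := is_derive1_powR (1 - b) s0 => hh.
    apply: is_derive_eq; rewrite /GRing.scale/=.
    by rewrite ?mulr0 ?addr0.
  have -> : F = (fun s : R => (1 - b)^-1 * s `^ (1 - b)).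
    by apply/funext => x; rewrite /F mulrC.
  apply: (is_derive_eq h); rewrite mulKf ?gt_eqF//.
  by congr (_ `^ _); ring.
have cF s : 0 < s -> {for s, continuous F}.
  move=> s0; apply: differentiable_continuous; apply/derivable1_diffP.
  by have [] := dF s s0.
rewrite (@continuous_FTC2 _ _ F)//.
- rewrite -EFinB lee_fin /F lerBlDr lerDl divr_ge0 ?powR_ge0//.
  exact: ltW.
- apply: continuous_in_subspaceT => s; rewrite inE/= in_itv/= => /andP[es _].
  have s0 := pos _ es.
  apply: differentiable_continuous; apply/derivable1_diffP.
  by have [] := is_derive1_powR (- b) s0.
- split.
  + move=> s; rewrite in_itv/= => /andP[es _].
    by have [] := dF s (lt_trans e0 es).
  + exact/cvg_at_right_filter/cF.
  + by apply/cvg_at_left_filter/cF; exact: lt_trans eu.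
- move=> s; rewrite in_itv/= => /andP[es _]; rewrite derive1E.
  by have [_ ->] := dF s (lt_trans e0 es).
Qed.

Lemma integral_powRN (u : R) : 0 < u ->
  (\int[mu]_(s in `]0%R, u]) (s `^ (- b))%:E <= (u `^ (1 - b) / (1 - b))%:E)%E.
Proof.
move=> u0; pose E n : set R := `[(u / n.+2%:R)%R, u]%classic.
have mE n : measurable (E n) by exact: measurable_itv.
have EU : `]0, u]%classic = \bigcup_n E n.
  apply/seteqP; split=> [s /=|s [n _]]; last first.
    rewrite /E /= !in_itv/= => /andP[h ->]; rewrite andbT.
    by apply: lt_le_trans h; rewrite divr_gt0// ltr0n.
  rewrite in_itv/= => /andP[s0 su].
  exists (Num.bound (u / s)) => //; rewrite /E /= in_itv/= su andbT.
  rewrite ler_pdivrMr ?ltr0n// mulrC -ler_pdivrMr//.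
  rewrite (le_trans (ltW (archi_boundP _)))// ?divr_ge0 ?(ltW u0) ?(ltW s0)//.
  by rewrite ler_nat; apply: leq_trans (leqnSn _) (leqnSn _).
have ndE : nondecreasing_seq E.
  move=> m n mn; rewrite /E subsetEset => s; rewrite /= !in_itv/= => /andP[h ->].
  rewrite andbT; apply: le_trans h.
  rewrite ler_wpM2l ?(ltW u0)// lef_pV2 ?posrE ?ltr0n// ler_nat.
  by rewrite !ltnS.
have := @ge0_nondecreasing_set_cvg_integral _ (measurableTypeR R) R E (fun s : R => (s `^ (- b))%:E) mu ndE mE.
rewrite -EU => /(_ _ _)/cvg_lim <-//.
- apply: lime_le.
    apply/cvg_ex; eexists; apply: (@ge0_nondecreasing_set_cvg_integral _ (measurableTypeR R) R E (fun s : R => (s `^ (- b))%:E) mu ndE mE) => //.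
      by move=> n; apply: measurable_funTS; apply/measurable_EFinP; exact: measurable_powRN.
    by move=> n s _; rewrite lee_fin powR_ge0.
  apply: nearW => n; apply: integral_powRN_seg.
    by rewrite divr_gt0// ltr0n.
  by rewrite ltr_pdivrMr ?ltr0n// ltr_pMr// ltr1n.
- by move=> n; apply: measurable_funTS; apply/measurable_EFinP; exact: measurable_powRN.
- by move=> n s _; rewrite lee_fin powR_ge0.
Qed.

Lemma integral_expR_seg (a u v : R) : 0 < a -> u < v ->
  (\int[mu]_(s in `[u, v]) (expR (- (s * a)))%:E <= (expR (- (u * a)) / a)%:E)%E.
Proof.
move=> a0 uv; pose F (s : R) := - (expR (- (s * a)) / a).
have dF (s : R) : is_derive s 1 F (expR (- (s * a))).
  rewrite /F; apply: is_derive_eq; rewrite /GRing.scale/=.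
  by field; rewrite gt_eqF.
have cF : continuous F.
  move=> s; apply: differentiable_continuous; apply/derivable1_diffP.
  by have [] := dF s.
rewrite (@continuous_FTC2 _ _ F)//.
- rewrite -EFinB lee_fin /F opprK -[leRHS]add0r lerD2r oppr_le0.
  by rewrite divr_ge0 ?expR_ge0// ltW.
- apply: continuous_subspaceT => s.
  apply: differentiable_continuous; apply/derivable1_diffP.
  by apply: ex_derive.
- split.
  + by move=> s _; have [] := dF s.
  + exact/cvg_at_right_filter/cF.
  + exact/cvg_at_left_filter/cF.
- by move=> s _; rewrite derive1E; have [_ ->] := dF s.
Qed.

(** The first summand serves the exponents [a <= 1], where the exponential is
    ignored; the second one serves [a > 1], splitting the integral at [1 / a]. *)
Definition time_kernel_cst (t : R) : R :=
  2 * (t `^ (1 - b) / (1 - b)) + 2 * ((1 - b)^-1 + 1).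

Lemma time_kernel_cst_ge0 t : 0 <= time_kernel_cst t.
Proof.
have := ltW b1 => b1'.
by rewrite addr_ge0// mulr_ge0// ?addr_ge0 ?divr_ge0 ?powR_ge0 ?invr_ge0.
Qed.

(** Scaling: the relevant times are of order [1 / a]. Before [1 / a] the
    exponential is bounded by 1, after [1 / a] the power is bounded by [a ^ b];
    both parts have order [a ^ (b - 1)]. *)
Lemma laplace_powRN_le (a t : R) : 0 <= a -> 0 < t ->
  (\int[mu]_(s in `]0%R, t]) (s `^ (- b) * expR (- (s * a)))%:E <=
   (time_kernel_cst t * (1 + a `^ (1 - b))^-1)%:E)%E.
Proof.
move=> a0 t0; have := ltW b1 => b1'.
have mk : measurable_fun setT (fun s : R => (s `^ (- b) * expR (- (s * a)))%:E).
  apply/measurable_EFinP; apply: measurable_funM; first exact: measurable_powRN.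
  by apply: measurableT_comp => //; apply: measurable_funN; exact: measurable_funM.
have mp : measurable_fun setT (fun s : R => (s `^ (- b))%:E).
  by apply/measurable_EFinP; exact: measurable_powRN.
have le1 (u : R) : 0 < u -> (\int[mu]_(s in `]0%R, u]) (s `^ (- b) * expR (- (s * a)))%:E <=
   (u `^ (1 - b) / (1 - b))%:E)%E.
  move=> u0; apply: le_trans (integral_powRN u0).
  apply: ge0_le_integral => //.
  - by move=> s _; rewrite lee_fin mulr_ge0 ?powR_ge0 ?expR_ge0.
  - exact: measurable_funTS.
  - exact: measurable_funTS.
  - move=> s; rewrite /= in_itv/= => /andP[s0 _]; rewrite lee_fin.
    rewrite ler_piMr ?powR_ge0// -expR0 ler_expR oppr_le0 mulr_ge0//.
    exact: ltW.
have A0 : 0 < 1 + a `^ (1 - b) by rewrite ltr_pwDl// powR_ge0.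
have T0 : 0 <= t `^ (1 - b) / (1 - b) by rewrite divr_ge0// powR_ge0.
have [a1|a1] := leP a 1.
  apply: (le_trans (le1 t t0)); rewrite lee_fin ler_pdivlMr//.
  apply: (@le_trans _ _ (t `^ (1 - b) / (1 - b) * 2)).
    rewrite ler_wpM2l//; have : a `^ (1 - b) <= 1.
      by rewrite -[leRHS](one_powR (1 - b)) ge0_ler_powR// nnegrE.
    by lra.
  rewrite mulrC /time_kernel_cst lerDl mulr_ge0// addr_ge0// invr_ge0//.
have a00 : 0 < a by rewrite (lt_trans _ a1).
have ab1 : 1 <= a `^ (1 - b).
  by rewrite -[leLHS](one_powR (1 - b)) ge0_ler_powR// ?nnegrE// ltW.
have Hgoal : (a `^ (1 - b))^-1 * ((1 - b)^-1 + 1) <=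
    time_kernel_cst t * (1 + a `^ (1 - b))^-1.
  rewrite ler_pdivlMr// -mulrA ler_pdivrMl ?(lt_le_trans _ ab1)//.
  rewrite /time_kernel_cst; set A := a `^ _; set T := _ / _; set X := _ + 1.
  have X0 : 0 <= X by rewrite addr_ge0// invr_ge0.
  have h1 : 0 <= A * T by rewrite mulr_ge0// powR_ge0.
  have h2 : 0 <= (A - 1) * X by rewrite mulr_ge0// subr_ge0.
  by lra.
have aV : (a^-1) `^ (1 - b) = (a `^ (1 - b))^-1.
  by rewrite -[a^-1]powR_inv1// -powRrM mulrC powRrM powR_inv1// powR_ge0.
have [ta|ta] := leP t a^-1.
  apply: (le_trans (le1 t t0)); rewrite lee_fin (le_trans _ Hgoal)//.
  apply: (@le_trans _ _ ((a `^ (1 - b))^-1 / (1 - b))).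
    rewrite ler_wpM2r ?invr_ge0// -aV ge0_ler_powR// ?nnegrE ?invr_ge0// ltW//.
  by rewrite ler_wpM2l ?invr_ge0 ?powR_ge0// lerDl.
have aV0 : 0 < a^-1 by rewrite invr_gt0.
have -> : `]0, t]%classic = `]0, a^-1]%classic `|` `]a^-1, t]%classic.
  by rewrite -itv_bndbnd_setU// bnd_simp// ltW.
rewrite ge0_integral_setU//=; last 3 first.
- exact: measurable_funTS.
- by move=> s _; rewrite lee_fin mulr_ge0 ?powR_ge0 ?expR_ge0.
- apply/disj_setPS => s [] /=; rewrite !in_itv/= => /andP[_ h1] /andP[h2 _].
  by have := lt_le_trans h2 h1; rewrite ltxx.
apply: (@le_trans _ _ (((a `^ (1 - b))^-1 / (1 - b))%:E + (a `^ (1 - b))^-1%:E)%E).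
  apply: leeD; first by rewrite -aV; exact: le1.
  apply: (@le_trans _ _ (\int[mu]_(s in `[a^-1%R, t]) ((a `^ b)%:E * (expR (- (s * a)))%:E))%E).
    apply: (@le_trans _ _ (\int[mu]_(s in `[a^-1%R, t]) (s `^ (- b) * expR (- (s * a)))%:E)%E).
      apply: ge0_subset_integral => //.
      - exact: measurable_funTS.
      - by move=> s _; rewrite lee_fin mulr_ge0 ?powR_ge0 ?expR_ge0.
      - by apply: subset_itvr; rewrite bnd_simp.
    apply: ge0_le_integral => //.
    - by move=> s _; rewrite lee_fin mulr_ge0 ?powR_ge0 ?expR_ge0.
    - exact: measurable_funTS.
    - apply: measurable_funTS; apply/measurable_EFinP; apply: measurable_funM => //.
      by apply: measurableT_comp => //; apply: measurable_funN; exact: measurable_funM.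
    - move=> s; rewrite /= in_itv/= => /andP[h _]; rewrite -EFinM lee_fin.
      rewrite ler_wpM2r ?expR_ge0// powRN -[leRHS]invrK lef_pV2 ?posrE; last 2 first.
      + by rewrite powR_gt0// (lt_le_trans aV0).
      + by rewrite invr_gt0 powR_gt0.
      have -> : (a `^ b)^-1 = a^-1 `^ b.
        by rewrite -[a^-1]powR_inv1// -powRrM mulrC powRrM powR_inv1// powR_ge0.
      by rewrite ge0_ler_powR// ?nnegrE ?(ltW b0)// ?(ltW aV0)// (le_trans (ltW aV0)).
  rewrite ge0_integralZl//=; last 2 first.
  - apply: measurable_funTS; apply/measurable_EFinP.
    by apply: measurableT_comp => //; apply: measurable_funN; exact: measurable_funM.
  - by rewrite lee_fin powR_ge0.
  apply: (@le_trans _ _ ((a `^ b)%:E * (a^-1)%:E)%E).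
    apply: lee_wpmul2l; first by rewrite lee_fin powR_ge0.
    apply: (le_trans (integral_expR_seg a00 ta)); rewrite lee_fin.
    rewrite -[leRHS]mul1r ler_wpM2r ?(ltW aV0)// -expR0 ler_expR.
    by rewrite oppr_le0 mulVf ?gt_eqF.
  rewrite -EFinM lee_fin -[X in _ * X]powR_inv1// -powRD; last first.
    by rewrite (gt_eqF a00) implybT.
  by rewrite -powRN opprB addrC.
rewrite -EFinD lee_fin (le_trans _ Hgoal)// mulrDr mulr1.
by [].
Qed.

Local Open Scope ereal_scope.

(** By Tonelli the time integral can be computed first, at a fixed [x], where it
    is the Laplace transform estimated by [laplace_powRN_le]. *)
Lemma integral_kernel_lty d (T : measurableType d)
    (m : {sigma_finite_measure set T -> \bar R}) (g psi : T -> R) (t : R) :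
  measurable_fun setT g -> measurable_fun setT psi ->
  (forall x, 0 <= g x)%R -> (forall x, 0 <= psi x)%R -> (0 < t)%R ->
  \int[m]_x ((1 + psi x `^ (1 - b))^-1 * g x)%:E < +oo ->
  \int[mu]_(s in `]0%R, t]) ((s `^ (- b))%:E *
      \int[m]_x (g x * expR (- (s * psi x)))%:E) < +oo.
Proof.
move=> mg mpsi g0 psi0 t0 fin.
have mD : measurable_fun setT (fun x => ((1 + psi x `^ (1 - b))^-1)%R).
  rewrite (_ : (fun x => _) = (fun x => ((1 + psi x `^ (1 - b)) `^ (-1))%R)).
    have m1 : measurable_fun setT (fun x => (1 + psi x `^ (1 - b))%R).
      apply: measurable_funD => //.
      exact: (measurableT_comp (measurable_powR (1 - b)%R) mpsi).
    exact: (measurableT_comp (measurable_powR (-1)%R) m1).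
  by apply/funext => x; rewrite powR_inv1// addr_ge0// powR_ge0.
pose F (p : measurableTypeR R * T) : \bar R :=
  (\1_(`]0%R, t]%classic : set R) p.1 * (p.1 `^ (- b) * (g p.2 * expR (- (p.1 * psi p.2)))))%:E.
have mF : measurable_fun setT F.
  apply/measurable_EFinP; apply: measurable_funM.
    exact: (measurableT_comp (measurable_indic (measurable_itv _)) measurable_fst).
  apply: measurable_funM.
    exact: (measurableT_comp measurable_powRN measurable_fst).
  apply: measurable_funM; first exact: (measurableT_comp mg measurable_snd).
  apply: measurableT_comp => //; apply: measurable_funN.
  apply: measurable_funM; first exact: measurable_fst.
  exact: (measurableT_comp mpsi measurable_snd).
have F0 p : 0 <= F p.
  by rewrite lee_fin mulr_ge0 ?mulr_ge0 ?powR_ge0 ?expR_ge0 ?ler0n// indicE.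
have E1 s : s \in `]0%R, t]%classic -> (s `^ (- b))%:E *
      \int[m]_x (g x * expR (- (s * psi x)))%:E = \int[m]_x F (s, x).
  move=> sI; rewrite -ge0_integralZl//=.
  - by apply: eq_integral => x _; rewrite /F /= indicE sI mul1r EFinM.
  - apply/measurable_EFinP; apply: measurable_funM => //.
    by apply: measurableT_comp => //; apply: measurable_funN; exact: measurable_funM.
  - by move=> x _; rewrite lee_fin mulr_ge0// expR_ge0.
  - by rewrite lee_fin powR_ge0.
have -> : \int[mu]_(s in `]0%R, t]) ((s `^ (- b))%:E *
      \int[m]_x (g x * expR (- (s * psi x)))%:E) =
    \int[mu]_(s in `]0%R, t]) \int[m]_x F (s, x).
  by apply: eq_integral => s sI; exact: E1.
rewrite integral_mkcond.
have -> : \int[mu]_s ((fun s => \int[m]_x F (s, x)) \_ `]0%R, t]) s =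
    \int[mu]_s \int[m]_x F (s, x).
  apply: eq_integral => s _; rewrite /patch; case: ifPn => // sI.
  by rewrite integral0_eq// => x _; rewrite /F /= indicE (negbTE sI) mul0r.
rewrite (fubini_tonelli (m1 := mu) (m2 := m) F mF F0).
apply: (@le_lt_trans _ _ (\int[m]_x ((time_kernel_cst t)%:E *
    ((1 + psi x `^ (1 - b))^-1 * g x)%:E))).
  apply: ge0_le_integral => //.
  - by move=> x _; apply: integral_ge0.
  - exact: (measurable_fun_fubini_tonelli_G (m1 := mu) F mF F0).
  - apply/measurable_EFinP; apply: measurable_funM => //; exact: measurable_funM.
  - move=> x _.
    have -> : \int[mu]_s F (s, x) = (g x)%:E *
        \int[mu]_(s in `]0%R, t]) (s `^ (- b) * expR (- (s * psi x)))%:E.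
      rewrite -ge0_integralZl//=; last 3 first.
      + apply: measurable_funTS; apply/measurable_EFinP; apply: measurable_funM.
          exact: measurable_powRN.
        by apply: measurableT_comp => //; apply: measurable_funN; exact: measurable_funM.
      + by move=> s _; rewrite lee_fin mulr_ge0 ?powR_ge0 ?expR_ge0.
      + by rewrite lee_fin.
      rewrite [RHS]integral_mkcond; apply: eq_integral => s _.
      rewrite /F /= /patch indicE; case: ifPn => sI; last by rewrite mul0r.
      by rewrite mul1r -EFinM; congr EFin; ring.
    apply: (@le_trans _ _ ((g x)%:E * (time_kernel_cst t * (1 + psi x `^ (1 - b))^-1)%:E)).
      by apply: lee_wpmul2l; [rewrite lee_fin|exact: laplace_powRN_le].
    by rewrite -!EFinM lee_fin mulrCA [(g x * _)%R]mulrC.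
rewrite ge0_integralZl//.
- by rewrite lte_mul_pinfty// lee_fin time_kernel_cst_ge0.
- apply/measurable_EFinP; exact: measurable_funM.
- by move=> x _; rewrite lee_fin mulr_ge0// invr_ge0 addr_ge0// powR_ge0.
- by rewrite lee_fin time_kernel_cst_ge0.
Qed.

End time_kernel.

(** Dominated convergence: the damping factor tends to 0 at every positive time. *)
Lemma exp_damping {R : realType} (k : R -> \bar R) (t delta : R) :
  measurable_fun setT k -> (forall s, 0 <= k s)%E -> (0 < delta)%R ->
  (\int[lebesgue_measure]_(s in `]0%R, t]) k s < +oo)%E ->
  exists M : nat, (\int[lebesgue_measure]_(s in `]0%R, t])
     ((expR (- (M%:R * s)))%:E * k s) <= delta%:E)%E.
Proof.
move=> mk k0 d0 fin.
have ik : (@lebesgue_measure R).-integrable `]0%R, t] k.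
  apply/integrableP; split; first exact: measurable_funTS.
  by under eq_integral do rewrite gee0_abs//.
pose f (n : nat) (s : R) : \bar R := ((expR (- (n%:R * s)))%:E * k s)%E.
have mf n : measurable_fun setT (f n).
  apply: emeasurable_funM => //; apply/measurable_EFinP.
  by apply: measurableT_comp => //; apply: measurable_funN; exact: measurable_funM.
have mI : measurable (`]0%R, t]%classic : set (measurableTypeR R)) by exact: measurable_itv.
have ff : {ae (@lebesgue_measure R), forall s, `]0%R, t]%classic s ->
    f ^~ s @ \oo --> (cst 0%E s : \bar R)}.
  have := integrable_ae mI ik; apply: filterS => s ks sI.
  have ksf := ks sI.
  have s0 : 0 < s by move: sI; rewrite /= in_itv/= => /andP[].
  rewrite (_ : f ^~ s = (fun n => (expR (- s) ^+ n * fine (k s))%:E)); last first.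
    by apply/funext => n; rewrite /f EFinM (fineK ksf) -expRM_natl mulrN.
  apply: cvg_EFin; first exact: nearW.
  rewrite -[X in _ --> X](mul0r (fine (k s))).
  apply: cvgMl; apply: cvg_expr.
  by rewrite ger0_norm ?expR_ge0// -expR0 ltr_expR oppr_lt0.
have fg : {ae (@lebesgue_measure R), forall s n, `]0%R, t]%classic s ->
    (`|f n s| <= k s)%E}.
  apply: aeW => s n; rewrite /= in_itv/= => /andP[s0 _].
  rewrite gee0_abs; last by rewrite mule_ge0// lee_fin expR_ge0.
  rewrite -[leRHS]mul1e; apply: lee_wpmul2r => //.
  by rewrite lee_fin -expR0 ler_expR oppr_le0 mulr_ge0// ltW.
have [_ _] := @dominated_convergence _ _ _ (@lebesgue_measure R) `]0%R, t]%classic mI f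
  (cst 0%E) k (fun n => measurable_funTS (mf n)) (measurable_cst _) ff ik fg.
rewrite integral0 => cv.
have nb : nbhs (0%E : \bar R) [set y | (y < delta%:E)%E].
  apply: open_nbhs_nbhs; split; last by rewrite /= lte_fin.
  exact: open_ereal_lt_ereal.
have [n _ Hn] := cv _ nb.
by exists n; apply/ltW/(Hn n) => /=.
Qed.

(** * Products of correlations along independent increments *)
Lemma emeasurable_prod {R : realType} d (T : measurableType d) (I : Type)
    (s : seq I) (f : I -> T -> \bar R) : (forall i, measurable_fun setT (f i)) ->
  measurable_fun setT (fun x => \prod_(i <- s) f i x)%E.
Proof.
move=> mf; elim: s => [|i s IHs].
  rewrite (_ : (fun x => _) = cst 1%E); first exact: measurable_cst.
  by apply/funext => x; rewrite big_nil.
rewrite (_ : (fun x => _) = (fun x => f i x * \prod_(j <- s) f j x)%E); last first.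
  by apply/funext => x; rewrite big_cons.
exact: emeasurable_funM.
Qed.

Section independence.
Context {R : realType} d0 (Omega : measurableType d0) (P : probability Omega R).
Context (d : nat).
Local Notation rV := 'rV[R]_d.
Context (G : set (set Omega)) (xi : Omega -> rV).
Hypothesis GI : setI_closed G.
Hypothesis mG : G `<=` measurable.
Hypothesis mxi : measurable_fun setT xi.
Hypothesis GT : forall B, measurable B ->
  forall A, G A -> P (A `&` xi @^-1` B) = (P A * P (xi @^-1` B))%E.

Let OmegaG := g_sigma_algebraType G.

Lemma sigma_sub_measurable : <<s G >> `<=` @measurable _ Omega.
Proof. by apply: smallest_sub => //; exact: sigma_algebra_measurable. Qed.

Let mxiB B : measurable B -> measurable (xi @^-1` B).
Proof. by move=> mB; rewrite -[X in measurable X]setTI; exact: mxi. Qed.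

(** Dynkin's argument: the events independent of [xi] form a Dynkin system
    containing the pi-system [G]. *)
Lemma sigma_indep A B : <<s G >> A -> measurable B ->
  P (A `&` xi @^-1` B) = (P A * P (xi @^-1` B))%E.
Proof.
move=> sA mB; have mxB := mxiB mB.
pose D := [set A | measurable A /\ P (A `&` xi @^-1` B) = (P A * P (xi @^-1` B))%E].
suff : <<s G >> `<=` D by move=> /(_ _ sA)[].
rewrite -(setI_closed_g_dynkin_g_sigma_algebra GI).
apply: smallest_sub; last by move=> C GC; split; [exact: mG|exact: GT].
split => [|C [mC eC]|F tF DF].
- by split => //; rewrite setTI probability_setT mul1e.
- split; first exact: measurableC.
  have -> : ~` C `&` xi @^-1` B = xi @^-1` B `\` (C `&` xi @^-1` B).
    by apply/seteqP; split=> w /=; [move=> [h1 h2]; split => // -[]|move=> [h1 h2]; split => // h3; apply: h2].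
  rewrite measureD//; last 2 first.
  - exact: measurableI.
  - by rewrite (le_lt_trans (probability_le1 P mxB))// ltry.
  rewrite (_ : xi @^-1` B `&` (C `&` xi @^-1` B) = C `&` xi @^-1` B); last first.
    by apply/seteqP; split=> w /=; [move=> []|move=> [h1 h2]; split].
  rewrite probability_setC// [X in (_ - X)%E]eC.
  by rewrite muleBl ?mul1e// ?fin_num_measure//.
- have mF n : measurable (F n) by have [] := DF n.
  split; first exact: bigcup_measurable.
  rewrite setI_bigcupl measure_bigcup//; last 2 first.
  - by move=> n _; exact: measurableI.
  - exact: trivIset_setIr.
  have -> : P (xi @^-1` B) = (fine (P (xi @^-1` B)))%:E.
    by rewrite fineK// fin_num_measure.
  rewrite measure_bigcup// muleC -nneseriesZl; last by move=> n _; exact: measure_ge0.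
  apply: eq_eseriesr => n _; rewrite [LHS](DF n).2 muleC fineK//.
  exact: fin_num_measure.
Qed.

Let idG : Omega -> OmegaG := id.
Let midG : measurable_fun setT idG.
Proof. by move=> _ Y mY; rewrite setTI; exact: sigma_sub_measurable. Qed.

Let idm : {mfun Omega >-> OmegaG} := mfun_Sub (mem_set midG).
Let xim : {mfun Omega >-> rV} := mfun_Sub (mem_set mxi).

Let PG := distribution P idm.
Let PX := distribution P xim.

(** Freezing: the identity into the sigma-algebra generated by [G] and [xi] have
    as joint law the product of their laws, so Tonelli integrates [xi] out
    first. *)
Lemma freezing (F : OmegaG * rV -> \bar R) : measurable_fun setT F ->
  (forall p, 0 <= F p)%E ->
  (\int[P]_w F (w, xi w) = \int[P]_w \int[P]_w' F (w, xi w'))%E /\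
  measurable_fun (setT : set Omega) (fun w => \int[P]_w' F (w, xi w'))%E.
Proof.
move=> mF F0.
pose pr (w : Omega) : OmegaG * rV := (w, xi w).
have mpr : measurable_fun setT pr by apply: measurable_fun_pair.
pose nu := distribution P (mfun_Sub (mem_set mpr)).
have E1 : (\int[P]_w F (w, xi w) = \int[nu]_p F p)%E.
  by rewrite ge0_integral_distribution.
have E2 : (\int[nu]_p F p = \int[PG \x PX]_p F p)%E.
  apply: eq_measure_integral => A mA _; apply/esym.
  apply: (product_measure_unique (m1 := PG) (m2 := PX)) => // B C mB mC.
  rewrite /nu /PG /PX /distribution /pushforward /=.
  exact: sigma_indep.
have E3 w : (\int[P]_w' F (w, xi w') = \int[PX]_x F (w, x))%E.
  rewrite ge0_integral_distribution//.
  exact: (measurableT_comp mF (pair1_measurable w)).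
have mI := measurable_fun_fubini_tonelli_F (m2 := PX) F mF F0.
split.
  rewrite E1 E2 fubini_tonelli1//.
  rewrite ge0_integral_distribution//; last by move=> w; exact: integral_ge0.
  by apply: eq_integral => w _; rewrite E3.
rewrite (_ : (fun w => _) = (fubini_F PX F) \o idG); first exact: measurableT_comp.
by apply/funext => w; rewrite E3.
Qed.

End independence.

Section increments.
Context {R : realType} (d : nat) d0 (Omega : measurableType d0) (P : probability Omega R).
Local Notation rV := 'rV[R]_d.
Context (X : R -> Omega -> rV).
Hypothesis mX : forall t, 0 <= t -> measurable_fun setT (X t).
Hypothesis iX : independent_increments P X.
Context (gamma : rV -> \bar R) (K : R -> \bar R).
Hypothesis mgamma : measurable_fun setT gamma.
Hypothesis gamma_ge0 : forall x, (0 <= gamma x)%E.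
Hypothesis K_ge0 : forall s, (0 <= K s)%E.
Hypothesis HK : forall s t y, 0 <= s -> s < t ->
  (\int[P]_w gamma (X t w - X s w + y) <= K (t - s))%E.

Let inc (tt : nat -> R) i w := X (tt i.+1) w - X (tt i) w.

Lemma rV_measurable_sub d1 (T : measurableType d1) (f g : T -> rV) :
  measurable_fun setT f -> measurable_fun setT g -> measurable_fun setT (fun w => f w - g w).
Proof.
move=> mf mg; apply: measurable_fun_rVP => i.
rewrite (_ : (fun x => _) = (fun w => f w ord0 i - g w ord0 i)); last first.
  by apply/funext => w; rewrite !mxE.
apply: measurable_funB.
  exact: (measurableT_comp (measurable_rV_coord i) mf).
exact: (measurableT_comp (measurable_rV_coord i) mg).
Qed.

(** The pi-system of the events that are rectangles in the first [n] increments
    along [tt]; independence of increments is directly a statement about it. *)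
Let G (tt : nat -> R) n : set (set Omega) :=
  [set [set w | forall i, (i < n)%N -> A i (inc tt i w)] |
     A in [set A : nat -> set rV | forall i, measurable (A i)]].

(** Only the factor [i = 0] contains the first increment. That increment is
    independent of the later ones, so it is integrated out first with the later
    ones frozen as the shift [y]; uniformity of [K] in the shift allows to
    iterate. *)
Lemma expectation_prod_correlation_le n (tt : nat -> R) :
  0 <= tt 0%N -> (forall i, tt i < tt i.+1) ->
  (\int[P]_w \prod_(i < n) gamma (X (tt n) w - X (tt i) w) <=
   \prod_(i < n) K (tt i.+1 - tt i))%E.
Proof.
elim: n tt => [|n IH] tt tt0 tti.
  under eq_integral do rewrite big_ord0.
  by rewrite big_ord0 integral_cst//= probability_setT mul1e.
have tt_ge0 i : 0 <= tt i.
  by elim: i => // i h; rewrite (le_trans h)// ltW.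
pose us i := tt i.+1.
have minc i : measurable_fun setT (inc us i) by apply: rV_measurable_sub; apply: mX; rewrite /us.
have mrect (A : nat -> set rV) m : (forall i, measurable (A i)) ->
    measurable [set w | forall i, (i < m)%N -> A i (inc us i w)].
  move=> mA; rewrite (_ : [set _ | _] = \bigcap_(i in `I_m) (inc us i @^-1` A i)).
    apply: fin_bigcap_measurable => // i _.
    by rewrite -[X in measurable X]setTI; exact: minc.
  by apply/seteqP; split => w /= h i hi; exact: h.
have GI : setI_closed (G us n).
  move=> _ _ [A mA <-] [B mB <-]; exists (fun i => A i `&` B i).
    by move=> i; exact: measurableI.
  apply/seteqP; split => w /=; first by move=> h; split => i /h [].
  by move=> [h1 h2] i hi; split; [exact: h1|exact: h2].
have mG : G us n `<=` measurable by move=> _ [A mA <-]; exact: mrect.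
pose xi w := inc tt 0 w.
have mxi : measurable_fun setT xi by apply: rV_measurable_sub; apply: mX; rewrite /us.
(* compare the product rule for [n.+1] increments with the one for the last [n] *)
have GT B : measurable B -> forall A, G us n A ->
    P (A `&` xi @^-1` B) = (P A * P (xi @^-1` B))%E.
  move=> mB _ [A mA <-].
  have m0 i : measurable ((fun i => if i is j.+1 then A j else B) i) by case: i.
  have E := iX n.+1 tt0 tti m0.
  rewrite big_ord_recl/= in E.
  have E' := iX n (tt_ge0 1) (fun i => tti i.+1) mA.
  rewrite [X in (X * _)%E]E' muleC; apply: etrans E.
  congr (P _); apply/seteqP; split => w /=.
    by move=> [h1 h2] [|i] //=; rewrite ltnS; exact: h1.
  by move=> h; split => [i hi|]; [exact: (h i.+1)|exact: (h 0%N)].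
pose OG := g_sigma_algebraType (G us n).
have mincG i : (i < n)%N -> measurable_fun (setT : set OG) (inc us i).
  move=> ilt _ Y mY; rewrite setTI; apply: sub_sigma_algebra.
  exists (fun j => if j == i then Y else setT); first by move=> j; case: ifP.
  apply/seteqP; split => w /=; first by move=> /(_ i ilt); rewrite eqxx.
  by move=> h j jn; case: eqVneq => [->|].
have mdiffG i : (i <= n)%N -> measurable_fun (setT : set OG) (fun w => X (us n) w - X (us i) w).
  move=> ilen; apply: measurable_fun_rVP => j.
  rewrite (_ : (fun w => _) = (fun w => \sum_(i <= k < n) inc us k w ord0 j)); last first.
    apply/funext => w; rewrite -summxE; congr (fun_of_matrix _ _ _).
    by rewrite (telescope_sumr (fun k => X (us k) w)).
  rewrite (_ : (fun w => _) = (fun w => \sum_(k < n) (if (i <= k)%N then inc us k w ord0 j else 0))).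
    apply: measurable_sum => k; have [_|_] := boolP (i <= k)%N => //.
    exact: (measurableT_comp (measurable_rV_coord j) (mincG _ (ltn_ord k))).
  apply/funext => w; rewrite -big_mkcond /= -(big_mkord (fun k => (i <= k)%N)
     (fun k => inc us k w ord0 j)).
  by rewrite (big_nat_widenl i 0%N).
pose V (w : OG) := (\prod_(i < n) gamma (X (us n) w - X (us i) w))%E.
have mV : measurable_fun (setT : set OG) V.
  apply: emeasurable_prod => i.
  by apply: (measurableT_comp mgamma); apply: mdiffG; exact: ltnW.
have V0 w : (0 <= V w)%E by apply: prode_ge0.
pose F (p : OG * rV) : \bar R := (gamma (p.2 + (X (us n) p.1 - X (us 0%N) p.1)) * V p.1)%E.
have F0 p : (0 <= F p)%E by rewrite mule_ge0.
have mF : measurable_fun setT F.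
  apply: emeasurable_funM; last exact: (measurableT_comp mV measurable_fst).
  apply: (measurableT_comp mgamma); apply: measurable_fun_rVP => i.
  rewrite (_ : (fun p => _) = (fun p : OG * rV => p.2 ord0 i + (X (us n) p.1 - X (us 0%N) p.1) ord0 i)); last first.
    by apply/funext => p; rewrite mxE.
  apply: measurable_funD.
    exact: (measurableT_comp (measurable_rV_coord i) measurable_snd).
  exact: (measurableT_comp (measurable_rV_coord i) (measurableT_comp (mdiffG 0%N isT) measurable_fst)).
have [E mI] := freezing GI mG mxi GT mF F0.
have -> : (\int[P]_w \prod_(i < n.+1) gamma (X (tt n.+1) w - X (tt i) w) =
    \int[P]_w F (w, xi w))%E.
  apply: eq_integral => w _; rewrite big_ord_recl /F /=; congr (gamma _ * _)%E.
  by rewrite /xi /inc /us [RHS]addrC subrKA.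
rewrite E big_ord_recl.
have mVP : measurable_fun (setT : set Omega) V.
  move=> _ Y mY; have := mV measurableT _ mY; exact: sigma_sub_measurable.
apply: (@le_trans _ _ (\int[P]_w (K (tt 1%N - tt 0%N) * V w))%E).
  apply: ge0_le_integral => //.
  - by move=> w _; exact: integral_ge0.
  - exact: measurable_funeM.
  - move=> w _; rewrite /F /= ge0_integralZr//.
    + apply: lee_wpmul2r => //; exact: HK.
    + apply: (measurableT_comp mgamma).
      apply: (@measurable_fun_rVP _ _ Omega) => i.
      rewrite (_ : (fun p => _) = (fun w' => xi w' ord0 i + (X (us n) w - X (us 0%N) w) ord0 i)); last first.
        by apply/funext => p; rewrite mxE.
      apply: measurable_funD => //.
      exact: (measurableT_comp (measurable_rV_coord i) mxi).
rewrite ge0_integralZl//.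
apply: lee_wpmul2l => //.
exact: (IH us (tt_ge0 1%N) (fun i => tti i.+1)).
Qed.

End increments.

(** * Exponential moments through iterated integrals *)
Lemma measurable_expeR {R : realType} : measurable_fun setT (@expeR R).
Proof.
rewrite (_ : @expeR R = fun x => if x == +oo%E then +oo%E else
    if x == -oo%E then 0%E else (expR (fine x))%:E); last first.
  by apply/funext => -[r| |].
have mb (y : \bar R) : measurable_fun setT (fun x : \bar R => x == y).
  apply: (@measurable_fun_bool _ _ _ _ true); rewrite setTI.
  rewrite (_ : _ @^-1` _ = [set y]); first exact: emeasurable_set1.
  by apply/seteqP; split => x /= /eqP.
apply: measurable_fun_ifT => //; apply: measurable_fun_ifT => //.
by apply/measurable_EFinP; apply: measurableT_comp.
Qed.

Section iterated_integrals.
Context {R : realType} d (Omega : measurableType d).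
Local Notation mu := (@lebesgue_measure R).
Local Notation RT := (measurableTypeR R).
Local Open Scope ereal_scope.
Context (h : RT -> Omega -> \bar R).
Hypothesis mh : measurable_fun [set: RT * Omega] (fun p => h p.1 p.2).
Hypothesis h_ge0 : forall s w, 0 <= h s w.

(** [iterated n T w] integrates [h s_1 w * ... * h s_n w] over the simplex
    [0 < s_1 < ... < s_n < T]. *)
Fixpoint iterated n (T : R) w : \bar R :=
  if n is m.+1 then
    \int[mu]_s (if (0 < s < T)%R then h s w * iterated m s w else 0)
  else 1.

Lemma iterated0 T w : iterated 0 T w = 1. Proof. by []. Qed.

Lemma iteratedS n T w : iterated n.+1 T w =
  \int[mu]_s (if (0 < s < T)%R then h s w * iterated n s w else 0).
Proof. by []. Qed.

Arguments iterated : simpl never.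

Lemma iterated_ge0 n T w : 0 <= iterated n T w.
Proof.
elim: n T => [|n IH] T; first by rewrite iterated0.
rewrite iteratedS; apply: integral_ge0 => s _.
by case: ifP => // _; exact: mule_ge0.
Qed.

Lemma measurable_iterated n :
  measurable_fun [set: RT * Omega] (fun p => iterated n p.1 p.2).
Proof.
elim: n => [|n IH]; first exact: measurable_cst.
pose F (q : (RT * Omega) * RT) : \bar R :=
  if (0 < q.2 < q.1.1)%R then h q.2 q.1.2 * iterated n q.2 q.1.2 else 0.
have mF : measurable_fun setT F.
  have m2 : measurable_fun [set: (RT * Omega) * RT] (fun q => (q.2, q.1.2)).
    apply: measurable_fun_pair; first exact: measurable_snd.
    exact: (measurableT_comp measurable_snd measurable_fst).
  apply: measurable_fun_ifT.
  - apply: measurable_and; apply: measurable_fun_ltr => //.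
    exact: (measurableT_comp measurable_fst measurable_fst).
  - apply: emeasurable_funM.
      exact: (measurableT_comp mh m2).
    exact: (measurableT_comp IH m2).
  - exact: measurable_cst.
have F0 q : 0 <= F q by rewrite /F; case: ifP => // _; rewrite mule_ge0// iterated_ge0.
exact: (measurable_fun_fubini_tonelli_F (m2 := mu) F mF F0).
Qed.

Let mh1 w : measurable_fun [set: RT] (fun s => h s w).
Proof. exact: (measurableT_comp mh (pair2_measurable w)). Qed.

Let mit1 n w : measurable_fun [set: RT] (fun s => iterated n s w).
Proof. exact: (measurableT_comp (measurable_iterated n) (pair2_measurable w)). Qed.

Let mifo (T : R) (f : RT -> \bar R) : measurable_fun setT f ->
  measurable_fun [set: RT] (fun s : RT => if (0 < s < T)%R then f s else 0).
Proof.
move=> mf; apply: measurable_fun_ifT => //.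
by apply: measurable_and; exact: measurable_fun_ltr.
Qed.

Let int_ifo (T : R) (f : RT -> \bar R) :
  \int[mu]_s (if (0 < s < T)%R then f s else 0) = \int[mu]_(s in `]0%R, T[) f s.
Proof.
rewrite [RHS]integral_mkcond; apply: eq_integral => s _.
by rewrite /patch mem_setE in_itv.
Qed.

(** The extra variable of [iterated 1 T w] falls either before or after the
    largest variable of the simplex; the first case is the induction
    hypothesis, the second one appends a new largest variable. *)
Lemma iterated1_mul n T w :
  iterated 1 T w * iterated n T w = n.+1%:R%:E * iterated n.+1 T w.
Proof.
have h0 s := h_ge0 s w.
have i0 m s := iterated_ge0 m s w.
elim: n T => [|n IH] T; first by rewrite iterated0 mule1 mul1e.
pose F (p : RT * RT) : \bar R :=
  if (0 < p.1 < T)%R && (p.1 <= p.2 < T)%R then h p.1 w * iterated n p.1 w * h p.2 w else 0.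
have mF : measurable_fun setT F.
  apply: measurable_fun_ifT.
  - apply: measurable_and; apply: measurable_and.
    + by apply: measurable_fun_ltr => //; exact: measurable_fst.
    + by apply: measurable_fun_ltr => //; exact: measurable_fst.
    + by apply: measurable_fun_ler; [exact: measurable_fst|exact: measurable_snd].
    + by apply: measurable_fun_ltr => //; exact: measurable_snd.
  - apply: emeasurable_funM; last exact: (measurableT_comp (mh1 w) measurable_snd).
    apply: emeasurable_funM; first exact: (measurableT_comp (mh1 w) measurable_fst).
    exact: (measurableT_comp (mit1 n w) measurable_fst).
  - exact: measurable_cst.
have F0 p : 0 <= F p by rewrite /F; case: ifP => // _; rewrite !mule_ge0.
have mhn m : measurable_fun [set: RT] (fun s => h s w * iterated m s w).
  exact: emeasurable_funM.
have mhs : measurable_fun [set: RT] (fun s => h s w * iterated 0 s w).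
  exact: emeasurable_funM.
have split1 s : (0 < s < T)%R ->
    iterated 1 T w = iterated 1 s w + \int[mu]_(u in `[s, T[) h u w.
  move=> /andP[s0 sT]; rewrite !iteratedS !int_ifo.
  under eq_integral do rewrite mule1.
  under [in RHS]eq_integral do rewrite mule1.
  have -> : `]0%R, T[%classic = `]0%R, s[%classic `|` `[s, T[%classic.
    by rewrite -itv_bndbnd_setU// bnd_simp// ltW.
  rewrite ge0_integral_setU//=.
  - exact: measurable_funTS.
  - apply/disj_setPS => u [] /=; rewrite !in_itv/= => /andP[_ h1] /andP[h2 _].
    by have := lt_le_trans h1 h2; rewrite ltxx.
have E1 : iterated 1 T w * iterated n.+1 T w =
    \int[mu]_s (if (0 < s < T)%R then h s w * iterated n s w * iterated 1 T w else 0).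
  rewrite [iterated n.+1 T w]iteratedS muleC -ge0_integralZr//.
  - by apply: eq_integral => s _; case: ifP => //; rewrite mul0e.
  - exact: mifo.
  - by move=> s _; case: ifP => // _; exact: mule_ge0.
have E2 s : (if (0 < s < T)%R then h s w * iterated n s w * iterated 1 T w else 0) =
    n.+1%:R%:E * (if (0 < s < T)%R then h s w * iterated n.+1 s w else 0) +
    \int[mu]_u F (s, u).
  rewrite /F /=; case: ifPn => /= sT; last by rewrite mule0 add0e integral0.
  rewrite (split1 _ sT) ge0_muleDr//; last exact: integral_ge0.
  congr (_ + _).
    by rewrite -muleA [iterated n s w * _]muleC IH muleCA.
  rewrite -ge0_integralZl//; last 2 first.
  - exact: measurable_funTS.
  - exact: mule_ge0.
  rewrite integral_mkcond; apply: eq_integral => u _.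
  by rewrite /patch mem_setE in_itv/=.
rewrite E1; under eq_integral do rewrite E2.
have mI := measurable_fun_fubini_tonelli_F (m2 := mu) F mF F0.
rewrite ge0_integralD//; last 3 first.
- by move=> s _; rewrite mule_ge0//; case: ifP => // _; exact: mule_ge0.
- by apply: measurable_funeM; exact: mifo.
- by move=> s _; exact: integral_ge0.
rewrite ge0_integralZl//; last 2 first.
- exact: mifo.
- by move=> s _; case: ifP => // _; exact: mule_ge0.
rewrite (fubini_tonelli (m1 := mu) (m2 := mu) F mF F0).
have -> : \int[mu]_u \int[mu]_s F (s, u) = iterated n.+2 T w.
  rewrite [RHS]iteratedS; apply: eq_integral => u _.
  have [uT|uT] := boolP (0 < u < T)%R; last first.
    rewrite integral0_eq// => s _; rewrite /F /=.
    case: ifP => // /andP[/andP[s0 _] /andP[su uT']].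
    by rewrite (lt_le_trans s0 su) uT' in uT.
  rewrite iteratedS int_ifo muleC -ge0_integralZr//; last 2 first.
  - exact: measurable_funTS.
  - by move=> s _; exact: mule_ge0.
  rewrite (@integral_itv_bndo_bndc _ (BRight 0%R) u); last first.
    apply: measurable_funTS; apply: emeasurable_funM; last exact: measurable_cst.
    exact: mhn.
  rewrite [RHS]integral_mkcond; apply: eq_integral => s _.
  rewrite /F /patch mem_setE in_itv/=; congr (if _ then _ else _).
  case/andP: uT => u0 uT; rewrite uT andbT.
  have [su|] := leP s u; last by rewrite !andbF.
  by rewrite (le_lt_trans su uT) !andbT.
rewrite [X in _ * X + _](_ : _ = iterated n.+2 T w)//.
rewrite -{2}[iterated n.+2 T w]mul1e -ge0_muleDl// -EFinD.
by rewrite [in RHS]mulrS addrC.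
Qed.

Lemma iterated_fact n T w : iterated 1 T w ^+ n = n`!%:R%:E * iterated n T w.
Proof.
elim: n => [|n IH]; first by rewrite fact0 iterated0 mule1.
rewrite expeS IH muleCA iterated1_mul muleA -EFinM -natrM.
by rewrite factS mulnC.
Qed.

(** Term by term the series is the exponential series when [iterated 1 T w] is
    finite; otherwise its term of order 1 is already infinite. *)
Lemma expeR_iterated_le (theta : R) T w : (0 < theta)%R ->
  expeR (theta%:E * iterated 1 T w) <=
  \sum_(0 <= n <oo) ((theta ^+ n)%:E * iterated n T w).
Proof.
move=> theta0.
have t0 n : 0 <= (theta ^+ n)%:E * iterated n T w.
  by rewrite mule_ge0 ?iterated_ge0// lee_fin exprn_ge0// ltW.
have := iterated_ge0 1 T w; case E : (iterated 1 T w) => [z| |]// z0.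
  have En n : (theta ^+ n)%:E * iterated n T w = (exp_coeff (theta * z) n)%:E.
    have := iterated_fact n T w; rewrite E -EFin_expe => zn.
    rewrite /exp_coeff /= exprMn -mulrA EFinM; congr (_ * _).
    rewrite EFinM zn muleAC -EFinM.
    by rewrite mulfV ?mul1e// pnatr_eq0 -lt0n fact_gt0.
  under eq_eseriesr do rewrite En.
  rewrite -EFinM /= /expR.
  have cv := is_cvg_series_exp_coeff (theta * z).
  rewrite -EFin_lim//.
  rewrite le_eqVlt; apply/orP; left; apply/eqP; congr (limn _).
  by apply/funext => n; rewrite /= sumEFin.
have -> : \sum_(0 <= n <oo) (theta ^+ n)%:E * iterated n T w = +oo.
  apply/eqP; rewrite eq_le leey/=.
  apply: le_trans (nneseries_lim_ge 2 (fun n _ _ => t0 n)).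
  have u1 : (theta ^+ 1)%:E * iterated 1 T w = +oo.
    by rewrite expr1 E mulry gtr0_sg// mul1e.
  by rewrite big_nat_recr//= u1; apply: leeDr; exact: sume_ge0.
by rewrite mulry gtr0_sg// mul1e.
Qed.

(** Khasminskii's argument in moment form: [k] controls the moments of [h]
    along increasing time sequences ending at [r]; damping makes the geometric
    series converge. *)
Section khasminskii.
Context (P : probability Omega R) (k : RT -> \bar R) (r t : R) (M delta : R).
Hypothesis mk : measurable_fun setT k.
Hypothesis k_ge0 : forall s, 0 <= k s.
Hypothesis rt : (r <= t)%R.
Hypothesis Hmoment : forall n (tt : nat -> R), (0 <= tt 0%N)%R ->
  (forall i, (tt i < tt i.+1)%R) -> tt n = r ->
  \int[P]_w \prod_(i < n) h (tt i) w <= \prod_(i < n) k (tt i.+1 - tt i)%R.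
Hypothesis Hdelta : \int[mu]_(s in `]0%R, t]) ((expR (- (M * s)))%:E * k s) <= delta%:E.
Hypothesis M_ge0 : (0 <= M)%R.

Let delta_ge0 : (0 <= delta)%R.
Proof.
rewrite -lee_fin (le_trans _ Hdelta)//; apply: integral_ge0 => s _.
by rewrite mule_ge0// lee_fin expR_ge0.
Qed.

(** Shifting the weight [exp (M s)] to time [T] leaves the damping factor
    [exp (- M (T - s))]. *)
Let damped (T : R) : (0 <= T)%R -> (T <= r)%R ->
  \int[mu]_s (if (0 < s < T)%R then k (T - s)%R * (expR (M * s))%:E else 0) <=
  (expR (M * T) * delta)%:E.
Proof.
move=> T0 Tr; rewrite int_ifo.
pose f (s : RT) : \bar R := (expR (- (M * s)))%:E * k s.
have f0 s : 0 <= f s by rewrite mule_ge0// lee_fin expR_ge0.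
have mf : measurable_fun setT f.
  apply: emeasurable_funM => //; apply/measurable_EFinP.
  by apply: measurableT_comp => //; apply: measurable_funN; exact: measurable_funM.
have E : \int[mu]_(s in `]0%R, T[) (k (T - s)%R * (expR (M * s))%:E) =
    (expR (M * T))%:E * \int[mu]_(s in `]0%R, T[) f s.
  rewrite -ge0_integralZl//; last exact: measurable_funTS.
  rewrite -(@ge0_integral_reflect _ T `]0%R, T[%classic (fun s => (expR (M * T))%:E * f s))//.
  - rewrite (_ : _ @^-1` _ = `]0%R, T[%classic); last first.
      by apply/seteqP; split=> s; rewrite /= !in_itv/= => /andP[h1 h2]; apply/andP; split; lra.
    apply: eq_integral => s _; rewrite /f muleA -EFinM -expRD muleC.
    by congr ((expR _)%:E * _); ring.
  - by apply: measurable_funTS; exact: measurable_funeM.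
  - by move=> s _; rewrite mule_ge0// lee_fin expR_ge0.
rewrite E EFinM; apply: lee_wpmul2l; first by rewrite lee_fin expR_ge0.
apply: (le_trans _ Hdelta); apply: ge0_subset_integral => //.
- exact: measurable_funTS.
- apply: subset_itv; rewrite bnd_simp//; exact: le_trans rt.
Qed.

Let VE m (tt : nat -> R) w := \prod_(i < m) h (tt i) w.
Let KE m (tt : nat -> R) := \prod_(i < m) k (tt i.+1 - tt i)%R.

Let mVE m tt : measurable_fun setT (VE m tt).
Proof.
apply: emeasurable_prod => i.
exact: (measurableT_comp mh (pair1_measurable (tt i : RT))).
Qed.

(** The integration variables are fixed one by one, the largest first: the
    times [tt] are those already fixed, and the weight [exp (M * tt 0)] carries
    the damping from one step to the next. *)
Lemma iterated_moment_le n : forall m (tt : nat -> R), (0 <= tt 0%N)%R ->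
  (forall i, (tt i < tt i.+1)%R) -> tt m = r ->
  \int[P]_w ((\prod_(i < m) h (tt i) w) * iterated n (tt 0%N) w) <=
  (\prod_(i < m) k (tt i.+1 - tt i)%R) * (expR (M * tt 0%N) * delta ^+ n)%:E.
Proof.
elim: n => [|n IH] m tt tt0 tti ttm.
  under eq_integral do rewrite iterated0 mule1.
  apply: (le_trans (Hmoment tt0 tti ttm)).
  rewrite -[leLHS]mule1 expr0 mulr1; apply: lee_wpmul2l; first exact: prode_ge0.
  by rewrite lee_fin -expR0 ler_expR mulr_ge0.
rewrite -/(KE m tt).
have V0 w : 0 <= VE m tt w by exact: prode_ge0.
have K0 : 0 <= KE m tt by exact: prode_ge0.
have tr : (tt 0%N <= r)%R.
  rewrite -ttm; have : forall j, (tt 0%N <= tt j)%R; last exact.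
  by elim=> // j hj; rewrite (le_trans hj)// ltW.
pose F (p : Omega * RT) : \bar R :=
  if (0 < p.2 < tt 0%N)%R then VE m tt p.1 * (h p.2 p.1 * iterated n p.2 p.1) else 0.
have msw : measurable_fun [set: Omega * RT] (fun p => (p.2, p.1)).
  by apply: measurable_fun_pair; [exact: measurable_snd|exact: measurable_fst].
have mF : measurable_fun setT F.
  apply: measurable_fun_ifT.
  - by apply: measurable_and; apply: measurable_fun_ltr => //; exact: measurable_snd.
  - apply: emeasurable_funM; first exact: (measurableT_comp (mVE m tt) measurable_fst).
    apply: emeasurable_funM; first exact: (measurableT_comp mh msw).
    exact: (measurableT_comp (measurable_iterated n) msw).
  - exact: measurable_cst.
have F0 p : 0 <= F p.
  by rewrite /F; case: ifP => // _; rewrite !mule_ge0// iterated_ge0.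
have -> : \int[P]_w (\prod_(i < m) h (tt i) w * iterated n.+1 (tt 0%N) w) =
    \int[P]_w \int[mu]_s F (w, s).
  apply: eq_integral => w _; rewrite iteratedS -ge0_integralZl//.
  - by apply: eq_integral => s _; rewrite /F /=; case: ifP => //; rewrite mule0.
  - by apply: mifo; apply: emeasurable_funM.
  - by move=> s _; case: ifP => // _; rewrite mule_ge0// iterated_ge0.
  - exact: V0.
rewrite (fubini_tonelli (m1 := P) (m2 := mu) F mF F0).
apply: (@le_trans _ _ (\int[mu]_s (KE m tt * (delta ^+ n)%:E *
   (if (0 < s < tt 0%N)%R then k (tt 0%N - s)%R * (expR (M * s))%:E else 0)))).
  have mk' : measurable_fun setT (fun s : RT => k (tt 0%N - s)%R * (expR (M * s))%:E).
    apply: emeasurable_funM.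
      by apply: (measurableT_comp mk); exact: measurable_funB.
    by apply/measurable_EFinP; apply: measurableT_comp => //; exact: measurable_funM.
  apply: ge0_le_integral => //.
  - by move=> s _; exact: integral_ge0.
  - exact: (measurable_fun_fubini_tonelli_G (m1 := P) F mF F0).
  - by apply: measurable_funeM; exact: mifo.
  move=> s _; rewrite /F /=; case: ifPn => st; last by rewrite mule0 integral0.
  case/andP: st => s0 st.
  pose tt' i := if i is j.+1 then tt j else s.
  have tti' i : (tt' i < tt' i.+1)%R by case: i.
  have := IH m.+1 tt' (ltW s0) tti' ttm.
  have Eh w : \prod_(i < m.+1) h (tt' i) w = h s w * VE m tt w by rewrite big_ord_recl.
  have Ek : \prod_(i < m.+1) k (tt' i.+1 - tt' i)%R = k (tt 0%N - s)%R * KE m tt.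
    by rewrite big_ord_recl.
  rewrite Ek; under eq_integral do rewrite Eh.
  move=> H; apply: le_trans (le_trans _ H) _.
    rewrite le_eqVlt; apply/orP; left; apply/eqP; apply: eq_integral => w _.
    by rewrite muleA [VE m tt w * _]muleC.
  rewrite EFinM le_eqVlt; apply/orP; left; apply/eqP.
  by rewrite [k _ * KE m tt]muleC [_%:E * (delta ^+ n)%:E]muleC muleACA.
rewrite ge0_integralZl//; last 3 first.
- apply: mifo; apply: emeasurable_funM.
    by apply: (measurableT_comp mk); exact: measurable_funB.
  by apply/measurable_EFinP; apply: measurableT_comp => //; exact: measurable_funM.
- by move=> s _; case: ifP => // _; rewrite mule_ge0// lee_fin expR_ge0.
- by rewrite mule_ge0// lee_fin exprn_ge0.
apply: (@le_trans _ _ (KE m tt * (delta ^+ n)%:E * (expR (M * tt 0%N) * delta)%:E)).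
  apply: lee_wpmul2l; first by rewrite mule_ge0// lee_fin exprn_ge0.
  exact: damped.
by rewrite -muleA -EFinM; rewrite mulrCA -exprSr.
Qed.

Lemma khasminskii (theta : R) : (0 < theta)%R -> (theta * delta <= 2^-1)%R -> (0 <= r)%R ->
  \int[P]_w expeR (theta%:E * iterated 1 r w) <= (2 * expR (M * r))%:E.
Proof.
move=> theta0 td r0.
have mit n : measurable_fun setT (iterated n r).
  exact: (measurableT_comp (measurable_iterated n) (pair1_measurable (r : RT))).
have t0 n w : 0 <= (theta ^+ n)%:E * iterated n r w.
  by rewrite mule_ge0 ?iterated_ge0// lee_fin exprn_ge0// ltW.
apply: (@le_trans _ _ (\int[P]_w \sum_(0 <= n <oo) ((theta ^+ n)%:E * iterated n r w))).
  apply: ge0_le_integral => //.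
  - by move=> w _; exact: expeR_ge0.
  - exact: (measurableT_comp measurable_expeR (measurable_funeM _ (mit 1%N))).
  - by apply: ge0_emeasurable_sum => // n _; exact: measurable_funeM.
  - by move=> w _; exact: expeR_iterated_le.
rewrite integral_nneseries//; last by move=> n; exact: measurable_funeM.
have bnd n : \int[P]_w ((theta ^+ n)%:E * iterated n r w) <= (expR (M * r) * 2^-1 ^+ n)%:E.
  rewrite ge0_integralZl//; last 2 first.
  - by move=> w _; exact: iterated_ge0.
  - by rewrite lee_fin exprn_ge0// ltW.
  have tti i : (r + i%:R < r + i.+1%:R)%R by rewrite ltrD2l ltr_nat.
  have := @iterated_moment_le n 0 (fun i => r + i%:R)%R.
  rewrite addr0 => /(_ r0 tti erefl); rewrite big_ord0 mul1e.
  under [X in X <= _]eq_integral do rewrite big_ord0 mul1e.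
  move=> H; apply: (le_trans (lee_wpmul2l _ H)).
    by rewrite lee_fin exprn_ge0// ltW.
  rewrite -EFinM lee_fin mulrCA ler_wpM2l ?expR_ge0// -exprMn.
  by rewrite lerXn2r ?nnegrE// ?mulr_ge0// ltW.
apply: lime_le.
  by apply: is_cvg_nneseries => n _ _; exact: integral_ge0.
apply: nearW => N.
apply: (@le_trans _ _ (\sum_(0 <= n < N) (expR (M * r) * 2^-1 ^+ n)%:E)).
  exact: lee_sum.
rewrite sumEFin lee_fin -mulr_sumr mulrC ler_wpM2r ?expR_ge0//.
have -> : (\sum_(0 <= n < N) 2^-1 ^+ n = 2 - 2 * 2^-1 ^+ N :> R)%R.
  elim: N => [|N IHN]; first by rewrite big_geq// expr0; ring.
  by rewrite big_nat_recr//= IHN exprS; field.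
by rewrite gerDl oppr_le0 mulr_ge0// exprn_ge0.
Qed.

End khasminskii.

End iterated_integrals.

(** * Jensen's inequality, and bounds off a null set *)
Section jensen.
Context {R : realType}.
Local Notation mu := (@lebesgue_measure R).
Local Open Scope ereal_scope.

(** Jensen's inequality for the uniform law on [(0, t]]. It follows from the
    tangent line of the exponential at the mean [m]; an infinite mean makes both
    sides infinite. *)
Lemma expeR_integral_le (f : measurableTypeR R -> \bar R) (t : R) : (0 < t)%R ->
  measurable_fun setT f -> (forall s, 0 <= f s) ->
  expeR (\int[mu]_(s in `]0%R, t]) f s) <=
  t^-1%:E * \int[mu]_(s in `]0%R, t]) expeR (t%:E * f s).
Proof.
move=> t0 mf f0.
have mE : measurable_fun setT (fun s => expeR (t%:E * f s)).
  exact: (measurableT_comp measurable_expeR (measurable_funeM _ mf)).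
have E0 s : 0 <= expeR (t%:E * f s) by exact: expeR_ge0.
have tf0 s : 0 <= t%:E * f s by rewrite mule_ge0// lee_fin ltW.
have tV : (0 < t^-1)%R by rewrite invr_gt0.
have lebt : mu `]0%R, t]%classic = t%:E.
  by rewrite lebesgue_measure_itv/= lte_fin t0 oppr0 adde0.
have If0 : 0 <= \int[mu]_(s in `]0%R, t]) f s by exact: integral_ge0.
case E : (\int[mu]_(s in `]0%R, t]) f s) If0 => [m| |]// m0; last first.
  have -> : \int[mu]_(s in `]0%R, t]) expeR (t%:E * f s) = +oo.
    apply/eqP; rewrite eq_le leey/= .
    apply: (@le_trans _ _ (\int[mu]_(s in `]0%R, t]) (t%:E * f s))).
      rewrite ge0_integralZl//.
      - by rewrite [X in _ * X]E mulry gtr0_sg// mul1e.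
      - exact: measurable_funTS.
      - by rewrite lee_fin ltW.
    apply: ge0_le_integral => //.
    - by apply: measurable_funTS; exact: measurable_funeM.
    - exact: measurable_funTS.
    - move=> s _; apply: le_trans (expeR_ge1Dx _).
      by rewrite leeDr.
  by rewrite mulry gtr0_sg// mul1e leey.
rewrite lee_fin in m0.
pose c : R := expR m.
have c0 : (0 <= c)%R by exact: expR_ge0.
have key : (c * t + c * t * m)%R%:E <=
    \int[mu]_(s in `]0%R, t]) expeR (t%:E * f s) + (t * (c * m))%R%:E.
  apply: (@le_trans _ _ (\int[mu]_(s in `]0%R, t]) (c%:E + c%:E * (t%:E * f s)))).
    rewrite ge0_integralD//; last 2 first.
    - by move=> s _; rewrite mule_ge0.
    - by apply: measurable_funTS; apply: measurable_funeM; exact: measurable_funeM.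
    rewrite integral_cst//= [X in _ * X]lebt ge0_integralZl//; last first.
      by apply: measurable_funTS; exact: measurable_funeM.
    rewrite ge0_integralZl//; last 2 first.
    - exact: measurable_funTS.
    - by rewrite lee_fin ltW.
    by rewrite [X in _ * (_ * X)]E -!EFinM -EFinD mulrA.
  have -> : (t * (c * m))%R%:E = \int[mu]_(s in `]0%R, t]) (c * m)%R%:E.
    by rewrite integral_cst//= [X in _ * X]lebt -EFinM mulrC.
  rewrite -ge0_integralD//; last 2 first.
  - exact: measurable_funTS.
  - by move=> s _; rewrite lee_fin mulr_ge0.
  apply: ge0_le_integral => //.
  - by move=> s _; rewrite adde_ge0// ?lee_fin// mule_ge0.
  - apply: measurable_funTS; apply: emeasurable_funD => //.
    by apply: measurable_funeM; exact: measurable_funeM.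
  - by apply: measurable_funTS; exact: emeasurable_funD.
  - move=> s _; have := f0 s; case: (f s) => [y| |]// y0.
    + rewrite -EFinM -EFinM -EFinD /= -EFinD lee_fin.
      have := expR_ge1Dx (t * y - m)%R => h.
      have -> : expR (t * y) = (c * expR (t * y - m))%R.
        by rewrite /c -expRD addrC subrK.
      have := ler_wpM2l c0 h; lra.
    + by rewrite mulry gtr0_sg// mul1e /= addye// leey.
case: (\int[mu]_(s in _) expeR _) key => [I| |]//.
- rewrite -EFinD lee_fin -EFinM lee_fin => key.
  rewrite -/c mulrC ler_pdivlMr//; lra.
- by move=> _; rewrite mulry gtr0_sg// mul1e leey.
Qed.

End jensen.

Section almost_sure_bound.
Context {R : realType} d (T : measurableType d) (m : {measure set T -> \bar R}).
Local Open Scope ereal_scope.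

Import HBNNSimple.

(** The integral of [f], which may fail to be measurable, is the supremum of the
    integrals of the simple functions below [f], and each of these is at most
    [g] off the null set [N]. *)
Lemma integral_le_of_ae (N : set T) (f g : T -> \bar R) :
  measurable N -> m N = 0 -> measurable_fun setT g -> (forall x, 0 <= g x) ->
  (forall x, 0 <= f x) -> (forall x, ~ N x -> f x <= g x) ->
  \int[m]_x f x <= \int[m]_x g x.
Proof.
move=> mN N0 mg g0 f0 fg; rewrite ge0_integralTE//.
apply: ge_ereal_sup => _ [h hf <-]; rewrite -integralT_nnsfun.
apply: ae_ge0_le_integral => //.
- by move=> x _; rewrite lee_fin; exact: fun_ge0.
- by apply/measurable_EFinP; exact: measurable_funP.
- exists N; split => // x; apply: contra_notP => xN _.
  exact: le_trans (hf x) (fg x xN).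
Qed.

End almost_sure_bound.

(** * Joint measurability of right-continuous paths *)
Section cadlag_measurable.
Context {R : realType} (d : nat) d0 (Omega : measurableType d0).
Local Notation rV := 'rV[R]_d.
Local Notation RT := (measurableTypeR R).
Context (X : R -> Omega -> rV) (N : set Omega).
Hypothesis mN : measurable N.
Hypothesis mX : forall t, 0 <= t -> measurable_fun setT (X t).
Hypothesis cX : forall w, ~ N w -> cadlag (fun t => X t w).

(** The process killed on the exceptional set [N], where nothing is known about
    the paths, and at negative times. *)
Definition path_version (p : RT * Omega) : rV :=
  if (0 <= p.1) && (p.2 \notin N) then X p.1 p.2 else 0.

(** The grid point lies strictly after [s], so only right limits are used. *)
Let grid (n : nat) (s : R) : R := (Num.truncn (n.+1%:R * s)).+1%:R / n.+1%:R.

Let grid_gt n s : s < grid n s.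
Proof.
rewrite /grid ltr_pdivlMr ?ltr0n// mulrC.
exact: truncnS_gt.
Qed.

Let grid_le n s : 0 <= s -> grid n s <= s + n.+1%:R^-1.
Proof.
move=> s0; rewrite /grid ler_pdivrMr ?ltr0n// mulrDl mulVf ?pnatr_eq0// mulrC.
by rewrite -[X in X <= _]natr1 lerD2r truncn_le mulr_ge0.
Qed.

(** Right-continuity makes the process the pointwise limit of its values at the
    grid points following each time, and these approximations take countably
    many times. *)
Lemma measurable_path_version : measurable_fun setT path_version.
Proof.
apply: measurable_fun_rVP => i.
pose Y n (p : RT * Omega) : R :=
  if (0 <= p.1) && (p.2 \notin N) then X (grid n p.1) p.2 ord0 i else 0.
have mcond : measurable_fun [set: RT * Omega] (fun p : RT * Omega => (0 <= p.1) && (p.2 \notin N)).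
  apply: measurable_and.
    by apply: measurable_fun_ler => //; exact: measurable_fst.
  apply: (measurableT_comp (f := fun w => w \notin N)); last exact: measurable_snd.
  apply: (@measurable_fun_bool _ _ _ _ true); rewrite setTI.
  rewrite (_ : _ @^-1` _ = ~` N); first exact: measurableC.
  by apply/seteqP; split => w /=; [move/negP => h h'; apply: h; exact: mem_set|
     move=> h; apply/negP => /set_mem].
have mY n : measurable_fun setT (Y n).
  apply: measurable_fun_ifT => //.
  move=> _ B mB; rewrite setTI.
  rewrite (_ : _ @^-1` _ = \bigcup_k
     ([set s : RT | Num.truncn (n.+1%:R * s) = k] `*`
      ((fun w => X (k.+1%:R / n.+1%:R) w ord0 i) @^-1` B))); last first.
    apply/seteqP; split => -[s w] /=; first by move=> h; exists (Num.truncn (n.+1%:R * s)).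
    by move=> [k _ [/= <-]].
  apply: bigcup_measurable => k _; apply: measurableX.
    apply: is_interval_measurable => x y /= xk yk z /andP[xz zy].
    by apply/eqP; rewrite eqn_leq -{1}yk -xk !le_truncn// ler_wpM2l.
  have : measurable_fun setT (fun w => X (k.+1%:R / n.+1%:R) w ord0 i).
    apply: (measurableT_comp (measurable_rV_coord i)); apply: mX.
    by rewrite divr_ge0.
  by move=> /(_ measurableT _ mB); rewrite setTI.
apply: (measurable_fun_cvg mY) => -[s w] _ /=.
rewrite /Y /path_version /=; case: ifPn => [/andP[s0 /negP wN]|_]; last first.
  by rewrite mxE; exact: cvg_cst.
have cw : cadlag (fun t => X t w) by apply: cX => /mem_set.
have [/(_ s s0) cs _] := cw.
have cs' : X t w ord0 i @[t --> s^'+] --> X s w ord0 i.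
  exact: (cvg_comp _ _ cs (@coord_continuous R 1 d ord0 i (X s w))).
apply: (cvg_comp _ _ _ cs') => A /= hA.
have gs : grid n s @[n --> \oo] --> s.
  apply: (@squeeze_cvgr _ _ _ _ (fun=> s) (fun n => s + n.+1%:R^-1)).
  - by near=> n; rewrite (ltW (grid_gt _ _)) grid_le.
  - exact: cvg_cst.
  - by rewrite -[X in _ --> X]addr0; apply: cvgD; [exact: cvg_cst|exact: cvg_harmonic].
have := gs (fun u => s < u -> A u) hA.
by apply: (@filterS _ \oo _ (fun n => s < grid n s -> A (grid n s))) => n /(_ (grid_gt n s)).
Unshelve. all: by end_near. Qed.

End cadlag_measurable.

(** * Exponent and decay of the increments *)
Section levy_charfun.
Context {R : realType} (d : nat) d0 (Omega : measurableType d0) (P : probability Omega R).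
Local Notation rV := 'rV[R]_d.
Context (X : R -> Omega -> rV) (Psi : rV -> R).
Hypothesis hX : levy_process P X.
Hypothesis hPsi : characteristic_exponent P X Psi.

Let mX t : 0 <= t -> measurable_fun setT (X t).
Proof. exact: levy_measurable hX t. Qed.

Let hPsi1 xi : cintegral P (fun w => expi (dotrV xi (X 1 w))) = (expR (- Psi xi))%:C%C.
Proof. by rewrite hPsi// mul1r. Qed.

Lemma characteristic_exponent_ge0 xi : 0 <= Psi xi.
Proof.
rewrite -oppr_le0 -[X in _ <= X]ln1 -[X in X <= _]expRK ler_ln ?posrE ?expR_gt0//.
rewrite -lee_fin -(expectation_cos_charfun (mX ler01) hPsi1).
have <- : (\int[P]_w 1%:E = 1)%E by rewrite integral_cst//= mul1e probability_setT.
apply: le_integral => //.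
- exact: (integrable_cos_dotrV _ (mX ler01)).
- exact: finite_measure_integrable_cst.
- by move=> w _; rewrite lee_fin (le_trans (ler_norm _))// cos_bound.
Qed.

Lemma measurable_characteristic_exponent : measurable_fun setT Psi.
Proof.
rewrite (_ : Psi = (fun xi => - ln (expR (- Psi xi)))); last first.
  by apply/funext => xi; rewrite expRK opprK.
apply: measurable_funN.
exact: (measurableT_comp (@measurable_ln R) (measurable_real_charfun (mX ler01) hPsi1)).
Qed.

Let expectation_eq_law (V W : Omega -> rV) (g : rV -> R) :
  measurable_fun setT V -> measurable_fun setT W -> measurable_fun setT g ->
  P.-integrable setT (fun w => (g (V w))%:E) ->
  P.-integrable setT (fun w => (g (W w))%:E) ->
  (forall A, measurable A -> P [set w | A (V w)] = P [set w | A (W w)]) ->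
  (\int[P]_w (g (V w))%:E = \int[P]_w (g (W w))%:E)%E.
Proof.
move=> mV mW mg iV iW law.
have mE : measurable_fun setT (fun x => (g x)%:E) by exact/measurable_EFinP.
have := @integral_pushforward _ _ _ _ _ _ mV P setT (fun x => (g x)%:E) mE.
rewrite preimage_setT => /(_ iV measurableT) <-.
have := @integral_pushforward _ _ _ _ _ _ mW P setT (fun x => (g x)%:E) mE.
rewrite preimage_setT => /(_ iW measurableT) <-.
by apply: eq_measure_integral => A mA _; exact: law.
Qed.

(** By stationarity [X t - X s] has the law of [X (t - s) - X 0], and [X 0 = 0]
    almost surely. *)
Lemma charfun_increment s t xi : 0 <= s -> s < t ->
  cintegral P (fun w => expi (dotrV xi (X t w - X s w))) =
  (expR (- ((t - s) * Psi xi)))%:C%C.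
Proof.
move=> s0 st; have u0 : 0 <= t - s by rewrite subr_ge0 ltW.
have t0 : 0 <= t by rewrite (le_trans s0)// ltW.
rewrite -hPsi//.
have mI : measurable_fun setT (fun w => X t w - X s w) by apply: rV_measurable_sub; exact: mX.
have mJ : measurable_fun setT (fun w => X (t - s) w - X 0 w).
  by apply: rV_measurable_sub; exact: mX.
have law A : measurable A ->
    P [set w | A (X t w - X s w)] = P [set w | A (X (t - s) w - X 0 w)].
  by move=> mA; rewrite -(levy_stationary hX s0 u0 mA) [s + _]addrC subrK.
have mdot : measurable_fun setT (fun x : rV => dotrV xi x) by exact: measurable_dotrV.
have mcos : measurable_fun setT (fun x : rV => cos (dotrV xi x)).
  by apply: measurableT_comp mdot; apply: continuous_measurable_fun; exact: continuous_cos.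
have msin : measurable_fun setT (fun x : rV => sin (dotrV xi x)).
  by apply: measurableT_comp mdot; apply: continuous_measurable_fun; exact: continuous_sin.
have start (g : rV -> R) : measurable_fun setT g ->
    (\int[P]_w (g (X (t - s) w - X 0 w))%:E = \int[P]_w (g (X (t - s) w))%:E)%E.
  move=> mg; apply: ae_eq_integral => //.
  - by apply/measurable_EFinP; exact: (measurableT_comp mg mJ).
  - by apply/measurable_EFinP; exact: (measurableT_comp mg (mX u0)).
  - by move: (levy_start hX); apply: filterS => w -> _; rewrite subr0.
rewrite /cintegral /expi /= /Rintegral; congr (complex.Complex (fine _) (fine _)).
- rewrite -(start _ mcos); apply: (expectation_eq_law mI mJ mcos) => //.
  + exact: (integrable_cos_dotrV _ mI).
  + exact: (integrable_cos_dotrV _ mJ).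
- rewrite -(start _ msin); apply: (expectation_eq_law mI mJ msin) => //.
  + exact: (integrable_sin_dotrV _ mI).
  + exact: (integrable_sin_dotrV _ mJ).
Qed.

Section kernel.
Context (hd : (1 <= d)%N) (b : R) (hb : 0 < b < 1).
Context (gamma : rV -> \bar R) (ghat : rV -> R).
Hypothesis hgamma : correlation_function gamma ghat.
Hypothesis hDalang : (\int[leb_rV d]_xi
     ((1 + Psi xi `^ (1 - b))^-1 * ghat xi)%R%:E < +oo)%E.
Local Notation RT := (measurableTypeR R).

Let gp xi := Num.max (ghat xi) 0.

Let gp_ge0 xi : 0 <= gp xi.
Proof. by rewrite le_max lexx orbT. Qed.

Let mghat : measurable_fun setT ghat.
Proof. by have [_ [mg _ _] _] := correlation_fourier hgamma. Qed.

Let mgp : measurable_fun setT gp.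
Proof. by apply: measurable_maxr. Qed.

(** Up to the constant, the Fourier side of the expectation of [gamma (X s)]; it
    also bounds the expectation of every translate [gamma (X s + y)]. *)
Definition correlation_decay (s : RT) : \bar R :=
  ((mollify_cst d)%:E *
   \int[leb_rV d]_xi (gp xi * expR (- (s * Psi xi)))%:E)%E.

Definition time_kernel (s : RT) : \bar R :=
  ((s `^ (- b))%:E * correlation_decay s)%E.

Let spectral_ge0 (s : R) : (0 <= \int[leb_rV d]_xi (gp xi * expR (- (s * Psi xi)))%:E)%E.
Proof. by apply: integral_ge0 => xi _; rewrite lee_fin mulr_ge0// expR_ge0. Qed.

Lemma correlation_decay_ge0 s : (0 <= correlation_decay s)%E.
Proof. by rewrite mule_ge0// lee_fin mollify_cst_ge0. Qed.

Lemma time_kernel_ge0 s : (0 <= time_kernel s)%E.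
Proof. by rewrite mule_ge0 ?correlation_decay_ge0// lee_fin powR_ge0. Qed.

Let mspectral : measurable_fun [set: RT]
  (fun s : RT => \int[leb_rV d]_xi (gp xi * expR (- (s * Psi xi)))%:E)%E.
Proof.
pose F (p : RT * rV) : \bar R := (gp p.2 * expR (- (p.1 * Psi p.2)))%:E.
have mF : measurable_fun setT F.
  apply/measurable_EFinP; apply: measurable_funM.
    exact: (measurableT_comp mgp measurable_snd).
  apply: (measurableT_comp (f := @expR R)) => //.
  apply: measurable_funN; apply: measurable_funM; first exact: measurable_fst.
  exact: (measurableT_comp measurable_characteristic_exponent measurable_snd).
have F0 p : (0 <= F p)%E by rewrite lee_fin mulr_ge0// expR_ge0.
exact: (measurable_fun_fubini_tonelli_F (m2 := leb_rV d) F mF F0).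
Qed.

Lemma measurable_time_kernel : measurable_fun setT time_kernel.
Proof.
apply: emeasurable_funM; last exact: measurable_funeM.
by apply/measurable_EFinP; exact: measurable_powRN.
Qed.

(** The spectral density is nonnegative almost everywhere, so replacing it by
    its positive part does not change the integral assumed to be finite. *)
Lemma integral_time_kernel_lty (t : R) : 0 < t ->
  (\int[lebesgue_measure]_(s in `]0%R, t]) time_kernel s < +oo)%E.
Proof.
move=> t0.
have mPsi := measurable_characteristic_exponent.
have mD : measurable_fun setT (fun xi => (1 + Psi xi `^ (1 - b))^-1).
  rewrite (_ : (fun x => _) = (fun x => ((1 + Psi x `^ (1 - b)) `^ (-1))%R)).
    have m1 : measurable_fun setT (fun x => (1 + Psi x `^ (1 - b))%R).
      apply: measurable_funD => //.
      exact: (measurableT_comp (measurable_powR (1 - b)%R) mPsi).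
    exact: (measurableT_comp (measurable_powR (-1)%R) m1).
  by apply/funext => xi; rewrite powR_inv1// addr_ge0// powR_ge0.
have fin : (\int[leb_rV d]_xi ((1 + Psi xi `^ (1 - b))^-1 * gp xi)%R%:E < +oo)%E.
  rewrite (_ : (\int[leb_rV d]_xi _)%E =
    (\int[leb_rV d]_xi ((1 + Psi xi `^ (1 - b))^-1 * ghat xi)%R%:E)%E)//.
  apply: ae_eq_integral => //.
  - by apply/measurable_EFinP; apply: measurable_funM.
  - by apply/measurable_EFinP; apply: measurable_funM.
  - move: (correlation_fourier_ge0 hgamma); apply: filterS => xi h _.
    by rewrite /gp max_l.
have := integral_kernel_lty hb mgp mPsi gp_ge0 characteristic_exponent_ge0 t0 fin.
move=> lt; rewrite (_ : (\int[_]_(_ in _) _)%E = ((mollify_cst d)%:E *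
   \int[lebesgue_measure]_(s in `]0%R, t]) ((s `^ (- b))%:E *
      \int[leb_rV d]_xi (gp xi * expR (- (s * Psi xi)))%:E))%E).
  by rewrite lte_mul_pinfty// ?lee_fin ?mollify_cst_ge0.
rewrite -ge0_integralZl//.
- by apply: eq_integral => s _; rewrite /time_kernel /correlation_decay muleCA.
- apply: measurable_funTS; apply: emeasurable_funM => //.
  by apply/measurable_EFinP; exact: measurable_powRN.
- by move=> s _; rewrite mule_ge0// lee_fin powR_ge0.
- by rewrite lee_fin mollify_cst_ge0.
Qed.

Lemma expectation_increment_le (s t : R) (y : rV) : 0 <= s -> s < t ->
  (\int[P]_w gamma (X t w - X s w + y)%R <= correlation_decay (t - s)%R)%E.
Proof.
move=> s0 st; apply: (expectation_correlation_le hd hgamma).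
- apply: rV_measurable_sub; apply: mX => //.
  by rewrite (le_trans s0)// ltW.
- by move=> xi; exact: charfun_increment.
- by move=> xi; exact: expR_ge0.
Qed.

End kernel.
End levy_charfun.

(** * Double integrals of symmetric kernels *)
Section symmetric_square.
Context {R : realType}.
Local Notation mu := (@lebesgue_measure R).
Local Notation RT := (measurableTypeR R).
Local Open Scope ereal_scope.

Lemma integral_itv_if (t : R) (f : RT -> \bar R) :
  \int[mu]_(s in `]0%R, t]) f s = \int[mu]_s (if (0 < s <= t)%R then f s else 0).
Proof.
rewrite integral_mkcond; apply: eq_integral => s _.
by rewrite /patch mem_setE in_itv.
Qed.

(** The square is the union of two triangles exchanged by the symmetry, and the
    diagonal, where the kernel vanishes. *)
Lemma ge0_integral_square_sym (f : RT * RT -> \bar R) (t : R) :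
  measurable_fun setT f -> (forall p, 0 <= f p) ->
  (forall r s, f (r, s) = f (s, r)) -> (forall r, f (r, r) = 0) ->
  \int[mu]_(r in `[0%R, t]) \int[mu]_(s in `[0%R, t]) f (r, s) =
  2%:E * \int[mu]_(r in `]0%R, t]) \int[mu]_s (if (0 < s < r)%R then f (r, s) else 0).
Proof.
move=> mf f0 fsym fdiag.
pose g (p : RT * RT) : \bar R :=
  if (0 < p.2 < p.1)%R && (p.1 <= t)%R then f p else 0.
have mg : measurable_fun setT g.
  apply: measurable_fun_ifT => //.
  by apply: measurable_and; [apply: measurable_and; apply: measurable_fun_ltr|apply: measurable_fun_ler].
have g0 p : 0 <= g p by rewrite /g; case: ifP.
have msw : measurable_fun [set: RT * RT] (fun p : RT * RT => (p.2, p.1)).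
  by apply: measurable_fun_pair; [exact: measurable_snd|exact: measurable_fst].
have mg' : measurable_fun setT (fun p : RT * RT => g (p.2, p.1)).
  exact: (measurableT_comp mg msw).
have mf1 (r : RT) : measurable_fun setT (fun s => f (r, s)).
  exact: (measurableT_comp mf (pair1_measurable r)).
have mg1 (r : RT) : measurable_fun setT (fun s => g (r, s)).
  exact: (measurableT_comp mg (pair1_measurable r)).
have mg2 (r : RT) : measurable_fun setT (fun s => g (s, r)).
  exact: (measurableT_comp mg (pair2_measurable r)).
have mIf : measurable_fun [set: RT] (fun r : RT => \int[mu]_(s in `]0%R, t]) f (r, s)).
  pose f' (p : RT * RT) : \bar R := if (0 < p.2 <= t)%R then f p else 0.
  have mf' : measurable_fun setT f'.
    apply: measurable_fun_ifT => //.
    by apply: measurable_and; [apply: measurable_fun_ltr|apply: measurable_fun_ler].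
  have f'0 p : 0 <= f' p by rewrite /f'; case: ifP.
  rewrite (_ : (fun r => _) = (fun r => \int[mu]_s f' (r, s))).
    exact: (measurable_fun_fubini_tonelli_F (m2 := mu) f' mf' f'0).
  by apply/funext => r; rewrite integral_itv_if.
have mIg : measurable_fun [set: RT] (fun r => \int[mu]_s g (r, s)).
  exact: (measurable_fun_fubini_tonelli_F (m2 := mu) g mg g0).
have mIg' : measurable_fun [set: RT] (fun r => \int[mu]_s g (s, r)).
  exact: (measurable_fun_fubini_tonelli_F (m2 := mu) _ mg' (fun p => g0 _)).
transitivity (\int[mu]_r (\int[mu]_s g (r, s) + \int[mu]_s g (s, r))).
  transitivity (\int[mu]_(r in `[0%R, t]) \int[mu]_(s in `]0%R, t]) f (r, s)).
    apply: eq_integral => r _; rewrite -integral_itv_obnd_cbnd//.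
    exact: (measurable_funTS (mf1 r)).
  rewrite -integral_itv_obnd_cbnd; last exact: (measurable_funTS mIf).
  rewrite integral_itv_if; apply: eq_integral => r _.
  rewrite -ge0_integralD//.
  case: ifPn => [/andP[r0 rt]|rn].
    rewrite integral_itv_if; apply: eq_integral => s _; rewrite /g /=.
    rewrite r0 rt andbT /=.
    have [sr|rs|->] := ltgtP s r.
    - by rewrite andbT addr0 ; case: ifPn => [/andP[->]//|]; rewrite (le_trans (ltW sr) rt) andbT => /negbTE->.
    - by rewrite andbF add0e (lt_trans r0 rs) fsym.
    - by rewrite fdiag andbF adde0; case: ifP.
  rewrite [RHS]integral0_eq// => s _; rewrite /g /=.
  have -> : ((0 < s < r) && (r <= t) = false)%R.
    by apply/negbTE; apply: contra rn => /andP[/andP[s0 sr] ->]; rewrite (lt_trans s0 sr).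
  have -> : ((0 < r < s) && (s <= t) = false)%R.
    by apply/negbTE; apply: contra rn => /andP[/andP[-> rs] st]; rewrite (le_trans (ltW rs) st).
  by rewrite adde0.
rewrite ge0_integralD//; last 2 first.
- by move=> r _; exact: integral_ge0.
- by move=> r _; exact: integral_ge0.
rewrite -[X in _ + X](fubini_tonelli (m1 := mu) (m2 := mu) g mg g0).
rewrite [X in _ * X](_ : _ = \int[mu]_r \int[mu]_s g (r, s)).
  by rewrite mule_natl mule2n.
rewrite integral_itv_if; apply: eq_integral => r _.
case: ifPn => rt.
  apply: eq_integral => s _; rewrite /g/=.
  by case/andP: rt => r0 ->; rewrite andbT.
rewrite integral0_eq// => s _; rewrite /g/=; case: ifP => // /andP[/andP[s0 sr] rt'].
by rewrite rt' (lt_trans s0 sr) in rt.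
Qed.

Lemma ge0_integral_itv_swap d (T : measurableType d) (m : {sigma_finite_measure set T -> \bar R})
    (G : RT -> T -> \bar R) (t : R) :
  measurable_fun [set: RT * T] (fun q => G q.1 q.2) -> (forall r w, 0 <= G r w) ->
  measurable_fun setT (fun w => \int[mu]_(r in `]0%R, t]) G r w) /\
  \int[m]_w \int[mu]_(r in `]0%R, t]) G r w =
  \int[mu]_(r in `]0%R, t]) \int[m]_w G r w.
Proof.
move=> mG G0; pose g (q : RT * T) := if (0 < q.1 <= t)%R then G q.1 q.2 else 0.
have mg : measurable_fun setT g.
  apply: measurable_fun_ifT => //.
  by apply: measurable_and; [apply: measurable_fun_ltr|apply: measurable_fun_ler].
have g0 q : 0 <= g q by rewrite /g; case: ifP.
have E w : \int[mu]_(r in `]0%R, t]) G r w = \int[mu]_r g (r, w).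
  by rewrite integral_itv_if.
split.
  rewrite (_ : (fun w => _) = (fun w => \int[mu]_r g (r, w))); last by apply/funext.
  exact: (measurable_fun_fubini_tonelli_G (m1 := mu) g mg g0).
under eq_integral do rewrite E.
rewrite -(fubini_tonelli (m1 := mu) (m2 := m) g mg g0) integral_itv_if.
apply: eq_integral => r _; rewrite /g /=; case: ifP => // _.
by rewrite integral0_eq.
Qed.

End symmetric_square.

(** * The pair kernel *)
Section pair_kernel.
Context {R : realType} (d : nat) d0 (Omega : measurableType d0).
Local Notation rV := 'rV[R]_d.
Local Notation RT := (measurableTypeR R).
Context (X : R -> Omega -> rV) (N : set Omega) (b : R) (gamma : rV -> \bar R).
Hypothesis mN : measurable N.
Hypothesis mX : forall t, 0 <= t -> measurable_fun setT (X t).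
Hypothesis cX : forall w, ~ N w -> cadlag (fun t => X t w).
Hypothesis mgamma : measurable_fun setT gamma.
Hypothesis gamma_ge0 : forall x, (0 <= gamma x)%E.
Hypothesis gammaN : forall x, gamma (- x) = gamma x.
Hypothesis b0 : 0 < b.

(** A jointly measurable version of the integrand, equal to it off [N]. *)
Definition pair_kernel (r s : RT) (w : Omega) : \bar R :=
  if w \in N then 0%E else
  ((`|r - s| `^ (- b))%:E *
   gamma (path_version X N (r, w) - path_version X N (s, w))%R)%E.

Lemma pair_kernel_ge0 r s w : (0 <= pair_kernel r s w)%E.
Proof.
by rewrite /pair_kernel; case: ifP => // _; rewrite mule_ge0// lee_fin powR_ge0.
Qed.

Lemma measurable_pair_kernel :
  measurable_fun [set: (RT * RT) * Omega] (fun q => pair_kernel q.1.1 q.1.2 q.2).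
Proof.
have m11 : measurable_fun [set: (RT * RT) * Omega] (fun q => q.1.1).
  exact: (measurableT_comp measurable_fst measurable_fst).
have m12 : measurable_fun [set: (RT * RT) * Omega] (fun q => q.1.2).
  exact: (measurableT_comp measurable_snd measurable_fst).
have mY := measurable_path_version mN mX cX.
have mY1 : measurable_fun [set: (RT * RT) * Omega] (fun q => path_version X N (q.1.1, q.2)).
  by apply: (measurableT_comp mY); exact: measurable_fun_pair.
have mY2 : measurable_fun [set: (RT * RT) * Omega] (fun q => path_version X N (q.1.2, q.2)).
  by apply: (measurableT_comp mY); exact: measurable_fun_pair.
apply: measurable_fun_ifT => //.
- apply: (measurableT_comp (f := fun w => w \in N)); last exact: measurable_snd.
  apply: (@measurable_fun_bool _ _ _ _ true); rewrite setTI.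
  rewrite (_ : _ @^-1` _ = N)//.
  by apply/seteqP; split => w /=; [exact: set_mem|exact: mem_set].
- apply: emeasurable_funM; last exact: (measurableT_comp mgamma (rV_measurable_sub mY1 mY2)).
  apply/measurable_EFinP; apply: (measurableT_comp (measurable_powRN b)).
  by apply: measurableT_comp => //; exact: measurable_funB.
Qed.

Lemma pair_kernel_sym r s w : pair_kernel r s w = pair_kernel s r w.
Proof. by rewrite /pair_kernel distrC -gammaN opprB. Qed.

(** At time difference 0 the weight is [0 `^ (- b) = 0], which absorbs [gamma 0]. *)
Lemma pair_kernel_diag r w : pair_kernel r r w = 0%E.
Proof.
rewrite /pair_kernel; case: ifP => // _.
by rewrite subrr normr0 powR0 ?mul0e// oppr_eq0 gt_eqF.
Qed.

Lemma pair_kernelE r s w : ~ N w -> 0 <= r -> 0 <= s ->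
  pair_kernel r s w = ((`|r - s| `^ (- b))%:E * gamma (X r w - X s w)%R)%E.
Proof.
move=> Nw r0 s0; have wN : (w \in N) = false by apply/negP => /set_mem.
by rewrite /pair_kernel /path_version/= wN r0 s0.
Qed.

Lemma pair_kernel_le r s w : 0 <= r -> 0 <= s ->
  (pair_kernel r s w <= (`|r - s| `^ (- b))%:E * gamma (X r w - X s w)%R)%E.
Proof.
move=> r0 s0; have [Nw|Nw] := pselect (N w); last by rewrite pair_kernelE.
by rewrite /pair_kernel mem_set// mule_ge0// lee_fin powR_ge0.
Qed.

End pair_kernel.

(** * Exponential integrability *)
Section exponential_moment.
Context {R : realType} (d : nat) (hd : (1 <= d)%N) (b : R) (hb : 0 < b < 1).
Local Notation rV := 'rV[R]_d.
Local Notation RT := (measurableTypeR R).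
Local Notation mu := (@lebesgue_measure R).
Context d0 (Omega : measurableType d0) (P : probability Omega R).
Context (X : R -> Omega -> rV) (Psi : rV -> R) (gamma : rV -> \bar R) (ghat : rV -> R).
Hypothesis hX : levy_process P X.
Hypothesis hPsi : characteristic_exponent P X Psi.
Hypothesis hgamma : correlation_function gamma ghat.
Hypothesis hDalang : (\int[leb_rV d]_xi
     ((1 + Psi xi `^ (1 - b))^-1 * ghat xi)%R%:E < +oo)%E.
Context (N : set Omega).
Hypothesis mN : measurable N.
Hypothesis cX : forall w, ~ N w -> cadlag (fun t => X t w).
Local Open Scope ereal_scope.

Let mX t : (0 <= t)%R -> measurable_fun setT (X t).
Proof. exact: levy_measurable hX t. Qed.

Let mgamma : measurable_fun setT gamma := measurable_correlation hgamma.

Let gamma_ge0 x : 0 <= gamma x.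
Proof. exact: correlation_ge0 hgamma x. Qed.

Let b0 : (0 < b)%R. Proof. by case/andP: hb. Qed.

Local Notation h := (pair_kernel X N b gamma).
Local Notation k := (time_kernel Psi b ghat).

Let h_ge0 r s w : 0 <= h r s w.
Proof. exact: pair_kernel_ge0. Qed.

Let mh : measurable_fun [set: (RT * RT) * Omega] (fun q => h q.1.1 q.1.2 q.2).
Proof. exact: measurable_pair_kernel. Qed.

Let lee_prod (n : nat) (f g : 'I_n -> \bar R) : (forall i, 0 <= f i) ->
  (forall i, f i <= g i) -> \prod_(i < n) f i <= \prod_(i < n) g i.
Proof.
move=> f0 fg.
suff : 0 <= \prod_(i < n) f i /\ \prod_(i < n) f i <= \prod_(i < n) g i by case.
elim/big_ind2 : _ => [|x1 x2 y1 y2 [x0 xy] [y0 yy]|i _] //.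
by split; [exact: mule_ge0|exact: lee_pmul].
Qed.

Let mhr (r : RT) : measurable_fun [set: RT * Omega] (fun p => h r p.1 p.2).
Proof.
apply: (measurableT_comp mh (g := fun p : RT * Omega => ((r, p.1), p.2))).
apply: measurable_fun_pair; last exact: measurable_snd.
by apply: measurable_fun_pair => //; exact: measurable_fst.
Qed.

(** The time weight is measured from the fixed last time [r] whereas the
    increments are consecutive; as the weight decreases, shortening
    [r - tt i] to [tt i.+1 - tt i] only increases it. *)
Lemma pair_kernel_moment_le (r : R) n (tt : nat -> R) : (0 <= tt 0%N)%R ->
  (forall i, (tt i < tt i.+1)%R) -> tt n = r ->
  \int[P]_w \prod_(i < n) h r (tt i) w <= \prod_(i < n) k (tt i.+1 - tt i)%R.
Proof.
move=> tt0 tti ttn.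
have ttS i j : (i <= j)%N -> (tt i <= tt j)%R.
  move=> /subnK <-; elim: (j - i)%N => // m IH.
  by rewrite addSn (le_trans IH)// ltW.
have tt_ge0 i : (0 <= tt i)%R by rewrite (le_trans tt0)// ttS.
pose c i := ((r - tt i) `^ (- b))%R.
have mg i : measurable_fun setT (fun w => gamma (X (tt n) w - X (tt i) w)%R).
  by apply: (measurableT_comp mgamma); apply: rV_measurable_sub; exact: mX.
apply: (@le_trans _ _ (\int[P]_w ((\prod_(i < n) c i)%:E *
    \prod_(i < n) gamma (X (tt n) w - X (tt i) w)%R))).
  apply: ge0_le_integral => //.
  - by move=> w _; apply: prode_ge0.
  - apply: emeasurable_prod => i.
    exact: (measurableT_comp (mhr r) (pair1_measurable (tt i : RT))).
  - by apply: measurable_funeM; apply: emeasurable_prod.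
  - move=> w _; rewrite -prodEFin -big_split/=; apply: lee_prod => // i.
    rewrite ttn; apply: (le_trans (pair_kernel_le _ _ _ _ _ _ _)) => //.
      by rewrite -ttn.
    by rewrite ger0_norm// subr_ge0 -ttn ttS// ltnW.
rewrite ge0_integralZl//; last 3 first.
- by apply: emeasurable_prod.
- by move=> w _; apply: prode_ge0.
- by rewrite lee_fin; apply: prodr_ge0 => i _; exact: powR_ge0.
rewrite -prodEFin.
apply: (@le_trans _ _ ((\prod_(i < n) (c i)%:E) *
    \prod_(i < n) correlation_decay Psi ghat (tt i.+1 - tt i)%R)).
  rewrite lee_wpmul2l//.
    by apply: prode_ge0 => i _; rewrite lee_fin powR_ge0.
  apply: (expectation_prod_correlation_le mX (levy_independent hX) mgamma gamma_ge0
    (K := correlation_decay Psi ghat)) => //.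
  - by move=> s; exact: correlation_decay_ge0.
  - by move=> s t y; exact: (expectation_increment_le hX hPsi hd hgamma).
rewrite -big_split/=; apply: lee_prod => i.
  by rewrite mule_ge0// ?correlation_decay_ge0// lee_fin powR_ge0.
rewrite lee_wpmul2r// ?correlation_decay_ge0// lee_fin /c !powRN.
have p1 : (0 < tt i.+1 - tt i)%R by rewrite subr_gt0.
have p2 : (tt i.+1 - tt i <= r - tt i)%R by rewrite lerD2r -ttn ttS.
rewrite lef_pV2 ?posrE ?powR_gt0// ?(lt_le_trans p1)//.
by rewrite ge0_ler_powR ?nnegrE// ltW// (lt_le_trans p1).
Qed.

Let I1 (r : RT) (w : Omega) := iterated (h r) 1 r w.

Let I1E r w : I1 r w = \int[mu]_s (if (0 < s < r)%R then h r s w else 0).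
Proof.
rewrite /I1 iteratedS; apply: eq_integral => s _.
by case: ifP => // _; rewrite iterated0 mule1.
Qed.

Let I1_ge0 r w : 0 <= I1 r w.
Proof. exact: iterated_ge0. Qed.

Let mI1 : measurable_fun [set: RT * Omega] (fun q => I1 q.1 q.2).
Proof.
pose F (q : (RT * Omega) * RT) : \bar R :=
  if (0 < q.2 < q.1.1)%R then h q.1.1 q.2 q.1.2 else 0.
have m11 : measurable_fun [set: (RT * Omega) * RT] (fun q => q.1.1).
  exact: (measurableT_comp measurable_fst measurable_fst).
have mF : measurable_fun setT F.
  apply: measurable_fun_ifT => //.
    by apply: measurable_and; exact: measurable_fun_ltr.
  apply: (measurableT_comp mh (g := fun q : (RT * Omega) * RT => ((q.1.1, q.2), q.1.2))).
  apply: measurable_fun_pair.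
    by apply: measurable_fun_pair => //; exact: measurable_snd.
  exact: (measurableT_comp measurable_snd measurable_fst).
have F0 q : 0 <= F q by rewrite /F; case: ifP.
rewrite (_ : (fun q => _) = (fun q => \int[mu]_s F (q, s))); last first.
  by apply/funext => q; rewrite I1E.
exact: (measurable_fun_fubini_tonelli_F (m2 := mu) F mF F0).
Qed.

(** For a fixed last time [r] the inner integral runs over [0 < s < r] and
    involves increments ending at the same point [X r]. *)
Lemma double_integral_iterated (t : R) w : ~ N w ->
  \int[mu]_(r in `[0%R, t]) \int[mu]_(s in `[0%R, t])
      ((`|r - s| `^ (- b))%R%:E * gamma (X r w - X s w)%R) =
  2%:E * \int[mu]_(r in `]0%R, t]) iterated (h r) 1 r w.
Proof.
move=> Nw.
transitivity (\int[mu]_(r in `[0%R, t]) \int[mu]_(s in `[0%R, t]) h r s w).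
  apply: eq_integral => r; rewrite mem_setE in_itv/= => /andP[r0 _].
  apply: eq_integral => s; rewrite mem_setE in_itv/= => /andP[s0 _].
  by rewrite pair_kernelE.
have mhw : measurable_fun [set: RT * RT] (fun p => h p.1 p.2 w).
  exact: (measurableT_comp mh (pair2_measurable w)).
have hsym r s : h r s w = h s r w.
  by apply: pair_kernel_sym; exact: correlation_sym hgamma.
have hdiag r : h r r w = 0 by exact: pair_kernel_diag.
rewrite [LHS](ge0_integral_square_sym t mhw (fun p => h_ge0 p.1 p.2 w) hsym hdiag).
apply: (congr1 (fun z => 2%:E * z)).
apply: eq_integral => r _.
exact: esym (I1E r w).
Qed.

(** The damping parameter is chosen so that the geometric series of Khasminskii's
    argument has ratio at most 1/2; it depends on [t] but not on [r]. *)
Lemma expectation_iterated_le (t theta : R) : (0 < t)%R -> (0 < theta)%R ->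
  exists C : R, forall r, (0 < r <= t)%R ->
    \int[P]_w expeR (theta%:E * iterated (h r) 1 r w) <= C%:E.
Proof.
move=> t0 th0.
have mk := measurable_time_kernel hX hPsi b hgamma.
have delta0 : (0 < 2^-1 / theta)%R by rewrite divr_gt0.
have [M HM] := exp_damping mk (fun s => time_kernel_ge0 Psi b ghat s) delta0
   (integral_time_kernel_lty hX hPsi hb hgamma hDalang t0).
exists (2 * expR (M%:R * t))%R => r /andP[r0 rt].
apply: (@le_trans _ _ (2 * expR (M%:R * r))%:E).
  apply: (khasminskii (mhr r) (h_ge0 r) mk (fun s => time_kernel_ge0 Psi b ghat s) rt _ HM) => //.
  - by move=> n tt; exact: pair_kernel_moment_le.
  - by rewrite mulrC divfK ?gt_eqF.
  - exact: ltW.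
by rewrite lee_fin ler_wpM2l// ler_expR ler_wpM2l.
Qed.

(** Jensen's inequality in the last time [r] reduces the double integral to
    single ones, at the price of multiplying the exponent by [2 t]. *)
Lemma expectation_double_integral_lty (t lambda : R) : P N = 0 ->
  (0 < t)%R -> (0 < lambda)%R ->
  \int[P]_w expeR (lambda%:E *
     \int[mu]_(r in `[0%R, t]) \int[mu]_(s in `[0%R, t])
         ((`|r - s| `^ (- b))%R%:E * gamma (X r w - X s w)%R)) < +oo.
Proof.
move=> N0 t0 l0.
pose theta := (t * (2 * lambda))%R.
have th0 : (0 < theta)%R by rewrite !mulr_gt0.
have [C HC] := expectation_iterated_le t0 th0.
pose G (r : RT) w := expeR (theta%:E * I1 r w).
have mG : measurable_fun [set: RT * Omega] (fun q => G q.1 q.2).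
  exact: (measurableT_comp measurable_expeR (measurable_funeM _ mI1)).
have G0 r w : 0 <= G r w by exact: expeR_ge0.
have [mIG swap] := ge0_integral_itv_swap P t mG G0.
have tV0 : (0 <= t^-1)%R by rewrite invr_ge0 ltW.
have GI0 w : 0 <= \int[mu]_(r in `]0%R, t]) G r w by exact: integral_ge0.
apply: (@le_lt_trans _ _ (\int[P]_w (t^-1%:E * \int[mu]_(r in `]0%R, t]) G r w))).
  apply: (@integral_le_of_ae _ _ _ _ N) => //.
  - exact: measurable_funeM.
  - by move=> w; rewrite mule_ge0// lee_fin.
  - by move=> w; exact: expeR_ge0.
  move=> w Nw; rewrite double_integral_iterated//.
  have mIw : measurable_fun setT (fun r => I1 r w).
    exact: (measurableT_comp mI1 (pair2_measurable w)).
  have -> : lambda%:E * (2%:E * \int[mu]_(r in `]0%R, t]) iterated (h r) 1 r w) =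
      \int[mu]_(r in `]0%R, t]) ((2 * lambda)%:E * I1 r w).
    rewrite (@ge0_integralZl _ _ _ mu _ _ (fun r => I1 r w))//.
    - by rewrite muleA -EFinM [(lambda * 2)%R]mulrC.
    - exact: (measurable_funTS mIw).
    - by rewrite lee_fin mulr_ge0// ltW.
  apply: (le_trans (expeR_integral_le (f := fun r => (2 * lambda)%:E * I1 r w) t0 _ _)).
  - exact: measurable_funeM.
  - by move=> r; rewrite mule_ge0// lee_fin mulr_ge0// ltW.
  - by under eq_integral do rewrite muleA -EFinM.
rewrite ge0_integralZl//.
rewrite swap; apply: (@le_lt_trans _ _ (t^-1%:E * \int[mu]_(r in `]0%R, t]) `|C|%:E)).
  rewrite lee_wpmul2l//; apply: ge0_le_integral => //.
  - by move=> r _; exact: integral_ge0.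
  - apply: measurable_funTS.
    exact: (measurable_fun_fubini_tonelli_F (m2 := P) (fun q => G q.1 q.2) mG (fun q => G0 _ _)).
  - move=> r /=; rewrite in_itv/= => rt; apply: (le_trans (HC r rt)).
    by rewrite lee_fin ler_norm.
rewrite integral_cst//= [X in _ * (_ * X)](_ : _ = t%:E).
  by rewrite -!EFinM ltry.
by rewrite lebesgue_measure_itv/= lte_fin t0 oppr0 adde0.
Qed.

End exponential_moment.

Theorem theorem3p3 (R : realType) (d : nat) (hd : (1 <= d)%N)
  (beta0 : R) (hbeta0 : 0 < beta0 < 1)
  (dO : measure_display) (Omega : measurableType dO) (P : probability Omega R)
  (X : R -> Omega -> 'rV[R]_d)
  (hX : levy_process P X) (hXsym : symmetric_process P X)
  (hXq : has_transition_densities P X)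
  (Psi : 'rV[R]_d -> R) (hPsi : characteristic_exponent P X Psi)
  (gamma : 'rV[R]_d -> \bar R) (ghat : 'rV[R]_d -> R)
  (hgamma : correlation_function gamma ghat)
  (hDalang : (\int[leb_rV d]_xi
     ((1 + Psi xi `^ (1 - beta0))^-1 * ghat xi)%R%:E < +oo)%E)
  (t lambda : R) (ht : 0 < t) (hlambda : 0 < lambda) :
  (\int[P]_w expeR (lambda%:E *
     \int[lebesgue_measure]_(r in `[0%R, t])
       \int[lebesgue_measure]_(s in `[0%R, t])
         ((`|r - s| `^ (- beta0))%R%:E * gamma (X r w - X s w)%R)) < +oo)%E.
Proof.
have [N [mN N0 badN]] := levy_cadlag hX.
apply: (expectation_double_integral_lty hd hbeta0 hX hPsi hgamma hDalang mN) => //.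
by move=> w Nw; apply: contrapT => bad; apply: Nw; exact: badN.
Qed.
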